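(* Let $d\geq 1$, let $p=p_d=\frac{2d+1}{4d}$, let $(S_n)$ be the $d$-dimensional elephant random walk with memory parameter $p$, and let $G_n=\frac{1}{n}\sum_{k=1}^n S_k$. Then $$\lim_{n\to\infty}\frac{1}{\log\log n}\sum_{k=2}^n\frac{1}{(k\log k)^2}G_kG_k^T=\frac{4}{9d}I_d\quad\text{a.s.},$$ in particular $$\lim_{n\to\infty}\frac{1}{\log\log n}\sum_{k=2}^n\frac{\|G_k\|^2}{(k\log k)^2}=\frac{4}{9}\quad\text{a.s.},$$ and moreover $$\limsup_{n\to\infty}\frac{\|G_n\|^2}{2n\log n\log\log\log n}=\frac{4}{9d}\quad\text{a.s.}$$
   Context: The $d$-dimensional elephant random walk (ERW) with memory parameter $p\in[0,1]$ is defined as follows. Let $e_1,\dots,e_d$ be the standard basis of $\mathbb{R}^d$; the $2d$ directions are $\pm e_1,\dots,\pm e_d$. Set $S_0=0$. The first step $X_1$ is uniformly distributed on the $2d$ directions. For $n\geq 1$, given $X_1,\dots,X_n$, an index $k$ is chosen uniformly at random in $\{1,\dots,n\}$, and then $X_{n+1}=X_k$ with probability $p$, while $X_{n+1}$ equals each of the $2d-1$ remaining directions with probability $(1-p)/(2d-1)$. The position is $S_{n+1}=S_n+X_{n+1}$. $I_d$ is the identity matrix of order $d$ and $\|\cdot\|$ the Euclidean norm. *)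

(* Defs.v *)
From HB Require Import structures.
From mathcomp Require Import all_boot all_order all_algebra.
From mathcomp Require Import all_classical all_reals all_analysis.
Set Implicit Arguments. Unset Strict Implicit. Unset Printing Implicit Defensive.
Import Order.TTheory GRing.Theory Num.Theory.
Import numFieldNormedType.Exports.
Local Open Scope classical_set_scope.
Local Open Scope ring_scope.

(* A direction in Z^d : a coordinate index and a sign (true = +e_i, false = -e_i).
   There are exactly 2d directions. *)
Definition dir (d : nat) := ('I_d * bool)%type.

Definition dirvec (R : ringType) (d : nat) (x : dir d) : 'cV[R]_d :=
  \col_(i < d) (if i == x.1 then (if x.2 then 1 else -1) else 0).

Definition erw_trans (R : realFieldType) (d : nat) (p : R) (n : nat)
  (x : nat -> dir d) (y : dir d) : R :=
  n%:R^-1 * \sum_(1 <= k < n.+1)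
     (if x k == y then p else (1 - p) / (2 * d%:R - 1)).

Fixpoint erw_path_prob (R : realFieldType) (d : nat) (p : R) (n : nat)
  (x : nat -> dir d) : R :=
  match n with
  | 0 => 1
  | 1 => (2 * d%:R)^-1
  | m.+1 => erw_path_prob p m x * erw_trans p m x (x m.+1)
  end.

(* (X k)_{k >= 1} (X 0 is irrelevant) is a d-dimensional elephant random walk
   with memory parameter p on the probability space (T, P): every step is a
   random variable with values in the 2d directions, and the joint law of
   (X 1, ..., X n) is the one determined by the ERW dynamics. *)
Definition is_ERW (R : realType) (dT : measure_display) (T : measurableType dT)
  (P : probability T R) (d : nat) (p : R) (X : nat -> T -> dir d) : Prop :=
  (forall k (y : dir d), measurable [set w | X k w = y]) /\
  (forall n (x : nat -> dir d),
      P [set w | forall k, (1 <= k <= n)%N -> X k w = x k]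
      = (erw_path_prob p n x)%:E).

Definition ERW_pos (R : ringType) (T : Type) (d : nat) (X : nat -> T -> dir d)
  (n : nat) (w : T) : 'cV[R]_d :=
  \sum_(1 <= k < n.+1) dirvec R (X k w).

Definition ERW_center (R : fieldType) (T : Type) (d : nat) (X : nat -> T -> dir d)
  (n : nat) (w : T) : 'cV[R]_d :=
  n%:R^-1 *: \sum_(1 <= k < n.+1) ERW_pos R X k w.

Definition sqnorm (R : ringType) (d : nat) (v : 'cV[R]_d) : R :=
  \sum_(i < d) v i 0 ^+ 2.

(* Main.v *)
(** At the critical memory parameter the next step copies a uniformly chosen
    past step with probability 1/2 and is uniform otherwise.  Hence, for every
    centered observable [g] of the directions, [S_n = g(X_1) + ... + g(X_n)]
    satisfies [E(S_{n+1} | F_n) = (1 + 1/(2n)) S_n], and up to a bounded term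
    [S_n / sqrt n] is a martingale with bracket [H_n var g], where the harmonic
    number [H_n] plays the role of the clock.

    The center of mass is exactly
    [G_n = (2/3) ((1 + 1/(2n)) S_n - R_n / n)] with [R_n] a martingale of order
    [n^(3/2)], which is negligible, so that everything reduces to [S_n].

    - Quadratic strong law: expanding [S_n^2 / (n H_n)] gives
      [sum S_k^2 / (k^2 H_k^2) = var g * ln H_n + N_n + o(ln H_n)], and the
      martingale [N_n] has the left-hand side as its bracket, so an exponential
      supermartingale makes it negligible.
    - Upper bound: exponential supermartingales at geometric clock scales,
      for finitely many directions on a grid.
    - Lower bound: projecting on [(1, ..., 1)] gives the one-dimensional walk.
      On clock blocks growing like [j!], tilting the steps by a drift and the
      entropy inequality bound from below the conditional probability of a
      large increment by [1/j], and a conditional Borel-Cantelli argument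
      concludes. *)

Require Import Defs.
From HB Require Import structures.
From mathcomp Require Import all_boot all_order all_algebra.
From mathcomp Require Import all_classical all_reals all_analysis.
From mathcomp Require Import ring lra zify.
Set Implicit Arguments. Unset Strict Implicit. Unset Printing Implicit Defensive.
Import Order.TTheory GRing.Theory Num.Theory.
Import numFieldNormedType.Exports.
Local Open Scope classical_set_scope.
Local Open Scope ring_scope.

(** * History-dependent kernels on a finite alphabet *)

Section Kernel.
Variables (R : realType) (A : finType) (q : seq A -> A -> R).
Implicit Types (F G Z : seq A -> R) (h : seq A).

(** No filtration and no conditional expectation appears: an event about the first [n] steps is a
    boolean function of a list, its probability is an [n]-fold iterate of a kernel operator, and
    outside the lower bound every almost sure estimate rests on one maximal inequality for
    nonnegative supermartingales. An obstacle common to the limit laws is that the conditional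
    second moment of [g] is itself random: it is [var g] plus a multiple of the empirical mean of
    the centered observable [g^2 - var g], so cruder estimates for that observable have to come
    first. The harmonic clock is preferred to the logarithm because its increments are exactly
    [1/(n+1)], which lets potentials and weights telescope exactly. The factor [2/3] is
    [1/(1 + 1/2)], from summing a growth of order [sqrt n]; its square is the [4/9], and [1/d] is
    the variance of a uniform step along a unit vector. *)

Definition kstep F h : R := \sum_(y : A) q h y * F (y :: h).

Definition stochastic := (forall h y, 0 <= q h y) /\ (forall h, \sum_y q h y = 1).

Hypothesis qP : stochastic.

Lemma kstep_le F G h : (forall y, F (y :: h) <= G (y :: h)) -> kstep F h <= kstep G h.
Proof. by move=> FG; apply: ler_sum => y _; apply: ler_wpM2l => //; case: qP. Qed.

Lemma kstep_cst c h : kstep (fun=> c) h = c.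
Proof. by rewrite /kstep -mulr_suml; case: qP => _ ->; rewrite mul1r. Qed.

Lemma kstepD F G h : kstep (fun h' => F h' + G h') h = kstep F h + kstep G h.
Proof. by rewrite /kstep -big_split /=; apply: eq_bigr => y _; rewrite mulrDr. Qed.

Lemma kstepZ c F h : kstep (fun h' => c * F h') h = c * kstep F h.
Proof. by rewrite /kstep mulr_sumr; apply: eq_bigr => y _; rewrite mulrCA. Qed.

Lemma eq_kstep F G h : (forall y, F (y :: h) = G (y :: h)) -> kstep F h = kstep G h.
Proof. by move=> FG; apply: eq_bigr => y _; rewrite FG. Qed.

Lemma iter_kstep_le n F G h :
  (forall s, size s = n -> F (s ++ h) <= G (s ++ h)) ->
  iter n kstep F h <= iter n kstep G h.
Proof.
elim: n h => [|n IH] h FG /=; first exact: (FG [::]).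
apply: kstep_le => y; apply: IH => s sn.
by have := FG (rcons s y); rewrite size_rcons sn cat_rcons; apply.
Qed.

Lemma iter_kstep_supermartingale Z n h :
  (forall h, kstep Z h <= Z h) -> iter n kstep Z h <= Z h.
Proof.
move=> KZ; elim: n h => [//|n IH] h /=; apply: le_trans (KZ h).
exact: kstep_le.
Qed.

Lemma iter_kstep_cst n c h : iter n kstep (fun=> c) h = c.
Proof.
elim: n h => [//|n IH] h /=.
by rewrite -[RHS](kstep_cst c h); apply: eq_kstep => y; rewrite IH.
Qed.

Lemma iter_kstepD n F G h :
  iter n kstep (fun h' => F h' + G h') h = iter n kstep F h + iter n kstep G h.
Proof. by elim: n h => [//|n IH] h /=; rewrite -kstepD; apply: eq_kstep => y; rewrite IH. Qed.

Lemma iter_kstepZ n c F h :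
  iter n kstep (fun h' => c * F h') h = c * iter n kstep F h.
Proof. by elim: n h => [//|n IH] h /=; rewrite -kstepZ; apply: eq_kstep => y; rewrite IH. Qed.

Lemma eq_iter_kstep n F G h :
  (forall s, size s = n -> F (s ++ h) = G (s ++ h)) ->
  iter n kstep F h = iter n kstep G h.
Proof.
by move=> FG; apply/eqP; rewrite eq_le !iter_kstep_le // => s sn; rewrite FG.
Qed.

(** Taking out what is known: dropping the [n] newest steps gives back [h], so the factor [G] is
    constant along the iteration. *)
Lemma iter_kstep_drop n F G h :
  iter n kstep (fun h' => G (drop n h') * F h') h = G h * iter n kstep F h.
Proof.
rewrite -iter_kstepZ; apply: eq_iter_kstep => s sn.
by rewrite -sn drop_size_cat.
Qed.

Fixpoint hits (B : pred (seq A)) h : bool :=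
  B h || (if h is _ :: h' then hits B h' else false).

Lemma ville (Z : seq A -> R) (lam : R) n :
  0 < lam -> (forall h, 0 <= Z h) -> (forall h, kstep Z h <= Z h) ->
  iter n kstep (fun h => (hits (fun h => lam <= Z h) h)%:R) [::] <= Z [::] / lam.
Proof.
move=> lam0 Z0 KZ; set B := fun h => lam <= Z h.
pose V h := if hits B h then 1 else Z h / lam.
have V_le h : V h <= Z h / lam \/ hits B h by rewrite /V; case: ifP; [right|left].
have KV h : kstep V h <= V h.
  rewrite {2}/V; case: ifPn => hB.
    rewrite -[leRHS](kstep_cst 1 h); apply: kstep_le => y.
    by rewrite /V /= hB orbT.
  apply: (@le_trans _ _ (lam^-1 * kstep Z h)); last first.
    by rewrite mulrC; apply: ler_wpM2r (KZ h); rewrite invr_ge0 ltW.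
  rewrite -kstepZ; apply: kstep_le => y; rewrite /V /= (negbTE hB) orbF [leRHS]mulrC.
  by case: ifPn => // By; rewrite ler_pdivlMr // mul1r.
apply: le_trans (_ : iter n kstep V [::] <= _).
  apply: iter_kstep_le => s _; rewrite /V; case: ifP => //= _.
  by rewrite mulr_ge0 // invr_ge0 ltW.
apply: le_trans (iter_kstep_supermartingale n [::] KV) _.
rewrite /V; case: ifPn => //=; rewrite orbF => BZ.
by rewrite ler_pdivlMr // mul1r.
Qed.

End Kernel.

(** * The law of the walk as a history-dependent kernel *)

(** At the critical parameter [(1 - p) / (2 d - 1) = 1 / (4 d)] and [p = 1 / 2 + 1 / (4 d)], so the
    law is half the empirical frequency plus half the uniform one. The empty history needs its own
    clause: the general formula would have total mass [1 / 2] there. *)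
Definition erwq (R : realType) (d : nat) (h : seq (dir d)) (y : dir d) : R :=
  if h is [::] then (2 * d%:R)^-1
  else (count_mem y h)%:R / (2 * (size h)%:R) + (4 * d%:R)^-1.

Section ErwKernel.
Variables (R : realType) (d : nat).
Hypothesis d0 : (0 < d)%N.
Let dR : (0 : R) < d%:R. Proof. by rewrite ltr0n. Qed.
Let dRn : d%:R != 0 :> R. Proof. by rewrite gt_eqF. Qed.

Lemma card_dir : #|{: dir d}| = (2 * d)%N.
Proof. by rewrite card_prod card_ord card_bool mulnC. Qed.

Lemma sum_count (h : seq (dir d)) (g : dir d -> R) :
  \sum_y (count_mem y h)%:R * g y = \sum_(x <- h) g x.
Proof.
elim: h => [|x h IH]; first by rewrite big_nil big1 // => y _; rewrite mul0r.
rewrite big_cons -IH -(big_pred1_eq +%R x g) [X in _ = X + _]big_mkcond -big_split /=.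
apply: eq_bigr => y _ /=; rewrite natrD mulrDl (eq_sym x).
by case: eqP; rewrite ?mul1r ?mul0r.
Qed.

Definition mean (g : dir d -> R) : R := (2 * d%:R)^-1 * \sum_y g y.

Definition wsum (g : dir d -> R) (h : seq (dir d)) : R := \sum_(x <- h) g x.

Lemma erwq_sum (g : dir d -> R) h : h != [::] ->
  \sum_y erwq R h y * g y = wsum g h / (2 * (size h)%:R) + mean g / 2.
Proof.
move=> hn; have qE y : erwq R h y =
    (count_mem y h)%:R / (2 * (size h)%:R) + (4 * d%:R)^-1 by case: h hn.
under eq_bigr do rewrite qE mulrDl mulrAC.
rewrite big_split /= -mulr_suml sum_count -mulr_sumr /mean; congr (_ + _).
by field.
Qed.

Lemma erwq_sum_nil (g : dir d -> R) : \sum_y erwq R [::] y * g y = mean g.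
Proof. by rewrite /erwq /mean -mulr_sumr. Qed.

Lemma erwq_stochastic : stochastic (@erwq R d).
Proof.
split=> [h y|h].
  by rewrite /erwq; case: h => [|? ?]; rewrite ?addr_ge0 // ?divr_ge0 // ?invr_ge0 ?mulr_ge0 // ?ltW.
have mean1 : mean (fun=> 1) = 1.
  rewrite /mean sumr_const card_dir -mulr_natr natrM; by field.
have [->|hn] := eqVneq h [::].
  by rewrite -[RHS]mean1 -erwq_sum_nil; apply: eq_bigr => y _; rewrite mulr1.
under eq_bigr do rewrite -[erwq _ _ _]mulr1.
rewrite erwq_sum // mean1 /wsum big_const_seq count_predT iter_addr_0.
have : (size h)%:R != 0 :> R by rewrite pnatr_eq0 size_eq0.
by move: (size h) => k k0; field.
Qed.

End ErwKernel.

Fixpoint hist (A : Type) (x : nat -> A) (n : nat) : seq A :=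
  if n is m.+1 then x n :: hist x m else [::].

Fixpoint hist_prob (R : realType) (d : nat) (h : seq (dir d)) : R :=
  if h is y :: h' then hist_prob R h' * erwq R h' y else 1.

Lemma size_hist (A : Type) (x : nat -> A) n : size (hist x n) = n.
Proof. by elim: n => //= n ->. Qed.

Lemma hist_eqP (A : Type) (x x' : nat -> A) n :
  hist x n = hist x' n <-> (forall k, (1 <= k <= n)%N -> x k = x' k).
Proof.
elim: n => [|n IH]; first by split => // _ k; case: k.
split=> /= [[xx' /IH E] k|E].
  rewrite [(k <= _)%N]leq_eqVlt => /andP[k1 /orP[/eqP-> //|kn]]; apply: E.
  by rewrite k1.
rewrite E ?leqnn //; congr (_ :: _); apply/IH => k /andP[k1 kn].
by apply: E; rewrite k1 ltnW.
Qed.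

Lemma hist_surj (A : Type) (y0 : A) (h : seq A) :
  hist (fun k => nth y0 h (size h - k)) (size h) = h.
Proof.
elim: h => //= y h IH; rewrite subSS subnn /=; congr (_ :: _).
rewrite -[RHS]IH; apply/hist_eqP => k /andP[_ kh].
by rewrite subSn.
Qed.

Lemma drop_hist (A : Type) (x : nat -> A) m n : drop m (hist x (m + n)) = hist x n.
Proof. by elim: m => [|m IH]; rewrite ?drop0 // addSn. Qed.

Section Law.
Variables (R : realType) (dT : measure_display) (T : measurableType dT).
Variables (P : probability T R) (d : nat) (X : nat -> T -> dir d).
Hypothesis d0 : (1 <= d)%N.
Let p : R := (2 * d%:R + 1) / (4 * d%:R).
Hypothesis XP : is_ERW P p X.
Let dRn : d%:R != 0 :> R. Proof. by rewrite gt_eqF // ltr0n. Qed.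

Lemma erw_trans_erwq (x : nat -> dir d) n y : erw_trans p n.+1 x y = erwq R (hist x n.+1) y.
Proof.
have d2 : 2 * d%:R - 1 != 0 :> R.
  rewrite subr_eq0 -natrM -[X in _ == X]/(1%:R) eqr_nat.
  by case: (d) d0 => // k _; rewrite mulnS.
have E m : \sum_(1 <= k < m.+1) (if x k == y then p else (1 - p) / (2 * d%:R - 1))
    = (count_mem y (hist x m))%:R / 2 + m%:R / (4 * d%:R).
  elim: m => [|m IH]; first by rewrite big_geq //= !mul0r addr0.
  rewrite big_nat_recr //= IH natrD -(natr1 m).
  by rewrite /p; case: eqP => _ /=; field; rewrite ?d2 ?dRn.
rewrite /erw_trans E /erwq [hist _ _]/= -/(hist x n.+1) [size _]/= size_hist.
have : n.+1%:R != 0 :> R by rewrite pnatr_eq0.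
by move: (n.+1%:R) => k k0; field; rewrite k0 dRn.
Qed.

Lemma erw_path_prob_hist (x : nat -> dir d) n : erw_path_prob p n x = hist_prob R (hist x n).
Proof.
elim: n => [//|[|n] IH]; first by rewrite /= mul1r.
by rewrite [LHS]/= -/(erw_path_prob p n.+1 x) IH erw_trans_erwq.
Qed.

Lemma measurable_hist (B : pred (seq (dir d))) n :
  measurable [set w | B (hist (X^~ w) n)].
Proof.
elim: n B => [|n IH] B.
  rewrite [X in measurable X](_ : _ = if B [::] then setT else set0).
    by case: ifP.
  by apply/seteqP; split => w /=; case: (B [::]).
rewrite [X in measurable X](_ : _ =
    \bigcup_(y in [set: dir d]) ([set w | X n.+1 w = y] `&` [set w | B (y :: hist (X^~ w) n)])).
  apply: fin_bigcup_measurable => [|y _]; first exact: finite_finset.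
  by apply: measurableI; [case: XP|exact: (IH (fun h => B (y :: h)))].
apply/seteqP; split => [w /= Bw|w [y _] [/= <- //]].
by exists (X n.+1 w).
Qed.

Lemma prob_hist_eq h : P [set w | hist (X^~ w) (size h) = h] = (hist_prob R h)%:E.
Proof.
have y0 : dir d by exact: (Ordinal d0, true).
have := hist_surj y0 h; set x := (fun k : nat => _) => hx.
rewrite -[in RHS]hx -erw_path_prob_hist; case: XP => _ <-.
congr (P _); apply/seteqP; split => w /=.
  by rewrite -[X in _ = X]hx => /hist_eqP.
by move=> E; rewrite -[RHS]hx; apply/hist_eqP.
Qed.

Lemma prob_split (E : set T) (Y : T -> dir d) : measurable E ->
  (forall y, measurable [set w | Y w = y]) ->
  P E = (\sum_(y : dir d) P (E `&` [set w | Y w = y]))%E.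
Proof.
move=> mE mY.
rewrite [X in P X = _](_ : _ = \bigcup_(y in [set: dir d]) (E `&` [set w | Y w = y])).
  rewrite measure_fin_bigcup //.
  - rewrite (fsbigE (index_enum (dir d))) ?index_enum_uniq //.
      by apply: eq_bigl => y; rewrite in_setT.
    by move=> y _; rewrite mem_index_enum.
  - exact: finite_finset.
  - by move=> y y' _ _ [w [[_ /= ->] [_ /=]]].
  - by move=> y _; apply: measurableI.
by apply/seteqP; split => [w Ew|w [y _] [] //]; exists (Y w).
Qed.

(** Markov property in product form. Multiplying by the probability of [h], instead of conditioning
    on it, lets the induction on [n] split over the value of the next step with [h] left general. *)
Lemma prob_hist_from (B : pred (seq (dir d))) n h :
  P [set w | hist (X^~ w) (size h) = h /\ B (hist (X^~ w) (n + size h))] =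
  (hist_prob R h * iter n (kstep (@erwq R d)) (fun h' => (B h')%:R) h)%:E.
Proof.
elim: n h => [|n IH] h.
  case Bh : (B h); rewrite add0n /= Bh ?mulr1 ?mulr0.
    rewrite -prob_hist_eq; congr (P _); apply/seteqP; split => w /=; first by case.
    by move=> hw; rewrite hw.
  rewrite -[RHS](measure0 P); congr (P _); apply/seteqP; split => w //= [->].
  by rewrite Bh.
have mE : measurable [set w | hist (X^~ w) (size h) = h /\ B (hist (X^~ w) (n.+1 + size h))].
  apply: measurableI; last exact: measurable_hist.
  rewrite [X in measurable X](_ : _ = [set w | pred1 h (hist (X^~ w) (size h))]).
    exact: measurable_hist.
  by apply/seteqP; split => w /= /eqP.
rewrite (@prob_split _ (X (size h).+1)) //; last by case: XP.
rewrite iterS [kstep _ _ _]/kstep mulr_sumr -sumEFin; apply: eq_bigr => y _.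
rewrite mulrA -[_ * erwq _ _ _]/(hist_prob R (y :: h)) -IH /= addnS.
congr (P _); apply/seteqP; split => w /=; first by move=> [[hw Bw] ->]; rewrite hw.
by move=> [[-> hw] Bw].
Qed.

Lemma prob_hist (B : pred (seq (dir d))) n :
  P [set w | B (hist (X^~ w) n)] =
  (iter n (kstep (@erwq R d)) (fun h' => (B h')%:R) [::])%:E.
Proof.
have := prob_hist_from B n [::]; rewrite addn0 mul1r => <-.
by congr (P _); apply/seteqP; split => w //= [].
Qed.

End Law.

(** * Almost sure consequences of the maximal inequality *)

Definition harm (R : realType) (n : nat) : R := \sum_(k < n) k.+1%:R^-1.

Section Harm.
Variable R : realType.
Notation H := (harm R).

Lemma harm0 : H 0 = 0. Proof. by rewrite /harm big_ord0. Qed.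
Lemma harmS n : H n.+1 = H n + n.+1%:R^-1. Proof. by rewrite /harm big_ord_recr. Qed.
Lemma harm_ge1 n : 1 <= H n.+1.
Proof.
elim: n => [|n IH]; first by rewrite harmS harm0 add0r invr1.
by rewrite harmS -[leLHS]addr0 lerD.
Qed.
Lemma harm_gt0 n : 0 < H n.+1. Proof. exact: lt_le_trans (harm_ge1 n). Qed.

Lemma harm_inv_diff n : (n.+2%:R * H n.+1 * H n.+2)^-1 = (H n.+1)^-1 - (H n.+2)^-1.
Proof.
have := harm_gt0 n; have := harm_gt0 n.+1; rewrite (harmS n.+1).
have : (0 : R) < n.+2%:R by [].
move: (n.+2%:R) (H n.+1) => k x k0 xk x0; field.
by rewrite !gt_eqF ?addr_gt0 ?mulr_gt0.
Qed.

Lemma sum_harm_inv n :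
  \sum_(0 <= k < n) (k.+2%:R * H k.+1 * H k.+2)^-1 = 1 - (H n.+1)^-1.
Proof.
elim: n => [|n IH]; first by rewrite big_geq // harmS harm0 add0r !invr1 subrr.
by rewrite big_nat_recr //= IH harm_inv_diff addrA subrK.
Qed.
End Harm.

Section AlmostSure.
Variables (R : realType) (dT : measure_display) (T : measurableType dT).
Variables (P : probability T R) (d : nat) (X : nat -> T -> dir d).
Hypothesis d0 : (1 <= d)%N.
Hypothesis XP : is_ERW P ((2 * d%:R + 1) / (4 * d%:R)) X.
Notation K := (kstep (@erwq R d)).
Notation H := (harm R).

Definition supermartingale (Z : seq (dir d) -> R) :=
  (forall h, 0 <= Z h) /\ (forall h, K Z h <= Z h).

Lemma hits_hist (B : pred (seq (dir d))) (x : nat -> dir d) n :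
  hits B (hist x n) <-> exists2 k, (k <= n)%N & B (hist x k).
Proof.
elim: n => [|n IH] /=.
  by rewrite orbF; split => [Bn|[[|k]//]]; exists 0%N.
split=> [/orP[Bn|/IH[k kn Bk]]|[k]]; first by exists n.+1.
  by exists k => //; rewrite ltnW.
rewrite leq_eqVlt => /orP[/eqP->/= -> //|kn Bk].
by apply/orP; right; apply/IH; exists k.
Qed.

Lemma ville_ae (Z : seq (dir d) -> R) (lam : R) :
  supermartingale Z -> 0 < lam ->
  exists B : set T, [/\ measurable B, (P B <= (Z [::] / lam)%:E)%E &
    forall w, ~ B w -> forall n, Z (hist (X^~ w) n) < lam].
Proof.
move=> [Z0 KZ] lam0.
pose F n := [set w | hits (fun h => lam <= Z h) (hist (X^~ w) n)].
have mF n : measurable (F n) by exact: (measurable_hist XP).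
exists (\bigcup_n F n); split; first exact: bigcupT_measurable.
  have ndF : nondecreasing_seq F.
    move=> m n mn; apply/subsetPset => w /hits_hist[k km Bk].
    by apply/hits_hist; exists k => //; exact: leq_trans mn.
  have cF := nondecreasing_cvg_mu (mu := P) mF (bigcupT_measurable _ mF) ndF.
  rewrite -(cvg_lim _ cF) //; apply: lime_le; first by apply/cvg_ex; eexists; exact: cF.
  near=> n => /=.
  by rewrite /F (prob_hist d0 XP) lee_fin; apply: ville => //; exact: erwq_stochastic.
move=> w nB n; rewrite ltNge; apply/negP => lZ; apply: nB.
by exists n => //; apply/hits_hist; exists n.
Unshelve. all: by end_near. Qed.

(** Two demands meet here: the reciprocals must be summable, and by [sum_harm_inv] they telescope to
    less than 1; and [ln (thr j)] must be asymptotic to [ln j], which keeps the constant of the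
    iterated logarithm sharp. *)
Definition thr (j : nat) : R := j.+2%:R * H j.+1 * H j.+2.

Lemma thr_gt0 j : 0 < thr j.
Proof. by rewrite /thr !mulr_gt0 ?harm_gt0. Qed.

(** Borel-Cantelli, with the [j]-th supermartingale tested at level [thr j]. The bound is uniform in
    the time [n], so that [j] can afterwards be chosen as a function of [n]. *)
Lemma ville_family_ae (J0 : nat) (Z : nat -> seq (dir d) -> R) :
  (forall j, (J0 <= j)%N -> supermartingale (Z j) /\ Z j [::] <= 1) ->
  {ae P, forall w, exists J, forall j, (J <= j)%N ->
    forall n, Z j (hist (X^~ w) n) < thr j}.
Proof.
move=> ZP.
have [B BP] : {B : nat -> set T & forall j, (J0 <= j)%N ->
   [/\ measurable (B j), (P (B j) <= (thr j)^-1%:E)%E &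
    forall w, ~ B j w -> forall n, Z j (hist (X^~ w) n) < thr j]}.
  apply: (@choice _ _ (fun j B => (J0 <= j)%N -> [/\ measurable B, (P B <= (thr j)^-1%:E)%E &
    forall w, ~ B w -> forall n, Z j (hist (X^~ w) n) < thr j])) => j.
  have [J0j|] := leqP J0 j; last by exists set0.
  have [sZ Z1] := ZP j J0j; have [B [mB PB BP]] := ville_ae sZ (thr_gt0 j).
  exists B => _; split => //; apply: le_trans PB _.
  by rewrite lee_fin -[leRHS]mul1r ler_wpM2r // invr_ge0 ltW // thr_gt0.
pose F j := if (J0 <= j)%N then B j else set0.
have mF j : measurable (F j) by rewrite /F; case: ifP => // /BP[].
have PF j : (P (F j) <= (thr j)^-1%:E)%E.
  rewrite /F; case: ifP => [/BP[] //|_].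
  by rewrite measure0 lee_fin invr_ge0 ltW // thr_gt0.
exists (lim_sup_set F); split.
- by apply: bigcap_measurable => // k _; exact: bigcup_measurable.
- apply: lim_sup_set_cvg0 => //; apply: (@le_lt_trans _ _ 1%:E); last exact: ltry.
  apply: lime_le; first exact: is_cvg_nneseries.
  near=> n; apply: (@le_trans _ _ (\sum_(0 <= j < n) (thr j)^-1%:E)%E).
    by apply: lee_sum => j _; exact: PF.
  rewrite sumEFin lee_fin sum_harm_inv lerBlDr lerDl invr_ge0 ltW //.
  exact: harm_gt0.
- move=> w /= nw n _ /=; apply: contrapT => nF; apply: nw.
  exists (maxn J0 n) => j; rewrite geq_max => /andP[J0j nj].
  have [_ _] := BP j J0j; apply => Bj; apply: nF; exists j => //=.
  by rewrite /F J0j.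
Unshelve. all: by end_near. Qed.

Lemma ville_bounded_ae (Z : seq (dir d) -> R) : supermartingale Z ->
  {ae P, forall w, exists L, forall n, Z (hist (X^~ w) n) <= L}.
Proof.
(* The constant family [c * Z] starts below 1; adding 1 avoids dividing by a zero initial value. *)
move=> [Z0 KZ]; set c := (1 + Z [::])^-1.
have c0 : 0 < c by rewrite invr_gt0 ltr_pwDl.
have : {ae P, forall w, exists J, forall j, (J <= j)%N ->
    forall n, c * Z (hist (X^~ w) n) < thr j}.
  apply: (@ville_family_ae 0 (fun _ h => c * Z h)) => j _; split; first split.
  - by move=> h; rewrite mulr_ge0 // ltW.
  - by move=> h; rewrite kstepZ; apply: ler_wpM2l => //; exact: ltW.
  - rewrite /c mulrC ler_pdivrMr ?ltr_pwDl // mul1r; lra.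
apply: filterS => w [J /(_ J (leqnn _)) JP]; exists (thr J / c) => n.
by rewrite ler_pdivlMr // mulrC ltW.
Qed.

Lemma negligible_small (N : set T) (B : nat -> set T) (C : R) :
  (forall m, measurable (B m)) -> (forall m, N `<=` B m) ->
  (forall m, (P (B m) <= (C / m.+1%:R)%:E)%E) -> P.-negligible N.
Proof.
move=> mB NB PB; exists (\bigcap_m B m); split.
- exact: bigcapT_measurable.
- have mI : measurable (\bigcap_m B m) by exact: bigcapT_measurable.
  have [r r0 Pr] : exists2 r, 0 <= r & P (\bigcap_m B m) = r%:E.
    exists (fine (P (\bigcap_m B m))); first exact: fine_ge0.
    by rewrite fineK // fin_num_measure.
  have rC m : r <= C / m.+1%:R.
    rewrite -lee_fin -Pr; apply: le_trans (PB m); apply: le_measure; rewrite ?inE //.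
    exact: bigcap_inf.
  rewrite Pr; congr (_%:E); apply/eqP; rewrite eq_le r0 andbT leNgt; apply/negP => r1.
  have C0 : 0 <= C by have := rC 0%N; rewrite divr1; exact: le_trans.
  have := rC (Num.bound (C / r)); rewrite ler_pdivlMr // mulrC -ler_pdivlMr //.
  apply/negP; rewrite -ltNge; apply: lt_trans (archi_boundP _) _; first exact: divr_ge0.
  by rewrite ltr_nat.
- by move=> w Nw m _; exact: NB.
Qed.

(** Conditional Borel-Cantelli without independence: if the [j]-th failure has conditional
    probability at most [j / (j + 1)] whatever the past, the product over [j = J, ..., J + m - 1]
    telescopes to [J / (J + m)], which tends to 0. *)
Lemma infinitely_often_ae (nn : nat -> nat) (F : nat -> pred (seq (dir d))) (J0 : nat) :
  {homo nn : j k / (j <= k)%N} ->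
  (forall j h, (J0 <= j)%N -> size h = nn j ->
     iter (nn j.+1 - nn j) K (fun h' => (F j h')%:R) h <= j%:R / j.+1%:R) ->
  {ae P, forall w J, exists2 j, (J <= j)%N & ~~ F j (hist (X^~ w) (nn j.+1))}.
Proof.
move=> nnP FP; apply: ae_foralln => J1.
(* The successor makes [J] positive, so that [J / J] is 1 at the start of the product. *)
pose J := (maxn J1 J0).+1.
have nnS j : nn j.+1 = (nn j + (nn j.+1 - nn j))%N by rewrite subnKC // nnP.
(* [G m] says that the blocks [J, ..., J + m - 1] all fail; it is read at time [nn (J + m)], and
   [drop] returns to the earlier block ends. *)
pose G := fix G m : pred (seq (dir d)) := if m is m'.+1 then
   fun h => F (J + m')%N h && G m' (drop (nn (J + m').+1 - nn (J + m')) h) else predT.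
have GP m x : G m (hist x (nn (J + m)%N)) =
    [forall j : 'I_m, F (J + j)%N (hist x (nn (J + j).+1))].
  elim: m => [|m IH]; first by apply/esym/forallP => -[].
  have drp : drop (nn (J + m).+1 - nn (J + m)) (hist x (nn (J + m).+1)) = hist x (nn (J + m)%N).
    have E : nn (J + m).+1 = (nn (J + m).+1 - nn (J + m) + nn (J + m))%N by rewrite subnK // nnP.
    by rewrite {2}E drop_hist.
  rewrite addnS /= drp IH; apply/andP/forallP => [[Fm /forallP Fj] j|Fj].
    have [jm|] := ltnP j m; first exact: (Fj (Ordinal jm)).
    by rewrite leq_eqVlt ltnNge -ltnS ltn_ord orbF => /eqP<-.
  by split; [exact: (Fj ord_max)|apply/forallP => j; exact: (Fj (widen_ord (leqnSn m) j))].
have GPr m : iter (nn (J + m)%N) K (fun h => (G m h)%:R) [::] <= J%:R / (J + m)%:R.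
  elim: m => [|m IH].
    rewrite addn0 divff ?pnatr_eq0 //.
    by rewrite [leLHS](iter_kstep_cst (erwq_stochastic R d0)).
  rewrite addnS {1}(nnS (J + m)%N) iterD.
  apply: (@le_trans _ _ (iter (nn (J + m)%N) K
     (fun h => ((J + m)%:R / (J + m).+1%:R) * (G m h)%:R) [::])).
    apply: iter_kstep_le => [|s ss]; first exact: erwq_stochastic.
    rewrite cats0; under [X in iter _ _ X]eq_fun do rewrite /= -mulnb natrM mulrC.
    rewrite (iter_kstep_drop (erwq_stochastic R d0) _ (fun h => (F (J + m)%N h)%:R)
      (fun h => (G m h)%:R)) mulrC.
    apply: ler_wpM2r => //; apply: FP => //.
    by rewrite /J addSn (leq_trans (leq_maxr J1 J0)) // leqW // leq_addr.
  rewrite iter_kstepZ.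
  apply: le_trans (ler_wpM2l _ IH) _; first by rewrite divr_ge0.
  rewrite mulrC mulrA divfK // pnatr_eq0.
  by rewrite /J addSn.
apply: (@negligible_small _
  (fun m => [set w | G m (hist (X^~ w) (nn (J + m)%N))]) J%:R).
- by move=> m; exact: (measurable_hist XP).
- move=> m w /= nw; rewrite GP; apply/forallP => j; apply/negPn/negP => nF.
  apply: nw; exists (J + j)%N => //.
  by rewrite /J addSn leqW // (leq_trans (leq_maxl J1 J0)) // leq_addr.
- move=> m; rewrite (prob_hist d0 XP) lee_fin; apply: le_trans (GPr m) _.
  apply: ler_wpM2l => //; rewrite lef_pV2 ?posrE ?ltr0n ?/J ?addSn // ler_nat.
  by rewrite ltnS leq_addl.
Qed.
End AlmostSure.

(** * Exponential and entropy inequalities *)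

Section Inequalities.
Variable R : realType.
Implicit Types (x y t eta : R).

(** The sign of the derivative on either side of 0 replaces Taylor's formula with remainder in the
    next two inequalities. *)
Lemma min_at0 (f df : R -> R) (a : R) :
  (forall x, `|x| <= a -> is_derive x 1 f (df x)) ->
  (forall x, `|x| <= a -> 0 <= x * df x) ->
  forall x, `|x| <= a -> f 0 <= f x.
Proof.
move=> fd df0 x xa.
have cont y z : - a <= y -> z <= a -> {within `[y, z], continuous f}.
  move=> ay za; apply: derivable_within_continuous => u; rewrite in_itv /= => /andP[yu uz].
  have : `|u| <= a by rewrite ler_norml (le_trans ay yu) (le_trans uz za).
  by move=> /fd [].
move: (xa); rewrite ler_norml => /andP[ax xa'].
have a0 : 0 <= a by apply: le_trans xa.
have [x0|x0|<-//] := ltgtP 0 x.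
- have fd' u : u \in `]0, x[%R -> is_derive u 1 f (df u).
    rewrite in_itv /= => /andP[u0 ux]; apply: fd.
    by rewrite ger0_norm; [exact: le_trans (ltW ux) xa'|exact: ltW].
  have [||c] := MVT x0 fd' (cont _ _ _ _); rewrite ?oppr_le0 //.
  rewrite in_itv /= subr0 => /andP[c0 cx] E.
  have : 0 <= c * df c.
    by rewrite df0 // ger0_norm; [exact: le_trans (ltW cx) xa'|exact: ltW].
  by rewrite pmulr_rge0 // => dc; rewrite -subr_ge0 E mulr_ge0 // ltW.
- have fd' u : u \in `]x, 0[%R -> is_derive u 1 f (df u).
    rewrite in_itv /= => /andP[u0 ux]; apply: fd.
    rewrite ler0_norm ?(ltW ux) // lerNl (le_trans ax (ltW u0)) //.
  have [||c] := MVT x0 fd' (cont _ _ _ _); rewrite ?oppr_le0 //.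
  rewrite in_itv /= sub0r => /andP[c0 cx] E.
  have : 0 <= c * df c.
    by rewrite df0 // ler0_norm ?(ltW cx) // lerNl (le_trans ax (ltW c0)).
  rewrite nmulr_rge0 // => dc.
  by rewrite -subr_le0 E mulr_le0_ge0 // oppr_ge0 ltW.
Qed.

Lemma expR_le_2nd eta x : 0 <= eta <= 1 -> `|x| <= eta ->
  expR x <= 1 + x + (1 + eta) / 2 * x ^+ 2.
Proof.
move=> /andP[e0 e1] xe.
(* Dividing by the exponential makes the derivative factor as [y * (eta - (1 + eta) / 2 * y)], whose
   second factor is nonnegative for [y <= eta <= 1]. *)
pose f y : R := (1 + y + (1 + eta) / 2 * y ^+ 2) * expR (- y).
pose df y : R := y * (eta - (1 + eta) / 2 * y) * expR (- y).
have fd y : `|y| <= eta -> is_derive y 1 f (df y).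
  move=> _; rewrite /f; apply: is_derive_eq.
  by rewrite /df /GRing.scale /=; field; rewrite ?pnatr_eq0.
have df0 y : `|y| <= eta -> 0 <= y * df y.
  move=> ye; rewrite /df !mulrA mulr_ge0 ?expR_ge0 // -expr2 mulr_ge0 ?sqr_ge0 //.
  move: ye; rewrite ler_norml => /andP[_ ye]; nra.
have := min_at0 fd df0 xe; rewrite /f oppr0 expR0 expr0n /= !addr0 mulr0 addr0 mulr1.
by rewrite expRN ler_pdivlMr ?expR_gt0 // mul1r.
Qed.

(** Entropy counterpart of [expR_le_2nd]. The radius is [eta / 2] because on the negative side the
    derivative has the right sign once [(1 + x) * (1 + eta) >= 1]. *)
Lemma ln_entropy_2nd eta x : 0 < eta <= 1 -> `|x| <= eta / 2 ->
  (1 + x) * ln (1 + x) <= x + (1 + eta) / 2 * x ^+ 2.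
Proof.
move=> /andP[e0 e1] xe.
pose f y : R := y + (1 + eta) / 2 * y ^+ 2 - (1 + y) * ln (1 + y).
pose df y : R := (1 + eta) * y - ln (1 + y).
have y1 y : `|y| <= eta / 2 -> 0 < 1 + y by rewrite ler_norml => /andP[? ?]; lra.
have fd y : `|y| <= eta / 2 -> is_derive y 1 f (df y).
  move=> ye; have y0 := y1 y ye; rewrite /f.
  have dln : is_derive y 1 (fun u : R => ln (1 + u)) (1 + y)^-1.
    have := is_derive1_ln y0.
    have d1 : is_derive y 1 (fun u : R => 1 + u) 1 by apply: is_derive_eq; rewrite add0r mulr1. 
    by move=> dl; apply: is_derive_eq (is_derive1_comp dl d1) _; rewrite mulr1.
  apply: is_derive_eq; rewrite /df /GRing.scale /=; field; rewrite gt_eqF //.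
have df0 y : `|y| <= eta / 2 -> 0 <= y * df y.
  move=> ye; have := y1 y ye => y0; rewrite /df.
  have [yp|yn] := leP 0 y.
    rewrite mulr_ge0 // subr_ge0.
    have : ln (1 + y) <= y by apply: le_ln1Dx; lra.
    by move=> /le_trans; apply; rewrite mulrDl mul1r lerDl mulr_ge0 // ltW.
  apply: mulr_le0; first exact: ltW.
  rewrite subr_le0.
  have : ln (1 + y)^-1 <= (1 + y)^-1 - 1.
    have {1}-> : (1 + y)^-1 = 1 + ((1 + y)^-1 - 1) by rewrite addrCA subrr addr0.
    by apply: le_ln1Dx; rewrite ltrBrDl subrr invr_gt0.
  rewrite lnV ?posrE // => L.
  have L2 : (1 + y)^-1 - 1 <= - ((1 + eta) * y).
    rewrite lerBlDr -[leLHS]mul1r ler_pdivrMr //.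
    move: ye; rewrite ler_norml => /andP[? ?]; nra.
  by move: L L2; lra.
have := min_at0 fd df0 xe; rewrite /f !addr0 ln1 expr0n /= !mulr0 !addr0 subr0.
by rewrite subr_ge0.
Qed.

(** Valid for every real [x], hence it gives exponential supermartingales without any smallness of
    the increments. The constant 2 is not sharp; it serves only where orders of magnitude
    suffice. *)
Lemma expR_le_sub x : expR x <= x + expR (2 * x ^+ 2).
Proof.
have [x2|x2] := leP x (1 / 2); last first.
  apply: (@le_trans _ _ (expR (2 * x ^+ 2))); last by rewrite lerDr; lra.
  by rewrite ler_expR; nra.
apply: (@le_trans _ _ (1 + x + 2 * x ^+ 2)); last first.
  by have := expR_ge1Dx (2 * x ^+ 2); lra.
have : expR x * (1 - x) <= 1.
  have := expR_ge1Dx (- x); rewrite expRN => ex.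
  by rewrite mulrC -ler_pdivlMr ?expR_gt0 // mul1r.
have x1 : 0 < 1 - x by lra.
rewrite -ler_pdivlMr // => /le_trans; apply.
rewrite ler_pdivrMr //; nra.
Qed.

End Inequalities.

(** * Path functionals and their supermartingales *)

Section WalkFunctionals.
Variables (R : realType) (d : nat).
Hypothesis d0 : (1 <= d)%N.
Notation q := (@erwq R d).
Notation K := (kstep q).
Notation H := (harm R).
Notation path := (seq (dir d)).
Let qP := erwq_stochastic R d0.

Definition cexp (h : path) (D : dir d -> R) : R := \sum_y q h y * D y.

Lemma kstepE F h : K F h = cexp h (fun y => F (y :: h)). Proof. by []. Qed.

Lemma cexp_le h D D' : (forall y, D y <= D' y) -> cexp h D <= cexp h D'.
Proof. by move=> DD; apply: ler_sum => y _; apply: ler_wpM2l => //; case: qP. Qed.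
Lemma cexp_cst h c : cexp h (fun=> c) = c. Proof. exact: (kstep_cst qP c h). Qed.
Lemma cexpD h D D' : cexp h (fun y => D y + D' y) = cexp h D + cexp h D'.
Proof. by rewrite /cexp -big_split /=; apply: eq_bigr => y _; rewrite mulrDr. Qed.
Lemma cexpZ h c D : cexp h (fun y => c * D y) = c * cexp h D.
Proof. by rewrite /cexp mulr_sumr; apply: eq_bigr => y _; rewrite mulrCA. Qed.
Lemma eq_cexp h D D' : (forall y, D y = D' y) -> cexp h D = cexp h D'.
Proof. by move=> DD; apply: eq_bigr => y _; rewrite DD. Qed.

(* Histories list the most recent step first. *)
Fixpoint acc (a : path -> dir d -> R) (h : path) : R :=
  if h is y :: h' then acc a h' + a h' y else 0.

Lemma accB a b h : acc (fun h y => a h y - b h y) h = acc a h - acc b h.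
Proof. by elim: h => [|y h IH] /=; rewrite ?subr0 // IH opprD addrACA. Qed.
Lemma accD a b h : acc (fun h y => a h y + b h y) h = acc a h + acc b h.
Proof. by elim: h => [|y h IH] /=; rewrite ?addr0 // IH addrACA. Qed.
Lemma accZ c a h : acc (fun h y => c * a h y) h = c * acc a h.
Proof. by elim: h => [|y h IH] /=; rewrite ?mulr0 // IH mulrDr. Qed.
Lemma acc_le a b h : (forall h y, a h y <= b h y) -> acc a h <= acc b h.
Proof. by move=> ab; elim: h => [|y h IH] //=; rewrite lerD. Qed.
Lemma acc_ge0 a h : (forall h y, 0 <= a h y) -> 0 <= acc a h.
Proof. by move=> a0; elim: h => [|y h IH] //=; rewrite addr_ge0. Qed.

(** A Lyapunov argument: the expected decrease of the potential [phi] pays for the term [a]. With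
    the maximal inequality this bounds the whole series of the [a] almost surely. *)
Lemma supermartingale_acc (a : path -> R) (phi : path -> R) :
  (forall h, 0 <= a h) -> (forall h, 0 <= phi h) ->
  (forall h, cexp h (fun y => phi (y :: h)) + a h <= phi h) ->
  supermartingale (fun h => acc (fun h _ => a h) h + phi h).
Proof.
move=> a0 phi0 aphi; split=> h; first by rewrite addr_ge0 // acc_ge0.
rewrite kstepE /= cexpD cexp_cst -addrA lerD2l addrC.
exact: aphi.
Qed.

Lemma supermartingale_exp (a : path -> dir d -> R) :
  (forall h, cexp h (fun y => expR (a h y)) <= 1) ->
  supermartingale (fun h => expR (acc a h)).
Proof.
move=> a1; split=> h; first exact: expR_ge0.
rewrite kstepE /=; under eq_cexp do rewrite expRD.
by rewrite cexpZ -[leRHS]mulr1; apply: ler_wpM2l => //; exact: expR_ge0.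
Qed.

Lemma cexp_exp_subgaussian h D b : cexp h D = 0 -> (forall y, D y ^+ 2 <= b) ->
  cexp h (fun y => expR (D y - 2 * b)) <= 1.
Proof.
move=> D0 Db; under eq_cexp do rewrite expRD mulrC.
rewrite cexpZ expRN mulrC ler_pdivrMr ?expR_gt0 // mul1r.
apply: (@le_trans _ _ (cexp h (fun y => D y + expR (2 * b)))).
  apply: cexp_le => y; apply: le_trans (expR_le_sub _) _.
  by rewrite lerD2l ler_expR ler_wpM2l.
by rewrite cexpD D0 add0r cexp_cst.
Qed.

Lemma cexp_exp_2nd h D eta v : 0 <= eta <= 1 -> cexp h D = 0 ->
  (forall y, `|D y| <= eta) -> cexp h (fun y => D y ^+ 2) <= v ->
  cexp h (fun y => expR (D y - (1 + eta) / 2 * v)) <= 1.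
Proof.
move=> eta01 D0 De Dv; have /andP[e0 _] := eta01.
under eq_cexp do rewrite expRD mulrC.
rewrite cexpZ expRN mulrC ler_pdivrMr ?expR_gt0 // mul1r.
apply: (@le_trans _ _ (cexp h (fun y => 1 + D y + (1 + eta) / 2 * D y ^+ 2))).
  by apply: cexp_le => y; exact: expR_le_2nd.
rewrite cexpD cexpD D0 cexp_cst cexpZ addr0.
apply: le_trans (expR_ge1Dx _); rewrite lerD2l ler_wpM2l //.
by rewrite divr_ge0 // addr_ge0.
Qed.

Section Fixg.
Variables (g : dir d -> R) (c : R).
Hypothesis g0 : mean g = 0.
Hypothesis gc : forall y, `|g y| <= c.
Notation S := (wsum g).
Notation k h := ((size h)%:R : R).

Lemma wsum_nil : S [::] = 0. Proof. by rewrite /wsum big_nil. Qed.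
Lemma wsum_cons y h : S (y :: h) = S h + g y. Proof. by rewrite /wsum big_cons addrC. Qed.

Lemma bound_ge0 : 0 <= c.
Proof. by apply: le_trans (gc (Ordinal d0, true)). Qed.

Lemma g_sq_le y : g y ^+ 2 <= c ^+ 2.
Proof. by rewrite -real_normK ?num_real // lerXn2r ?nnegrE ?bound_ge0. Qed.

Lemma cexp_g h : cexp h g = S h / (2 * k h).
Proof.
(* For the empty history the right-hand side is [0 / 0 = 0], which agrees with the centered first
   step. *)
have [->|hn] := eqVneq h [::].
  by rewrite /cexp erwq_sum_nil g0 wsum_nil mul0r.
by rewrite /cexp erwq_sum // g0 mul0r addr0.
Qed.

Definition eps (h : path) (y : dir d) : R := g y - S h / (2 * k h).

Lemma cexp_eps h : cexp h (eps h) = 0.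
Proof. by rewrite /eps cexpD cexp_cst cexp_g subrr. Qed.

Lemma cexp_epsZ a h : cexp h (fun y => a * eps h y) = 0.
Proof. by rewrite cexpZ cexp_eps mulr0. Qed.

Lemma wsum_le h : `|S h| <= c * k h.
Proof.
elim: h => [|y h IH]; first by rewrite wsum_nil normr0 mulr0.
rewrite wsum_cons /= -natr1 mulrDr mulr1; apply: le_trans (ler_normD _ _) _.
exact: lerD.
Qed.

Lemma drift_le h : `|S h / (2 * k h)| <= c / 2.
Proof.
have [->|hn] := eqVneq h [::]; first by rewrite wsum_nil mul0r normr0 divr_ge0 ?bound_ge0.
have k0 : 0 < k h by rewrite ltr0n lt0n size_eq0.
rewrite normrM normfV (ger0_norm (x := 2 * _)) ?mulr_ge0 //.
by rewrite ler_pdivrMr ?mulr_gt0 // mulrA divfK ?wsum_le.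
Qed.

Lemma eps_le h y : `|eps h y| <= 2 * c.
Proof.
apply: le_trans (ler_normB _ _) _; have := gc y; have := drift_le h.
by have := bound_ge0; lra.
Qed.

Lemma eps_sq_le h y : eps h y ^+ 2 <= 4 * c ^+ 2.
Proof.
rewrite -real_normK ?num_real // (_ : 4 * c ^+ 2 = (2 * c) ^+ 2); last by ring.
by rewrite lerXn2r ?nnegrE ?eps_le // mulr_ge0 ?bound_ge0.
Qed.

Lemma cexp_eps_sq_le h : cexp h (fun y => eps h y ^+ 2) <= cexp h (fun y => g y ^+ 2).
Proof.
set m := S h / (2 * k h).
have -> : cexp h (fun y => eps h y ^+ 2) = cexp h (fun y => g y ^+ 2) - m ^+ 2.
  rewrite (@eq_cexp h _ (fun y => g y ^+ 2 + ((- 2 * m) * g y + m ^+ 2))).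
    by rewrite cexpD cexpD cexp_cst cexpZ cexp_g -/m; ring.
  by move=> y; rewrite /eps -/m; ring.
by rewrite lerBlDr lerDl sqr_ge0.
Qed.

Lemma cexp_wsum_sq h : h != [::] -> cexp h (fun y => S (y :: h) ^+ 2) =
  (1 + (k h)^-1) * S h ^+ 2 + cexp h (fun y => g y ^+ 2).
Proof.
move=> hn; have k0 : k h != 0 by rewrite pnatr_eq0 size_eq0.
rewrite (@eq_cexp h _ (fun y => S h ^+ 2 + ((2 * S h) * g y + g y ^+ 2))).
  by rewrite cexpD cexpD cexp_cst cexpZ cexp_g; field.
by move=> y; rewrite wsum_cons; ring.
Qed.

(* [S^2/k^2] is a potential for the additive functional: its conditional drift
   is exactly [- S^2/(k^2(k+1))] plus a summable deterministic term. *)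
Lemma supermartingale_sq :
  supermartingale (fun h => acc (fun h _ => S h ^+ 2 / (k h ^+ 2 * (k h + 1))) h
    + (S h ^+ 2 / k h ^+ 2 + 2 * c ^+ 2 / (k h + 1))).
Proof.
have c0 := bound_ge0; have c2 : 0 <= c ^+ 2 by exact: sqr_ge0.
apply: supermartingale_acc => [h|h|h].
- by rewrite divr_ge0 ?sqr_ge0 // mulr_ge0 ?sqr_ge0 // ?addr_ge0.
- apply: addr_ge0; rewrite divr_ge0 ?sqr_ge0 ?mulr_ge0 // ?addr_ge0.
have G : cexp h (fun y => g y ^+ 2) <= c ^+ 2.
  by rewrite -(cexp_cst h (c ^+ 2)); apply: cexp_le => y; exact: g_sq_le.
have [->|hn] := eqVneq h [::].
  rewrite wsum_nil expr0n /= !mul0r add0r addr0 mulr0n add0r.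
  rewrite -(cexp_cst [::] (2 * c ^+ 2 / 1)); apply: cexp_le => y.
  rewrite wsum_cons wsum_nil add0r /= expr1n !divr1.
  rewrite [X in _ + X <= _](_ : _ = c ^+ 2); last by field.
  by have := g_sq_le y; lra.
rewrite cexpD /= cexp_cst; under eq_cexp do rewrite mulrC.
rewrite cexpZ cexp_wsum_sq // -natr1.
have : 1 <= k h by rewrite ler1n lt0n size_eq0.
move: G; move: (cexp _ _) (S h ^+ 2) (sqr_ge0 (S h)) (k h) => v s s0 x vc x1.
rewrite -subr_ge0.
have -> : s / x ^+ 2 + 2 * c ^+ 2 / (x + 1) - ((x + 1) ^- 2 * ((1 + x^-1) * s + v) +
    2 * c ^+ 2 / (x + 1 + 1) + s / (x ^+ 2 * (x + 1))) =
    ((c ^+ 2 - v) + c ^+ 2 * (x / (x + 2))) / (x + 1) ^+ 2.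
  by field; rewrite !gt_eqF //; lra.
rewrite divr_ge0 ?sqr_ge0 // addr_ge0 ?subr_ge0 // mulr_ge0 // divr_ge0 //; lra.
Qed.

Definition mart : path -> R := acc (fun h y => (Num.sqrt (k h + 1))^-1 * eps h y).

(** [sqrt k] stands for the exact normalisation, a quotient of Gamma functions. With [a = sqrt k]
    and [b = sqrt (k + 1)] one step creates the error [s / a^2 * (b - a)^2 / (2 b)], at most
    [c * (1 / a - 1 / b)] because [|s| <= c * a^2]. These errors telescope, hence the stronger
    statement [c * (1 - 1 / sqrt k)] carried by the induction. *)
Lemma wsum_mart h : `|S h / Num.sqrt (k h) - mart h| <= c.
Proof.
have c0 := bound_ge0.
case: h => [|y h]; first by rewrite wsum_nil mul0r subr0 normr0.
suff : `|S (y :: h) / Num.sqrt (k (y :: h)) - mart (y :: h)| <= c * (1 - (Num.sqrt (k (y :: h)))^-1).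
  move=> /le_trans; apply; apply: ler_piMr => //.
elim: h y => [|y' h IH] y.
  rewrite /mart /= wsum_cons wsum_nil /eps wsum_nil mulr0n add0r sqrtr1 !divr1 invr1.
  by rewrite mul0r subr0 !add0r sqrtr1 invr1 mul1r subrr normr0 subrr mulr0.
have := IH y'; move: (y' :: h) (isT : (0 < size (y' :: h))%N) => {IH y'}h h0.
rewrite /mart [acc _ (y :: h)]/= -/mart.
rewrite wsum_cons [size (y :: h)]/= -natr1 /eps.
have k1 : 1 <= k h by rewrite ler1n.
set a := Num.sqrt (k h); set b := Num.sqrt (k h + 1).
have a0 : 0 < a by rewrite sqrtr_gt0; lra.
have b0 : 0 < b by rewrite sqrtr_gt0; lra.
have aE : k h = a ^+ 2 by rewrite sqr_sqrtr //; lra.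
have bE : b ^+ 2 = a ^+ 2 + 1 by rewrite -aE sqr_sqrtr //; lra.
have ab : a < b by rewrite ltr_sqrt; lra.
have := wsum_le h; rewrite aE; move: (S h) (mart h) (g y) => s m gy sc IH.
have -> : (s + gy) / b - (m + b^-1 * (gy - s / (2 * a ^+ 2))) =
   (s / a - m) + s / a ^+ 2 * ((b - a) ^+ 2 / (2 * b)).
  have -> : (b - a) ^+ 2 = b ^+ 2 - 2 * a * b + a ^+ 2 by ring.
  by rewrite bE; field; rewrite !gt_eqF.
apply: le_trans (ler_normD _ _) _.
have -> : c * (1 - b^-1) = c * (1 - a^-1) + c * ((b - a) / (a * b)).
  by field; rewrite !gt_eqF.
apply: lerD => //; rewrite normrM; apply: ler_pM => //.
  rewrite normrM normfV (ger0_norm (sqr_ge0 a)) ler_pdivrMr ?exprn_gt0 //.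
rewrite ger0_norm; last by rewrite divr_ge0 ?sqr_ge0 // mulr_ge0 // ltW.
rewrite ler_pdivrMr ?mulr_gt0 // mulrAC ler_pdivlMr ?mulr_gt0 //.
have -> : (b - a) ^+ 2 * (a * b) = (b - a) * b * ((b - a) * a) by ring.
have -> : (b - a) * (2 * b) = (b - a) * b * 2 by ring.
rewrite ler_wpM2l ?mulr_ge0 ?subr_ge0 ?ltW //.
nra.
Qed.

Definition remn : path -> R := acc (fun h y => k h * eps h y).

Fixpoint possum (h : path) : R := if h is _ :: h' then possum h' + S h else 0.

(** Multiplying [S_{n+1} - S_n = S_n / (2 n) + eps] by [n] gives
    [n S_{n+1} = (n + 1/2) S_n + n eps]. Adding [(3/2) S_{n+1}] to both sides shows that
    [(n + 1/2) S_n] minus the sum of the [n eps] increases by exactly [(3/2) S_{n+1}]. *)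
Lemma possumE h : possum h = 2 / 3 * ((k h + 1 / 2) * S h - remn h).
Proof.
elim: h => [|y h IH]; first by rewrite /= wsum_nil mulr0 subrr mulr0.
have RE : remn (y :: h) = remn h + k h * eps h y by [].
have PE : possum (y :: h) = possum h + S (y :: h) by [].
rewrite RE PE IH wsum_cons /eps [size (y :: h)]/= -(natr1 (size h)).
have E : k h * (S h / (2 * k h)) = S h / 2.
  have [->|hn] := eqVneq h [::]; first by rewrite wsum_nil !mul0r.
  have k0 : k h != 0 by rewrite pnatr_eq0 size_eq0.
  by field.
by rewrite (mulrBr (k h)) E; field.
Qed.

(** The accumulated weight, of order [1 / (k^4 H^2)], is the one with which [remn] enters the
    quadratic law of the center of mass. The passage from [k^3] to [(k + 1)^3] in the potential
    releases that term, and the fresh noise, at most [4 c^2 k^2] before normalisation, is paid by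
    the decrease of [4 c^2 / H], an exact difference by [harm_inv_diff]. *)
Lemma supermartingale_remn :
  supermartingale (fun h => acc (fun h _ => remn h ^+ 2 /
      (k h ^+ 3 * (k h + 1) * H (size h) * H (size h).+1)) h
    + (remn h ^+ 2 / (k h ^+ 3 * H (size h) * H (size h).+1)
       + 4 * c ^+ 2 / H (size h).+1)).
Proof.
have c0 := bound_ge0; have c2 : 0 <= c ^+ 2 by exact: sqr_ge0.
have Hge0 n : 0 <= H n by case: n => [|n]; [rewrite harm0|rewrite ltW ?harm_gt0].
apply: supermartingale_acc => [h|h|h].
- by rewrite divr_ge0 ?sqr_ge0 // !mulr_ge0 ?exprn_ge0 // ?addr_ge0.
- by apply: addr_ge0; rewrite divr_ge0 ?sqr_ge0 // ?mulr_ge0 ?exprn_ge0.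
have [->|hn] := eqVneq h [::].
  have R0 : remn [::] = 0 by [].
  have R1 y : remn [:: y] = 0 by rewrite /remn /= mul0r addr0.
  rewrite R0 expr0n !mul0r add0r addr0 -[leRHS](cexp_cst [::]).
  apply: cexp_le => y; rewrite R1 expr0n mul0r add0r.
  apply: ler_wpM2l; first by rewrite mulr_ge0.
  by rewrite lef_pV2 ?posrE ?harm_gt0 // [leRHS]harmS lerDl.
rewrite cexpD /= cexp_cst; under eq_cexp do rewrite mulrC.
rewrite cexpZ.
have -> : cexp h (fun y => remn (y :: h) ^+ 2) =
    remn h ^+ 2 + k h ^+ 2 * cexp h (fun y => eps h y ^+ 2).
  rewrite (@eq_cexp h _ (fun y => remn h ^+ 2 +
      ((2 * remn h * k h) * eps h y + k h ^+ 2 * eps h y ^+ 2))).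
    by rewrite cexpD cexpD cexp_cst !cexpZ cexp_eps; ring.
  by move=> y; rewrite /remn /= -/remn; ring.
have G : cexp h (fun y => eps h y ^+ 2) <= 4 * c ^+ 2.
  by rewrite -(cexp_cst h (4 * _)); apply: cexp_le => y; exact: eps_sq_le.
have x1 : 1 <= k h by rewrite ler1n lt0n size_eq0.
have H2 : (H (size h).+1)^-1 - (H (size h).+2)^-1 =
    ((k h + 2) * H (size h).+1 * H (size h).+2)^-1.
  by rewrite -harm_inv_diff -natr1 -natr1 -addrA.
have [Ha Hb] : 0 < H (size h) /\ H (size h) <= H (size h).+2.
  split; first by case: h hn x1 {G H2} => // y h _ _; rewrite harm_gt0.
  by rewrite !harmS -addrA lerDl addr_ge0.
have Hc := harm_gt0 R (size h); have Hd := harm_gt0 R (size h).+1.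
rewrite -[in leLHS]natr1; move: (sqr_ge0 (remn h)) G x1 H2 Ha Hb Hc Hd.
move: (remn h ^+ 2) (cexp _ _) (k h) (H (size h)) (H (size h).+1) (H (size h).+2).
move=> r v x a b e r0 vc x1 H2 a0 ae b0 e0.
have x0 : 0 < x by lra.
have xx : 0 < x + 1 by lra.
pose C := 4 * c ^+ 2.
have T1 : ((x + 1) ^+ 3 * b * e)^-1 * r + r / (x ^+ 3 * (x + 1) * a * b) <= r / (x ^+ 3 * a * b).
  rewrite -subr_ge0.
  have -> : r / (x ^+ 3 * a * b) - (((x + 1) ^+ 3 * b * e)^-1 * r + r / (x ^+ 3 * (x + 1) * a * b))
    = r / (b * (x + 1)) * ((x ^+ 2 * a)^-1 - ((x + 1) ^+ 2 * e)^-1).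
    by field; rewrite !gt_eqF.
  apply: mulr_ge0; first by rewrite divr_ge0 // mulr_ge0 // ltW.
  rewrite subr_ge0 lef_pV2 ?posrE ?mulr_gt0 ?exprn_gt0 //.
  apply: ler_pM => //; rewrite ?exprn_ge0 ?ltW // ltrXn2r //; lra.
have T2 : ((x + 1) ^+ 3 * b * e)^-1 * (x ^+ 2 * v) + C / e <= C / b.
  rewrite -lerBrDr -mulrBr H2 /C.
  apply: (@le_trans _ _ (4 * c ^+ 2 * (((x + 1) ^+ 3 * b * e)^-1 * x ^+ 2))).
    rewrite [leRHS]mulrC [leLHS]mulrA; apply: ler_wpM2l vc.
    by rewrite mulr_ge0 ?sqr_ge0 // invr_ge0 !mulr_ge0 ?exprn_ge0 // ltW.
  rewrite ler_wpM2l ?mulr_ge0 // ler_pdivrMl ?mulr_gt0 ?exprn_gt0 // ler_pdivlMr; last first.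
    by rewrite !mulr_gt0 //; lra.
  rewrite !mulrA; do 2 (apply: ler_wpM2r; first exact: ltW).
  nra.
by rewrite mulrDr -/C; move: T1 T2; lra.
Qed.

End Fixg.
End WalkFunctionals.

(** * The harmonic clock *)

Section HarmAsymptotics.
Variable R : realType.
Notation H := (harm R).
Implicit Types (x eta B : R).

Lemma ln_le_lin eta : 0 < eta -> exists2 x0, 1 <= x0 & forall x, x0 <= x -> ln x <= eta * x.
Proof.
move=> e0; exists (1 + 4 / eta ^+ 2) => [|x xe].
  by rewrite lerDl divr_ge0 // sqr_ge0.
have x0 : 0 < x.
  by apply: lt_le_trans xe; rewrite ltr_pwDl // divr_ge0 // sqr_ge0.
have s0 : 0 < Num.sqrt x by rewrite sqrtr_gt0.
have xE : x = Num.sqrt x ^+ 2 by rewrite sqr_sqrtr // ltW.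
have L : ln x <= 2 * Num.sqrt x.
  rewrite {1}xE lnXn // -[leLHS]mulr_natl ler_wpM2l // ltW // ln_sublinear //.
apply: le_trans L _; rewrite {2}xE.
have se : 2 <= eta * Num.sqrt x.
  rewrite -(ler_pXn2r (n := 2)) ?nnegrE ?mulr_ge0 ?(ltW e0) ?(ltW s0) // exprMn -xE.
  have : 4 / eta ^+ 2 <= x by apply: le_trans xe; rewrite lerDr.
  by rewrite ler_pdivrMr ?exprn_gt0 // mulrC -natrX.
by rewrite expr2 mulrA ler_wpM2r // ltW.
Qed.

Lemma ln_harm n : ln n.+1%:R <= H n.
Proof.
elim: n => [|n IH]; first by rewrite harm0 ln1.
rewrite harmS; have n1 : (0 : R) < n.+1%:R by [].
have -> : n.+2%:R = n.+1%:R * (1 + n.+1%:R^-1) :> R.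
  by rewrite mulrDr mulr1 divff ?gt_eqF // natr1.
rewrite lnM ?posrE ?ltr_pwDl ?invr_ge0 //; apply: lerD => //.
by apply: le_ln1Dx; rewrite (@lt_le_trans _ _ 0) ?invr_ge0.
Qed.

Lemma harm_ln n : H n.+1 <= 1 + ln n.+1%:R.
Proof.
elim: n => [|n IH]; first by rewrite harmS harm0 ln1 invr1 add0r addr0.
rewrite harmS; have n1 : (0 : R) < n.+1%:R by [].
have n2 : (0 : R) < n.+2%:R by [].
apply: (@le_trans _ _ (1 + ln n.+1%:R + n.+2%:R^-1)); first by rewrite lerD2r.
rewrite -addrA lerD2l.
have : ln (n.+1%:R / n.+2%:R) <= - n.+2%:R^-1 :> R.
  have -> : n.+1%:R / n.+2%:R = 1 + (- n.+2%:R^-1) :> R.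
    rewrite -(natr1 n.+1); move: (n.+1%:R) n1 => x x0.
    by field; rewrite gt_eqF //; lra.
  by apply: le_ln1Dx; rewrite ltrN2 invf_lt1 // ltr1n.
rewrite ln_div ?posrE //.
by move: (ln n.+1%:R) (ln n.+2%:R) (n.+2%:R^-1) => a b e; lra.
Qed.

Lemma ln2_itv : 1 / 2 <= ln 2 :> R /\ ln 2 <= 1 :> R.
Proof.
split; last by have := @le_ln1Dx R 1; rewrite -(natrD _ 1 1); apply; lra.
have : ln (1 + (- (1 / 2))) <= - (1 / 2) :> R by apply: le_ln1Dx; lra.
rewrite (_ : 1 + - (1 / 2) = 2^-1 :> R); last by field.
by rewrite lnV ?posrE //; lra.
Qed.

Lemma ln_le_double m n : (0 < m)%N -> (m <= n * 2)%N -> ln m%:R <= 1 + ln n%:R :> R.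
Proof.
move=> m0 mn; have n0 : (0 < n)%N by case: n mn => //; case: m m0.
apply: (@le_trans _ _ (ln (n%:R * 2))).
  by rewrite ler_ln ?posrE ?mulr_gt0 ?ltr0n // -natrM ler_nat.
by rewrite lnM ?posrE ?ltr0n //; have [_] := ln2_itv; lra.
Qed.

Lemma near_natr B : \forall n \near \oo, B <= n%:R :> R.
Proof. exact: nbhs_infty_ger. Qed.

Lemma near_ln B : \forall n \near \oo, B <= ln n%:R :> R.
Proof.
near=> n; have nB : expR B <= n%:R by near: n; exact: near_natr.
by rewrite -[leLHS]expRK ler_ln ?posrE ?expR_gt0 // (lt_le_trans _ nB) ?expR_gt0.
Unshelve. all: by end_near. Qed.

Lemma near_harm B : \forall n \near \oo, B <= H n.
Proof.
near=> n; apply: (@le_trans _ _ (ln n%:R)); first by near: n; exact: near_ln.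
apply: le_trans (ln_harm n); have [->|n0] := posnP n; first by rewrite ln0 ?ln1.
by rewrite ler_ln ?posrE ?ltr0n // ler_nat.
Unshelve. all: by end_near. Qed.

Lemma near_ln_comp (u : nat -> R) : (forall B, \forall n \near \oo, B <= u n) ->
  forall B, \forall n \near \oo, B <= ln (u n).
Proof.
move=> uP B; near=> n; have nB : expR B <= u n by near: n; exact: uP.
by rewrite -[leLHS]expRK ler_ln ?posrE ?expR_gt0 // (lt_le_trans _ nB) ?expR_gt0.
Unshelve. all: by end_near. Qed.

Lemma near_lnH B : \forall n \near \oo, B <= ln (H n).
Proof. exact: near_ln_comp near_harm _. Qed.
Lemma near_lnlnH B : \forall n \near \oo, B <= ln (ln (H n)).
Proof. exact: near_ln_comp near_lnH _. Qed.

Lemma near_ln_thr eta : 0 < eta -> \forall j \near \oo, ln (thr R j) <= (1 + eta) * ln j%:R.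
Proof.
move=> e0; have [x0 x01 lnx] := ln_le_lin (divr_gt0 e0 (ltr0n R 4)).
near=> j; have j2 : (2 <= j)%N by near: j; exact: nbhs_infty_ge.
have j0 : (0 : R) < j%:R by rewrite ltr0n (leq_trans _ j2).
set y : R := ln j%:R.
have yB : x0 + (1 + eta) * 2 / eta <= y by rewrite /y; near: j; exact: near_ln.
have L1 : ln j.+2%:R <= 1 + y.
  by apply: ln_le_double; rewrite // muln2 -addnn -addn2 leq_add2l.
have Hj2 : H j.+2 <= 2 + y by apply: le_trans (harm_ln _) _; lra.
have Hj1 : H j.+1 <= 2 + y.
  by apply: le_trans Hj2; rewrite (harmS _ j.+1) lerDl.
have Hp1 := harm_gt0 R j; have Hp2 := harm_gt0 R j.+1.
rewrite /thr lnM ?posrE ?mulr_gt0 // lnM ?posrE //.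
have e4 : 0 <= (1 + eta) * 2 / eta by rewrite divr_ge0 ?mulr_ge0 ?addr_ge0 // ltW.
have y2 : x0 <= 2 + y by lra.
have L2 z : 0 < z -> z <= 2 + y -> ln z <= eta / 4 * (2 + y).
  move=> z0 zy; apply: le_trans (lnx _ y2); rewrite ler_ln ?posrE //; lra.
have := L2 _ Hp1 Hj1; have := L2 _ Hp2 Hj2.
have ye : (1 + eta) <= eta / 2 * y.
  have : (1 + eta) * 2 / eta <= y by lra.
  by rewrite ler_pdivrMr // => ?; lra.
move: L1 ye; lra.
Unshelve. all: by end_near. Qed.

End HarmAsymptotics.

(** * Upper bound in the law of the iterated logarithm *)

Section UpperLIL.
Variables (R : realType) (dT : measure_display) (T : measurableType dT).
Variables (P : probability T R) (d : nat) (X : nat -> T -> dir d).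
Hypothesis d0 : (1 <= d)%N.
Hypothesis XP : is_ERW P ((2 * d%:R + 1) / (4 * d%:R)) X.
Notation H := (harm R).
Notation path := (seq (dir d)).
Notation k h := ((size h)%:R : R).
Notation hX w n := (hist (X^~ w) n).
Implicit Types g : dir d -> R.

Lemma dir_bound g : exists c : R, forall y, `|g y| <= c.
Proof.
exists (\sum_y `|g y|) => y; rewrite (bigD1 y) //= lerDl.
exact: sumr_ge0.
Qed.

Lemma meanB g (a : R) : mean (fun y => g y - a) = mean g - a.
Proof.
rewrite /mean big_split /= sumrN mulrBr sumr_const card_dir -[a *+ _]mulr_natl natrM mulrA.
by rewrite mulVf ?mul1r // mulf_neq0 // pnatr_eq0 -lt0n.
Qed.

Lemma mean_sq_ge0 g : 0 <= mean (fun y => g y ^+ 2).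
Proof. by rewrite /mean mulr_ge0 ?invr_ge0 ?mulr_ge0 // sumr_ge0 // => y _; rewrite sqr_ge0. Qed.

Lemma acc_harm (h : path) (a : R) : acc (fun h _ => a / (k h + 1)) h = a * H (size h).
Proof.
elim: h => [|y h IH] /=; first by rewrite harm0 mulr0.
by rewrite IH harmS mulrDr natr1.
Qed.

Definition bracket g : path -> R := acc (fun h _ => cexp h (fun y => g y ^+ 2) / (k h + 1)).

Lemma cexp_sq g h : cexp h (fun y => g y ^+ 2) = mean (fun y => g y ^+ 2) +
  wsum (fun y => g y ^+ 2 - mean (fun y => g y ^+ 2)) h / (2 * k h).
Proof.
set s := mean _; set f := fun y => _ - s.
have f0 : mean f = 0 by rewrite meanB subrr.
have <- := cexp_g d0 f0 h.
by rewrite -[in RHS](cexp_cst d0 h s) -cexpD; apply: eq_cexp => y; rewrite /f addrC subrK.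
Qed.

(** The conditional second moment deviates from [var g] by [x / 2], with [x] the empirical mean of
    the centered squares. Since [x / 2 <= eta + x^2 / (16 eta)], the almost surely finite sum from
    [supermartingale_sq] controls the total deviation. [L] does not depend on [eta], so one null set
    serves all of them. *)
Lemma bracket_le_ae g : {ae P, forall w, exists L : R, forall eta, 0 < eta ->
  forall n, bracket g (hX w n) <= (mean (fun y => g y ^+ 2) + eta) * H n + L / eta}.
Proof.
set s := mean _; pose f y := g y ^+ 2 - s.
have f0 : mean f = 0 by rewrite meanB subrr.
have [c fc] := dir_bound f.
apply: filterS (ville_bounded_ae d0 XP (supermartingale_sq d0 f0 fc)).
move=> w [L LP]; exists (L / 16) => eta e0 n.
set A := acc (fun h _ => wsum f h ^+ 2 / (k h ^+ 2 * (k h + 1))) (hX w n).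
have AL : A <= L.
  apply: le_trans (LP n); rewrite lerDl addr_ge0 //.
    by rewrite divr_ge0 ?sqr_ge0.
  by rewrite divr_ge0 ?addr_ge0 // mulr_ge0 ?sqr_ge0.
apply: (@le_trans _ _ ((s + eta) * H n + (16 * eta)^-1 * A)); last first.
  rewrite lerD2l -mulrA -invfM [X in _ <= X]mulrC.
  by apply: ler_wpM2l => //; rewrite invr_ge0 mulr_ge0 // ltW.
have -> : H n = H (size (hX w n)) by rewrite size_hist.
rewrite -acc_harm -accZ -accD; apply: acc_le => h _.
rewrite cexp_sq -/s -/f.
have k0 : 0 < k h + 1 by rewrite ltr_pwDr.
have -> : wsum f h ^+ 2 / (k h ^+ 2 * (k h + 1)) = (wsum f h / k h) ^+ 2 / (k h + 1).
  by rewrite invfM mulrA exprMn exprVn.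
rewrite (mulrA (16 * eta)^-1) -mulrDl ler_wpM2r ?invr_ge0 ?(ltW k0) //.
rewrite -addrA lerD2l.
have -> : wsum f h / (2 * k h) = (wsum f h / k h) / 2 by rewrite invfM [2^-1 * _]mulrC mulrA.
move: (wsum f h / k h) => x.
rewrite -subr_ge0.
have -> : eta + (16 * eta)^-1 * x ^+ 2 - x / 2 = (16 * eta)^-1 * (x - 4 * eta) ^+ 2.
  by field; rewrite gt_eqF.
by rewrite mulr_ge0 ?sqr_ge0 // invr_ge0 mulr_ge0 // ltW.
Qed.

Lemma mart_exp_supermartingale g (c th eta : R) : mean g = 0 -> (forall y, `|g y| <= c) ->
  0 <= eta <= 1 -> 0 <= th -> th * (2 * c) <= eta ->
  supermartingale (fun h => expR (th * mart g h - (1 + eta) / 2 * th ^+ 2 * bracket g h)).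
Proof.
move=> g0 gc e01 th0 the.
pose D h y : R := th * ((Num.sqrt (k h + 1))^-1 * eps g h y).
pose v h : R := th ^+ 2 * (cexp h (fun y => g y ^+ 2) / (k h + 1)).
have /supermartingale_exp : forall h, cexp h (fun y => expR (D h y - (1 + eta) / 2 * v h)) <= 1.
  move=> h; have k1 : 0 < k h + 1 by rewrite ltr_pwDr.
  apply: cexp_exp_2nd => //.
  - by rewrite /D cexpZ cexp_epsZ ?mulr0.
  - move=> y; rewrite /D !normrM (ger0_norm th0).
    apply: le_trans the; rewrite ler_wpM2l // -[leRHS]mul1r.
    apply: ler_pM => //; last exact: eps_le.
    rewrite ger0_norm ?invr_ge0 ?sqrtr_ge0 // invf_le1 ?sqrtr_gt0 //.
    by rewrite -[leLHS]sqrtr1 ler_wsqrtr // lerDr.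
  - rewrite /v /D (@eq_cexp _ _ _ _ (fun y => (th ^+ 2 / (k h + 1)) * eps g h y ^+ 2)).
      rewrite cexpZ -mulrA ler_wpM2l ?sqr_ge0 // [leLHS]mulrC ler_wpM2r ?invr_ge0 ?(ltW k1) //.
      exact: cexp_eps_sq_le.
    move=> y; rewrite !exprMn exprVn sqr_sqrtr ?(ltW k1) //; ring.
congr supermartingale; apply/funext => h; congr expR.
by rewrite accB !accZ mulrA.
Qed.

(* Stitching: the boundary at clock time [H n] is read off the exponential
   supermartingale whose parameter is tuned to the scale [exp (eta j)] that
   contains [H n]. *)
Lemma mart_upper_fixed_ae g (tau : R) : mean g = 0 ->
  mean (fun y => g y ^+ 2) < tau ->
  {ae P, forall w, \forall n \near \oo,
    mart g (hX w n) <= Num.sqrt (tau * (2 * H n * ln (ln (H n))))}.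
Proof.
move=> g0; set s := mean _ => st; have s0 : 0 <= s by exact: mean_sq_ge0.
have [c gc] := dir_bound g; have c0 : 0 <= c := bound_ge0 d0 gc.
(* The losses multiply to [(1 + eta)^3 * expR eta * (s + 2 eta) <= (1 + 12 eta) * (s + 2 eta)],
   which is at most [s + eta * (14 + 12 s)] when [eta <= 1/2]; the choice makes this at most
   [tau]. *)
pose eta := Num.min (1 / 2) ((tau - s) / (14 + 12 * s)).
have s14 : 0 < 14 + 12 * s by lra.
have e0 : 0 < eta by rewrite lt_min divr_gt0 //= divr_gt0 ?subr_gt0.
have e2 : eta <= 1 / 2 by rewrite ge_min lexx.
have es : eta * (14 + 12 * s) <= tau - s by rewrite -ler_pdivlMr // ge_min lexx orbT.
pose t1 := s + 2 * eta; have t10 : 0 < t1 by rewrite /t1; lra.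
have const : (1 + eta) ^+ 3 * expR eta * t1 <= tau.
  have E : expR eta <= 1 + 2 * eta.
    have := expR_ge1Dx (- eta); rewrite expRN => ee.
    have : expR eta * (1 - eta) <= 1 by rewrite mulrC -ler_pdivlMr ?expR_gt0 // mul1r.
    have e1 : 0 < 1 - eta by lra.
    rewrite -ler_pdivlMr // => /le_trans; apply; rewrite ler_pdivrMr //; nra.
  apply: (@le_trans _ _ ((1 + 5 * eta) * (1 + 2 * eta) * t1)).
    rewrite ler_wpM2r ?(ltW t10) // ler_pM ?expR_ge0 ?exprn_ge0 //; first by lra.
    have -> : (1 + eta) ^+ 3 = 1 + 3 * eta + 3 * eta ^+ 2 + eta ^+ 3 by ring.
    have : eta ^+ 2 <= eta / 2 by rewrite expr2; nra.
    have : eta ^+ 3 <= eta / 2 by rewrite exprS expr2; nra.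
    by lra.
  apply: (@le_trans _ _ ((1 + 12 * eta) * t1)); first by rewrite ler_wpM2r ?(ltW t10) //; nra.
  rewrite /t1; nra.
(* With [V = t1 * expR (eta * j)] bounding the bracket on scale [j], this value minimises
   [(ln j + th^2 V / 2) / th], the bound on [mart] obtained at level about [j]. *)
pose th (j : nat) := Num.sqrt (2 * ln j%:R / (t1 * expR (eta * j%:R))) : R.
have thE j : (1 <= j)%N -> th j ^+ 2 = 2 * ln j%:R / (t1 * expR (eta * j%:R)).
  move=> j1; rewrite /th sqr_sqrtr // divr_ge0 // ?mulr_ge0 ?ln_ge0 ?ler1n ?expR_ge0 //.
  exact: ltW.
have [J0 J0P] : exists J0, forall j, (J0 <= j)%N -> (1 <= j)%N /\ th j * (2 * c) <= eta.
  have [J0 _ J0P] := near_natr (1 + 16 * c ^+ 2 / (t1 * eta ^+ 4)).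
  exists (maxn 1 J0) => j; rewrite geq_max => /andP[j1 J0j]; split => //.
  have jj := J0P j J0j.
  rewrite -(ler_pXn2r (n := 2)) ?nnegrE ?mulr_ge0 ?sqrtr_ge0 ?(ltW e0) //.
  rewrite exprMn thE // mulrAC ler_pdivrMr ?mulr_gt0 ?expR_gt0 //.
  have j0 : (0 : R) < j%:R by rewrite ltr0n.
  have lj : ln j%:R <= j%:R :> R by rewrite ltW // ln_sublinear.
  have lj0 : 0 <= ln j%:R :> R by rewrite ln_ge0 // ler1n.
  have Ej : (eta * j%:R) ^+ 2 / 2 <= expR (eta * j%:R).
    have := @expR_ge1Dxn R (eta * j%:R) 1; rewrite mulr_ge0 ?(ltW e0) // => /(_ isT).
    by apply: le_trans; rewrite lerDr.
  have jj' : 16 * c ^+ 2 <= j%:R * (t1 * eta ^+ 4).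
    rewrite -ler_pdivrMr ?mulr_gt0 ?exprn_gt0 //; apply: le_trans jj.
    by rewrite lerDr.
  apply: (@le_trans _ _ (2 * j%:R * (2 * c) ^+ 2)).
    by rewrite ler_wpM2r ?sqr_ge0 // ler_wpM2l.
  apply: (@le_trans _ _ (eta ^+ 2 * (t1 * ((eta * j%:R) ^+ 2 / 2)))); last first.
    by rewrite ler_wpM2l ?sqr_ge0 // ler_wpM2l // ltW.
  have -> : eta ^+ 2 * (t1 * ((eta * j%:R) ^+ 2 / 2)) = j%:R / 2 * (j%:R * (t1 * eta ^+ 4)).
    by field.
  have -> : 2 * j%:R * (2 * c) ^+ 2 = j%:R / 2 * (16 * c ^+ 2) by field.
  by rewrite ler_wpM2l // divr_ge0 // ltW.
have e01 : 0 <= eta <= 1 by rewrite (ltW e0); lra.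
have Zf := @ville_family_ae R dT T P d X d0 XP J0
  (fun j h => expR (th j * mart g h - (1 + eta) / 2 * th j ^+ 2 * bracket g h)).
have /Zf {}Zf : forall j, (J0 <= j)%N ->
    supermartingale (fun h => expR (th j * mart g h - (1 + eta) / 2 * th j ^+ 2 * bracket g h)) /\
    expR (th j * mart g [::] - (1 + eta) / 2 * th j ^+ 2 * bracket g [::]) <= 1.
  move=> j /J0P[j1 jth]; split.
    by apply: mart_exp_supermartingale gc _ _ _ => //; exact: sqrtr_ge0.
  by rewrite /mart /bracket /= !mulr0 subr0 expR0.
apply: filterS2 Zf (bracket_le_ae g) => w [J JP] [L LP].
have [J2 _ J2P] := near_ln_thr (eta := eta) e0.
near=> n.
(* The scale with [expR (eta * (j - 1)) <= H n < expR (eta * j)]; it costs only a factor [expR eta]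
   in the clock, and [ln j] is at most [(1 + eta) * ln (ln (H n))]. *)
set x := ln (H n); pose j := (Num.truncn (x / eta)).+1.
have xB : eta * (2 + (maxn J (maxn J2 2))%:R) + 1 <= x by rewrite /x; near: n; exact: near_lnH.
have x0 : 0 < x.
  by apply: lt_le_trans xB; rewrite ltr_pwDr // mulr_ge0 ?(ltW e0) // addr_ge0.
have lxB : ln (2 / eta) / eta <= ln x by rewrite /x; near: n; exact: near_lnlnH.
have HB : L / eta / eta <= H n by near: n; exact: near_harm.
have Hn0 : 0 < H n by apply: lt_le_trans (_ : 1 <= _) => //; near: n; exact: near_harm.
have /andP[jl ju] : (j.-1)%:R <= x / eta < j%:R.
  by have := truncn_itv (divr_ge0 (ltW x0) (ltW e0)).
have Hx : expR x = H n by rewrite /x lnK.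
have xj : x <= eta * j%:R by rewrite mulrC -ler_pdivrMr // ltW.
have jx : eta * j%:R <= x + eta.
  by move: jl; rewrite ler_pdivlMr // /j /= -natr1 mulrDr mulr1 lerD2r mulrC.
have jM : (maxn J (maxn J2 2) <= j)%N.
  rewrite -(ler_nat R) -(ler_pM2l e0); apply: le_trans xj; apply: le_trans xB.
  by rewrite ler_wpDr // ler_wpM2l ?(ltW e0) // lerDr.
move: jM; rewrite !geq_max => /and3P[jJ jJ2 j2].
have j0 : (0 : R) < j%:R by rewrite ltr0n.
have lj : ln j%:R <= (1 + eta) * ln x :> R.
  apply: (@le_trans _ _ (ln (x * (2 / eta)))).
    rewrite ler_ln ?posrE ?mulr_gt0 ?invr_gt0 //.
    rewrite mulrA ler_pdivlMr // mulrC; apply: le_trans jx _.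
    have : eta <= x; last by lra.
    apply: le_trans xB; rewrite mulrDr -addrA ler_wpDr ?addr_ge0 ?mulr_ge0 ?(ltW e0) //.
    by rewrite ler_peMr ?(ltW e0) // ler1n.
  rewrite lnM ?posrE ?divr_gt0 //.
  by move: lxB; rewrite ler_pdivrMr // => ?; lra.
have lj0 : 0 < ln j%:R :> R by rewrite ln_gt0 // ltr1n.
set E := expR (eta * j%:R).
have E0 : 0 < E by exact: expR_gt0.
have HE : H n <= E by rewrite -Hx ler_expR.
have EH : E <= expR eta * H n by rewrite -Hx -expRD ler_expR addrC.
have th2 : th j ^+ 2 = 2 * ln j%:R / (t1 * E) by rewrite thE // ltnW.
have th0 : 0 < th j by rewrite sqrtr_gt0 divr_gt0 ?mulr_gt0.
have WE : bracket g (hX w n) <= t1 * E.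
  apply: le_trans (LP _ e0 n) _; rewrite -/s.
  have : L / eta <= eta * H n by move: HB; rewrite ler_pdivrMr // [H n * _]mulrC.
  rewrite /t1 => LH; apply: (@le_trans _ _ ((s + 2 * eta) * H n)); first by lra.
  by rewrite ler_wpM2l // ltW.
set m := mart g (hX w n).
have tm : th j * m <= 2 * (1 + eta) * ln j%:R.
  have : expR (th j * m - (1 + eta) / 2 * th j ^+ 2 * bracket g (hX w n)) <= thr R j.
    by apply/ltW/JP.
  rewrite -[leRHS]lnK ?posrE ?thr_gt0 // ler_expR => Z.
  have Lt := J2P j jJ2.
  have : (1 + eta) / 2 * th j ^+ 2 * bracket g (hX w n) <= (1 + eta) * ln j%:R.
    apply: (@le_trans _ _ ((1 + eta) / 2 * th j ^+ 2 * (t1 * E))).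
      by rewrite ler_wpM2l // mulr_ge0 ?sqr_ge0 // divr_ge0 // addr_ge0 // ltW.
    by rewrite th2 -mulrA divfK ?gt_eqF ?mulr_gt0 // mulrA divfK.
  by move: Z Lt => /=; lra.
have [m0|m0] := leP m 0; first exact: le_trans m0 (sqrtr_ge0 _).
have mE : m = Num.sqrt (m ^+ 2) by rewrite sqrtr_sqr gtr0_norm.
rewrite mE; apply: ler_wsqrtr.
have m2 : m ^+ 2 <= 2 * (1 + eta) ^+ 2 * ln j%:R * (t1 * E).
  have : (th j * m) ^+ 2 <= (2 * (1 + eta) * ln j%:R) ^+ 2.
    by rewrite lerXn2r ?nnegrE // ?mulr_ge0 ?addr_ge0 ?ltW.
  rewrite exprMn th2 mulrAC ler_pdivrMr ?mulr_gt0 // => M.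
  rewrite -(ler_pM2l (x := 2 * ln j%:R)) ?mulr_gt0 //; apply: le_trans M _.
  rewrite le_eqVlt; apply/orP; left; apply/eqP; ring.
apply: le_trans m2 _.
apply: (@le_trans _ _ (2 * (1 + eta) ^+ 2 * ((1 + eta) * ln x) * (t1 * (expR eta * H n)))).
  have e1 : 0 <= 1 + eta by rewrite addr_ge0 // ltW.
  apply: ler_pM.
  - by rewrite mulr_ge0 ?(ltW lj0) // mulr_ge0 // exprn_ge0.
  - by rewrite mulr_ge0 // ltW.
  - by rewrite ler_wpM2l // mulr_ge0 ?exprn_ge0 // addr_ge0 // ltW.
  - by rewrite ler_wpM2l // ltW.
have lx0 : 0 < ln x.
  by rewrite -(pmulr_rgt0 _ (_ : 0 < 1 + eta)) ?addr_gt0 //; exact: lt_le_trans lj.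
have -> : 2 * (1 + eta) ^+ 2 * ((1 + eta) * ln x) * (t1 * (expR eta * H n)) =
  ((1 + eta) ^+ 3 * expR eta * t1) * (2 * H n * ln x) by ring.
by rewrite ler_wpM2r // !mulr_ge0 // ltW.
Unshelve. all: by end_near. Qed.

End UpperLIL.

(** * Upper bounds for the walk and for the remainder of the center of mass *)

Section Bounds.
Variables (R : realType) (dT : measure_display) (T : measurableType dT).
Variables (P : probability T R) (d : nat) (X : nat -> T -> dir d).
Hypothesis d0 : (1 <= d)%N.
Hypothesis XP : is_ERW P ((2 * d%:R + 1) / (4 * d%:R)) X.
Notation H := (harm R).
Notation path := (seq (dir d)).
Notation k h := ((size h)%:R : R).
Notation hX w n := (hist (X^~ w) n).
Implicit Types g : dir d -> R.
Notation var g := (mean (fun y => g y ^+ 2)).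

Lemma wsumN g h : wsum (fun y => - g y) h = - wsum g h.
Proof. by rewrite /wsum sumrN. Qed.

Lemma meanN g : mean (fun y => - g y) = - mean g.
Proof. by rewrite /mean sumrN mulrN. Qed.

Lemma varN g : var (fun y => - g y) = var g.
Proof. by congr mean; apply/funext => y; rewrite sqrrN. Qed.

Lemma epsN g h y : eps (fun y => - g y) h y = - eps g h y.
Proof. by rewrite /eps wsumN mulNr opprB addrC opprK. Qed.

Lemma remnN g h : remn (fun y => - g y) h = - remn g h.
Proof.
elim: h => [|y h IH]; first by rewrite /remn /= oppr0.
have E g' : remn g' (y :: h) = remn g' h + k h * eps g' h y by [].
by rewrite !E IH epsN mulrN opprD.
Qed.

(** The iterated logarithm normalisation with [H n] in place of [ln n]; [near_lilscale] exchanges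
    the two at the end. *)
Definition lilscale (n : nat) : R := 2 * n%:R * H n * ln (ln (H n)).

Lemma wsum_upper_ae g (tau : R) : mean g = 0 -> var g < tau ->
  {ae P, forall w, \forall n \near \oo, wsum g (hX w n) <= Num.sqrt (tau * lilscale n)}.
Proof.
move=> g0 st; have s0 := mean_sq_ge0 g.
have [c gc] := dir_bound g; have c0 : 0 <= c := bound_ge0 d0 gc.
(* The midpoint leaves a positive gap [sqrt tau - sqrt t1]; multiplied by the diverging [sqrt ph],
   it absorbs the bounded distance [c] between [S / sqrt n] and [mart]. *)
pose t1 := (var g + tau) / 2.
have st1 : var g < t1 by rewrite /t1; lra.
have t1t : t1 < tau by rewrite /t1; lra.
have t10 : 0 <= t1 by lra.
have tau0 : 0 <= tau by lra.
have sq0 : 0 < Num.sqrt tau - Num.sqrt t1 by rewrite subr_gt0 ltr_sqrt //; lra.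
apply: filterS (mart_upper_fixed_ae d0 XP g0 st1) => w mw.
near=> n.
have n0 : (0 : R) < n%:R by rewrite ltr0n; near: n; exact: nbhs_infty_gt.
have sn0 : 0 < Num.sqrt n%:R :> R by rewrite sqrtr_gt0.
have H1 : 1 <= H n by near: n; exact: near_harm.
have l0 : (c / (Num.sqrt tau - Num.sqrt t1)) ^+ 2 <= ln (ln (H n)) by near: n; exact: near_lnlnH.
have l00 : 0 <= ln (ln (H n)) by apply: le_trans l0; exact: sqr_ge0.
set ph := 2 * H n * ln (ln (H n)).
have ph0 : 0 <= ph by rewrite /ph !mulr_ge0 // (le_trans _ H1).
have -> : tau * lilscale n = n%:R * (tau * ph) by rewrite /lilscale /ph; ring.
rewrite sqrtrM ?ler0n // mulrC -ler_pdivrMr //.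
have := wsum_mart d0 gc (hX w n); rewrite size_hist ler_norml => /andP[_].
have : mart g (hX w n) <= Num.sqrt (t1 * ph) by rewrite /ph; near: n; exact: mw.
rewrite (@sqrtrM _ t1 ph t10) (@sqrtrM _ tau ph tau0).
have : c <= (Num.sqrt tau - Num.sqrt t1) * Num.sqrt ph.
  rewrite mulrC -ler_pdivrMr //.
  have -> : c / (Num.sqrt tau - Num.sqrt t1) = Num.sqrt ((c / (Num.sqrt tau - Num.sqrt t1)) ^+ 2).
    by rewrite sqrtr_sqr ger0_norm // divr_ge0 // ltW.
  apply: ler_wsqrtr; apply: le_trans l0 _.
  by rewrite /ph -[leLHS]mul1r ler_wpM2r //; lra.
by rewrite mulrBl; lra.
Unshelve. all: by end_near. Qed.

Lemma wsum_sq_upper_fixed_ae g (tau : R) : mean g = 0 -> var g < tau ->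
  {ae P, forall w, \forall n \near \oo, wsum g (hX w n) ^+ 2 <= tau * lilscale n}.
Proof.
move=> g0 st.
have g0' : mean (fun y => - g y) = 0 by rewrite meanN g0 oppr0.
have st' : var (fun y => - g y) < tau by rewrite varN.
apply: filterS2 (wsum_upper_ae g0 st) (wsum_upper_ae g0' st') => w A B.
near=> n.
have H1 : 1 <= H n by near: n; exact: near_harm.
have l0 : 0 <= ln (ln (H n)) by near: n; exact: near_lnlnH.
have L0 : 0 <= tau * lilscale n.
  rewrite mulr_ge0 ?(le_trans (mean_sq_ge0 g) (ltW st)) //.
  by rewrite /lilscale !mulr_ge0 // (le_trans _ H1).
have : wsum g (hX w n) <= Num.sqrt (tau * lilscale n) by near: n; exact: A.
have : wsum (fun y => - g y) (hX w n) <= Num.sqrt (tau * lilscale n) by near: n; exact: B.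
rewrite wsumN => C D.
rewrite -real_normK ?num_real // -[leRHS]sqr_sqrtr // lerXn2r ?nnegrE ?sqrtr_ge0 //.
by rewrite ler_norml D lerNl C.
Unshelve. all: by end_near. Qed.

Lemma wsum_sq_upper_ae g : mean g = 0 ->
  {ae P, forall w, forall tau, var g < tau -> \forall n \near \oo,
     wsum g (hX w n) ^+ 2 <= tau * lilscale n}.
Proof.
move=> g0.
have : {ae P, forall w, forall m : nat, \forall n \near \oo,
     wsum g (hX w n) ^+ 2 <= (var g + m.+1%:R^-1) * lilscale n}.
  by apply: ae_foralln => m; apply: wsum_sq_upper_fixed_ae => //; rewrite ltrDl invr_gt0.
apply: filterS => w A tau st; have t0 : 0 < tau - var g by rewrite subr_gt0.
pose m := Num.bound (tau - var g)^-1; near=> n.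
have H1 : 1 <= H n by near: n; exact: near_harm.
have l0 : 0 <= ln (ln (H n)) by near: n; exact: near_lnlnH.
apply: (@le_trans _ _ ((var g + m.+1%:R^-1) * lilscale n)); first by near: n; exact: A.
rewrite ler_wpM2r //; first by rewrite /lilscale !mulr_ge0 // (le_trans _ H1).
rewrite -lerBrDl -[leRHS]invrK lef_pV2 ?posrE ?invr_gt0 //.
apply: le_trans (ltW (archi_boundP _)) _; first by rewrite invr_ge0 ltW.
by rewrite ler_nat.
Unshelve. all: by end_near. Qed.

Lemma near_harm_sq (e : R) : 0 < e -> \forall n \near \oo, H n ^+ 2 <= e * n%:R.
Proof.
move=> e0; pose e1 := Num.min 1 e / 16.
have e10 : 0 < e1 by rewrite divr_gt0 // lt_min ltr01.
have e11 : e1 <= 1 / 16 by rewrite ler_wpM2r // ge_min lexx.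
have e1e : 16 * e1 <= e by rewrite /e1 mulrC divfK // ge_min lexx orbT.
have [x0 x01 lnx] := ln_le_lin e10.
near=> n.
have n1 : (1 <= n)%N by near: n; exact: nbhs_infty_ge.
have nB : x0 ^+ 2 + e1 ^- 2 <= n%:R by near: n; exact: near_natr.
set t := Num.sqrt n%:R : R.
have tE : n%:R = t ^+ 2 by rewrite sqr_sqrtr.
have t0 : 0 < t by rewrite sqrtr_gt0 ltr0n.
have x00 : 0 <= x0 by apply: le_trans x01.
have tx : x0 <= t.
  rewrite -(ler_pXn2r (n := 2)) ?nnegrE ?(ltW t0) // -tE.
  by apply: le_trans nB; rewrite lerDl invr_ge0 sqr_ge0.
have te : 1 <= e1 * t.
  rewrite -ler_pdivrMl // mulr1 -(ler_pXn2r (n := 2)) ?nnegrE ?invr_ge0 ?(ltW t0) ?(ltW e10) //.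
  by rewrite exprVn -tE; apply: le_trans nB; rewrite lerDr sqr_ge0.
have L : H n <= 3 * e1 * t.
  have -> : n = n.-1.+1 by rewrite prednK.
  apply: le_trans (harm_ln _ _) _; rewrite prednK // tE lnXn //.
  have := lnx t tx; rewrite mulr2n; lra.
have H0 : 0 <= H n by rewrite -(prednK n1) ltW ?harm_gt0.
apply: (@le_trans _ _ ((3 * e1 * t) ^+ 2)); first by rewrite lerXn2r ?nnegrE // (le_trans H0).
rewrite exprMn -tE ler_wpM2r // exprMn; nra.
Unshelve. all: by end_near. Qed.

(** The law of large numbers follows from the upper bound just proved, since [n H ln ln H <= n H^2]
    is negligible against [n^2]. *)
Lemma wsum_lln_ae g : mean g = 0 ->
  {ae P, forall w, forall e, 0 < e -> \forall n \near \oo, `|wsum g (hX w n)| <= e * n%:R}.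
Proof.
move=> g0; apply: filterS (wsum_sq_upper_ae g0) => w /(_ (var g + 1)).
rewrite ltrDl ltr01 => /(_ isT) A e e0; have s0 := mean_sq_ge0 g.
near=> n.
have H1 : 1 <= H n by near: n; exact: near_harm.
have l1 : 1 <= ln (H n) by near: n; exact: near_lnH.
have l0 : 0 <= ln (ln (H n)) by near: n; exact: near_lnlnH.
have lH : ln (ln (H n)) <= H n.
  apply: (@le_trans _ _ (ln (H n))); first by rewrite ltW // ln_sublinear // (lt_le_trans _ l1).
  by rewrite ltW // ln_sublinear // (lt_le_trans _ H1).
have E : H n ^+ 2 <= e ^+ 2 / (2 * (var g + 1)) * n%:R.
  near: n; apply: near_harm_sq; rewrite divr_gt0 ?exprn_gt0 // mulr_gt0 //; lra.
rewrite -(ler_pXn2r (n := 2)) ?nnegrE ?mulr_ge0 ?(ltW e0) // real_normK ?num_real //.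
apply: (@le_trans _ _ ((var g + 1) * lilscale n)); first by near: n; exact: A.
rewrite /lilscale; apply: (@le_trans _ _ ((2 * (var g + 1)) * n%:R * H n ^+ 2)).
  have -> : (var g + 1) * (2 * n%:R * H n * ln (ln (H n))) =
    (2 * (var g + 1)) * n%:R * (H n * ln (ln (H n))) by ring.
  by rewrite ler_wpM2l ?expr2 ?ler_wpM2l ?mulr_ge0 //; lra.
move: E; have t0 : 0 < 2 * (var g + 1) by lra.
rewrite mulrAC ler_pdivlMr // => E.
rewrite exprMn [n%:R ^+ 2]expr2 mulrA [leLHS]mulrAC ler_wpM2r //.
by rewrite mulrC.
Unshelve. all: by end_near. Qed.

Lemma remn_exp_supermartingale g (c th : R) : mean g = 0 -> (forall y, `|g y| <= c) ->
  supermartingale (fun h => expR (th * remn g h -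
    acc (fun h _ => 2 * (th ^+ 2 * k h ^+ 2 * (4 * c ^+ 2))) h)).
Proof.
move=> g0 gc; pose D h y : R := th * (k h * eps g h y).
have /supermartingale_exp : forall h,
    cexp h (fun y => expR (D h y - 2 * (th ^+ 2 * k h ^+ 2 * (4 * c ^+ 2)))) <= 1.
  move=> h; apply: cexp_exp_subgaussian => //.
    by rewrite /D cexpZ cexp_epsZ ?mulr0.
  move=> y; rewrite /D !exprMn -mulrA ler_wpM2l ?sqr_ge0 // ler_wpM2l ?sqr_ge0 //.
  exact: eps_sq_le.
by congr supermartingale; apply/funext => h; rewrite accB !accZ.
Qed.

(** No scales are needed: one parameter [th n = sqrt (H n / n^3)] is spent on each time [n]. The
    resulting [remn^2 / n^2] of order [n H] still lacks the iterated logarithm, so it is negligible.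
    In the constant, [8 c^2] is the compensator and [2] comes from
    [ln (thr n) <= 2 ln n <= 2 H n]. *)
Lemma remn_upper_ae g (c : R) : mean g = 0 -> (forall y, `|g y| <= c) ->
  {ae P, forall w, \forall n \near \oo,
    remn g (hX w n) <= (8 * c ^+ 2 + 2) * Num.sqrt (H n * n%:R ^+ 3)}.
Proof.
move=> g0 gc; have c0 : 0 <= c := bound_ge0 d0 gc.
pose th (j : nat) : R := Num.sqrt (H j / j%:R ^+ 3).
pose B j : path -> R := acc (fun h _ => 2 * (th j ^+ 2 * k h ^+ 2 * (4 * c ^+ 2))).
have := @ville_family_ae R dT T P d X d0 XP 0 (fun j h => expR (th j * remn g h - B j h)).
have Z1 j : (0 <= j)%N -> supermartingale (fun h => expR (th j * remn g h - B j h)) /\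
    expR (th j * remn g [::] - B j [::]) <= 1.
  move=> _; split; first exact: remn_exp_supermartingale.
  by rewrite /remn /B /= mulr0 subr0 expR0.
move=> /(_ Z1); apply: filterS => w [J JP].
near=> n.
have n1 : (1 <= n)%N by near: n; exact: nbhs_infty_ge.
have nR : (0 : R) < n%:R by rewrite ltr0n.
have Hn : 0 < H n by rewrite -(prednK n1) harm_gt0.
have Jn : (J <= n)%N by near: n; exact: nbhs_infty_ge.
have Lt : ln (thr R n) <= (1 + 1) * ln n%:R by near: n; exact: near_ln_thr.
have lnH : ln n%:R <= H n.
  by apply: le_trans (ln_harm R n); rewrite ler_ln ?posrE ?ler_nat.
have th2 : th n ^+ 2 = H n / n%:R ^+ 3.
  by rewrite sqr_sqrtr // divr_ge0 ?exprn_ge0 // ltW.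
have th0 : 0 < th n by rewrite sqrtr_gt0 divr_gt0 ?exprn_gt0.
have A : B n (hX w n) <= 8 * c ^+ 2 * H n.
  have accn h : B n h <= 8 * c ^+ 2 * th n ^+ 2 * k h ^+ 3.
    elim: h => [|y h IH]; first by rewrite /B /= expr0n mulr0.
    have -> : B n (y :: h) = B n h + 2 * (th n ^+ 2 * k h ^+ 2 * (4 * c ^+ 2)) by [].
    apply: le_trans (lerD IH (lexx _)) _; rewrite [size (y :: h)]/= -(natr1 (size h)).
    have cc : 0 <= 8 * c ^+ 2 * th n ^+ 2 by rewrite mulr_ge0 ?sqr_ge0 // mulr_ge0 ?sqr_ge0.
    have kk : 0 <= k h by [].
    have -> : 8 * c ^+ 2 * th n ^+ 2 * k h ^+ 3 + 2 * (th n ^+ 2 * k h ^+ 2 * (4 * c ^+ 2)) =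
      8 * c ^+ 2 * th n ^+ 2 * (k h ^+ 3 + k h ^+ 2) by ring.
    by rewrite ler_wpM2l //; nra.
  apply: le_trans (accn _) _; rewrite size_hist th2 -mulrA divfK // gt_eqF // exprn_gt0 //.
have : expR (th n * remn g (hX w n) - B n (hX w n)) <= thr R n.
  by apply/ltW/JP.
rewrite -[leRHS]lnK ?posrE ?thr_gt0 // ler_expR => Z.
have : th n * remn g (hX w n) <= (8 * c ^+ 2 + 2) * H n by move: Z A Lt lnH; lra.
have HE : H n = th n * Num.sqrt (H n * n%:R ^+ 3).
  rewrite /th -sqrtrM ?divr_ge0 ?exprn_ge0 ?(ltW Hn) //.
  rewrite (_ : _ / _ * _ = H n ^+ 2) ?sqrtr_sqr ?gtr0_norm //.
  by field; rewrite gt_eqF.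
by rewrite {1}HE mulrCA ler_pM2l.
Unshelve. all: by end_near. Qed.

Lemma remn_sq_upper_ae g : mean g = 0 -> {ae P, forall w, exists C : R,
  \forall n \near \oo, remn g (hX w n) ^+ 2 <= C * (H n * n%:R ^+ 3)}.
Proof.
move=> g0; have [c gc] := dir_bound g.
have g0' : mean (fun y => - g y) = 0 by rewrite meanN g0 oppr0.
have gc' y : `|- g y| <= c by rewrite normrN.
apply: filterS2 (remn_upper_ae g0 gc) (remn_upper_ae g0' gc') => w A B.
exists ((8 * c ^+ 2 + 2) ^+ 2); near=> n.
have n1 : (1 <= n)%N by near: n; exact: nbhs_infty_ge.
have Hn : 0 < H n by rewrite -(prednK n1) harm_gt0.
have A' : remn g (hX w n) <= (8 * c ^+ 2 + 2) * Num.sqrt (H n * n%:R ^+ 3) by near: n; exact: A.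
have B' : remn (fun y => - g y) (hX w n) <= (8 * c ^+ 2 + 2) * Num.sqrt (H n * n%:R ^+ 3).
  by near: n; exact: B.
rewrite remnN in B'.
have -> : (8 * c ^+ 2 + 2) ^+ 2 * (H n * n%:R ^+ 3) =
    ((8 * c ^+ 2 + 2) * Num.sqrt (H n * n%:R ^+ 3)) ^+ 2.
  by rewrite exprMn sqr_sqrtr // mulr_ge0 ?exprn_ge0 // ltW.
rewrite -real_normK ?num_real // lerXn2r ?nnegrE // ?mulr_ge0 ?sqrtr_ge0 //.
  by rewrite addr_ge0 // mulr_ge0 // sqr_ge0.
by rewrite ler_norml A' lerNl B'.
Unshelve. all: by end_near. Qed.

Lemma remn_sum_ae g : mean g = 0 -> {ae P, forall w, exists L : R, forall n,
  acc (fun h _ => remn g h ^+ 2 / (k h ^+ 3 * (k h + 1) * H (size h) * H (size h).+1)) (hX w n) <= L}.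
Proof.
move=> g0; have [c gc] := dir_bound g.
apply: filterS (ville_bounded_ae d0 XP (supermartingale_remn d0 g0 gc)) => w [L LP].
exists L => n; apply: le_trans (LP n); rewrite lerDl.
have Hge0 m : 0 <= H m by case: m => [|m]; [rewrite harm0|rewrite ltW ?harm_gt0].
apply: addr_ge0; rewrite divr_ge0 ?sqr_ge0 //.
  by rewrite !mulr_ge0 ?exprn_ge0.
by rewrite mulr_ge0 // sqr_ge0.
Qed.

End Bounds.

(** * Quadratic strong law *)

Section Sums.
Variable R : realType.
Notation H := (harm R).
Implicit Types (a b : nat -> R).

Lemma sum_le_near a b : (\forall i \near \oo, a i <= b i) ->
  exists C : R, forall n, \sum_(0 <= i < n) a i <= C + \sum_(0 <= i < n) b i.
Proof.
move=> [N _ NP]; exists (\sum_(0 <= i < N) `|a i - b i|) => n.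
rewrite -lerBlDr -sumrB.
have [nN|Nn] := leqP n N.
  rewrite [leRHS](big_cat_nat (n := n)) //=; apply: ler_wpDr; first exact: sumr_ge0.
  by apply: ler_sum => i _; exact: ler_norm.
rewrite [leLHS](big_cat_nat (n := N)) //= ?(ltnW Nn) //; apply: ler_wnDr.
  rewrite big_nat_cond; apply: sumr_le0 => i /andP[/andP[Ni _] _].
  by rewrite subr_le0 NP.
by apply: ler_sum => i _; exact: ler_norm.
Qed.

(** The clock of the quadratic law: it is to [ln H] what [H] is to [ln], and the weights of [sqsum]
    add up to it exactly. *)
Definition llog (n : nat) : R := \sum_(0 <= i < n) (i.+1%:R * H i.+1)^-1.

Lemma llogS n : llog n.+1 = llog n + (n.+1%:R * H n.+1)^-1.
Proof. by rewrite /llog big_nat_recr. Qed.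

Lemma llog1 : llog 1 = 1.
Proof. by rewrite llogS /llog big_geq // harmS harm0 !add0r invr1 mulr1 invr1. Qed.

Lemma llog_ge n : ln (H n.+1) <= llog n.+1.
Proof.
(* The added [1 / H] absorbs the gap between the weights [1 / (n H_{n-1})] and [1 / (n H_n)], which
   telescopes by [harm_inv_diff]. *)
suff : ln (H n.+1) + (H n.+1)^-1 <= llog n.+1.
  by apply: le_trans; rewrite lerDl invr_ge0 ltW ?harm_gt0.
elim: n => [|n IH]; first by rewrite llog1 harmS harm0 add0r invr1 ln1 invr1 add0r.
rewrite llogS; have h0 := harm_gt0 R n; have h1 := harm_gt0 R n.+1.
have D := harm_inv_diff R n.
have n0 : (0 : R) < n.+2%:R by [].
have L : ln (H n.+2) <= ln (H n.+1) + (n.+2%:R * H n.+1)^-1.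
  have -> : H n.+2 = H n.+1 * (1 + (n.+2%:R * H n.+1)^-1).
    by rewrite harmS; move: (n.+2%:R) n0 (H n.+1) h0 => k k0 x x0; field; rewrite !gt_eqF.
  have p0 : 0 <= (n.+2%:R * H n.+1)^-1 by rewrite invr_ge0 mulr_ge0 // ltW.
  rewrite lnM ?posrE ?ltr_pwDl // lerD2l; apply: le_ln1Dx.
  by rewrite (@lt_le_trans _ _ 0).
have E : (n.+2%:R * H n.+1)^-1 <= (n.+2%:R * H n.+2)^-1 + (n.+2%:R * H n.+1 * H n.+2)^-1.
  have -> : (n.+2%:R * H n.+1)^-1 = (n.+2%:R * H n.+2)^-1 + n.+2%:R^-1 * (n.+2%:R * H n.+1 * H n.+2)^-1.
    rewrite (harmS _ n.+1) in h1 *.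
    by move: (n.+2%:R) n0 (H n.+1) h0 h1 => k k0 x x0 xk; field; rewrite !gt_eqF ?addr_gt0 ?mulr_gt0.
  rewrite lerD2l ler_piMl // ?invr_ge0 ?mulr_ge0 ?ltW // invf_lt1 // ltr1n //.
move: IH L E; rewrite D.
move: (ln (H n.+2)) (ln (H n.+1)) (H n.+1)^-1 (H n.+2)^-1 (llog _) => l2 l1 i1 i2 l.
by move: (_ * H n.+1)^-1 (_ * H n.+2)^-1 => a b; lra.
Qed.

Lemma llog_le n : llog n.+1 <= 1 + ln (H n.+1).
Proof.
elim: n => [|n IH]; first by rewrite llog1 harmS harm0 add0r invr1 ln1 addr0.
rewrite llogS; have h0 := harm_gt0 R n; have h1 := harm_gt0 R n.+1.
have n0 : (0 : R) < n.+2%:R by [].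
have L : ln (H n.+1 / H n.+2) <= - (n.+2%:R * H n.+2)^-1.
  have -> : H n.+1 / H n.+2 = 1 + (- (n.+2%:R * H n.+2)^-1).
    rewrite (harmS _ n.+1) in h1 *.
    by move: (n.+2%:R) n0 (H n.+1) h0 h1 => k k0 x x0 xk; field; rewrite !gt_eqF ?addr_gt0 ?mulr_gt0.
  apply: le_ln1Dx; rewrite ltrN2 invf_lt1 ?mulr_gt0 //.
  by rewrite (lt_le_trans (_ : 1 < n.+2%:R)) ?ltr1n // ler_peMr ?harm_ge1.
move: L; rewrite ln_div ?posrE //; move: IH.
by move: (ln (H n.+2)) (ln (H n.+1)) (llog _) (_ * H n.+2)^-1 => l2 l1 l a; lra.
Qed.

Lemma near_llog B : \forall n \near \oo, B <= llog n.
Proof.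
near=> n; have n1 : (1 <= n)%N by near: n; exact: nbhs_infty_ge.
apply: (@le_trans _ _ (ln (H n))); first by near: n; exact: near_lnH.
by rewrite -(prednK n1) llog_ge.
Unshelve. all: by end_near. Qed.

End Sums.

Section QSL.
Variables (R : realType) (dT : measure_display) (T : measurableType dT).
Variables (P : probability T R) (d : nat) (X : nat -> T -> dir d).
Hypothesis d0 : (1 <= d)%N.
Hypothesis XP : is_ERW P ((2 * d%:R + 1) / (4 * d%:R)) X.
Notation H := (harm R).
Notation path := (seq (dir d)).
Notation k h := ((size h)%:R : R).
Notation hX w n := (hist (X^~ w) n).
Implicit Types g : dir d -> R.
Notation var g := (mean (fun y => g y ^+ 2)).
Notation L := (llog R).

Lemma acc_hist (a : path -> dir d -> R) (x : nat -> dir d) n :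
  acc a (hist x n) = \sum_(0 <= i < n) a (hist x i) (x i.+1).
Proof.
elim: n => [|n IH]; first by rewrite big_geq.
by rewrite big_nat_recr //= IH.
Qed.

Definition qvar g : path -> R :=
  acc (fun h _ => wsum g h ^+ 2 / (k h * (k h + 1) * H (size h) * H (size h).+1)).
Definition nmart g : path -> R :=
  acc (fun h y => wsum g h / ((k h + 1) * H (size h).+1) * eps g h y).
Definition sqsum g : path -> R :=
  acc (fun h y => g y ^+ 2 / ((k h + 1) * H (size h).+1)).

(** Expanding the square gives [(1 + 1/k) S^2 + 2 S eps + g^2]. The critical drift [1 + 1/k] cancels
    the passage from [k] to [k + 1] exactly, so only the change of [H] remains, and it produces
    [qvar]. *)
Lemma quadratic_identity g h :
  wsum g h ^+ 2 / (k h * H (size h)) = sqsum g h + 2 * nmart g h - qvar g h.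
Proof.
elim: h => [|y h IH]; first by rewrite /sqsum /nmart /qvar /= wsum_nil expr0n !mul0r mulr0 !addr0 subr0.
have Es : sqsum g (y :: h) = sqsum g h + g y ^+ 2 / ((k h + 1) * H (size h).+1) by [].
have En : nmart g (y :: h) = nmart g h + wsum g h / ((k h + 1) * H (size h).+1) * eps g h y by [].
have Eq : qvar g (y :: h) = qvar g h +
  wsum g h ^+ 2 / (k h * (k h + 1) * H (size h) * H (size h).+1) by [].
have -> : sqsum g (y :: h) + 2 * nmart g (y :: h) - qvar g (y :: h) =
   (sqsum g h + 2 * nmart g h - qvar g h) + (g y ^+ 2 / ((k h + 1) * H (size h).+1)
   + 2 * (wsum g h / ((k h + 1) * H (size h).+1) * eps g h y)
   - wsum g h ^+ 2 / (k h * (k h + 1) * H (size h) * H (size h).+1)).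
  by rewrite Es En Eq; ring.
rewrite -IH wsum_cons /eps [size (y :: h)]/= -(natr1 (size h)).
have [->|hn] := eqVneq h [::].
  have z : (0 : R) ^+ 2 = 0 by rewrite expr0n.
  by rewrite wsum_nil !(z, mul0r, mulr0, add0r, addr0, subr0).
have k0 : 0 < k h by rewrite ltr0n lt0n size_eq0.
have h0 : 0 < H (size h) by case: (h) hn => // ? ? _; exact: harm_gt0.
have k1 : 0 < k h + 1 by lra.
have hE : H (size h).+1 = H (size h) + (k h + 1)^-1 by rewrite harmS natr1.
have h1 := harm_gt0 R (size h); rewrite hE in h1 *.
move: (wsum g h) (k h) k0 k1 (H (size h)) h0 h1 => s x x0 x1 z z0 zx.
have zz : 0 < z * (x + 1) + 1 by rewrite ltr_pwDr // mulr_ge0 // ltW.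
by field; rewrite !gt_eqF.
Qed.

(** Abel summation: the weight [w'] changes by at most [2 / k] times itself per step, so the
    weighted sum of centered squares inherits the law of large numbers of the unweighted one. *)
Lemma sqsum_lln_ae g : {ae P, forall w, forall e, 0 < e ->
  \forall n \near \oo, `|sqsum g (hX w n) - var g * L n| <= e * L n}.
Proof.
set s := var g; pose f y := g y ^+ 2 - s.
have f0 : mean f = 0 by rewrite meanB // subrr.
pose w' (h : path) := ((k h + 1) * H (size h).+1)^-1.
pose F : path -> R := acc (fun h y => f y * w' h).
have FE x n : sqsum g (hist x n) - s * L n = F (hist x n).
  rewrite /sqsum /F !acc_hist /llog mulr_sumr -sumrB; apply: eq_bigr => i _.
  by rewrite /w' /f size_hist natr1 mulrBl.
have abel h : F h - wsum f h / (k h * H (size h)) =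
    acc (fun h _ => wsum f h * ((k h * H (size h))^-1 - w' h)) h.
  elim: h => [|y h IH]; first by rewrite /F /= wsum_nil mul0r subrr.
  rewrite /F [acc _ (y :: h)]/= -/F [RHS]/= -IH wsum_cons -(natr1 (size h)) -/(w' h).
  by ring.
have wdiff h : `|wsum f h * ((k h * H (size h))^-1 - w' h)| <= 2 * (`|wsum f h| / k h) * w' h.
  have [->|hn] := eqVneq h [::]; first by rewrite wsum_nil mul0r normr0 !mul0r mulr0 mul0r.
  have k0 : 0 < k h by rewrite ltr0n lt0n size_eq0.
  have h0 : 1 <= H (size h) by case: (h) hn => // ? ? _; exact: harm_ge1.
  have h1 := harm_gt0 R (size h).
  rewrite normrM [leRHS](_ : _ = `|wsum f h| * (2 / k h * w' h)); last by ring.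
  apply: ler_wpM2l => //.
  have E : (k h * H (size h))^-1 - w' h = (1 + (H (size h))^-1) / k h * w' h.
    rewrite /w'; have hE : H (size h).+1 = H (size h) + (k h + 1)^-1 by rewrite harmS natr1.
    rewrite hE in h1 *; have k1 : 0 < k h + 1 by lra.
    have h00 : 0 < H (size h) by lra.
    move: (k h) k0 k1 (H (size h)) h00 h1 => x x0 x1 z z0 zx.
    have zz : 0 < z * (x + 1) + 1 by rewrite ltr_pwDr // mulr_ge0 // ltW.
    by field; rewrite !gt_eqF.
  have w0 : 0 <= w' h by rewrite invr_ge0 mulr_ge0 ?ltW // addr_ge0.
  have i0 : 0 <= (H (size h))^-1 by rewrite invr_ge0; lra.
  have i1 : (H (size h))^-1 <= 1 by rewrite invf_le1 //; lra.
  rewrite E ger0_norm; last by rewrite mulr_ge0 // divr_ge0 // addr_ge0.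
  by rewrite ler_wpM2r // ler_wpM2r ?invr_ge0 //; lra.
apply: filterS (wsum_lln_ae d0 XP f0) => w A e e0.
have [C CP] : exists C : R, forall n,
    \sum_(0 <= i < n) `|wsum f (hX w i) * ((k (hX w i) * H (size (hX w i)))^-1 - w' (hX w i))| <=
    C + \sum_(0 <= i < n) e / 4 * (i.+1%:R * H i.+1)^-1.
  apply: sum_le_near; near=> i; apply: le_trans (wdiff _) _.
  rewrite /w' size_hist natr1.
  have i1 : (0 : R) < i%:R by rewrite ltr0n; near: i; exact: nbhs_infty_gt.
  apply: ler_wpM2r; first by rewrite invr_ge0 mulr_ge0 // ltW ?harm_gt0.
  have : `|wsum f (hX w i)| <= e / 8 * i%:R by near: i; apply: A; lra.
  by rewrite -ler_pdivrMr // => ?; lra.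
near=> n; rewrite FE.
have n1 : (1 <= n)%N by near: n; exact: nbhs_infty_ge.
have n0 : (0 : R) < n%:R by rewrite ltr0n.
have Hn : 1 <= H n by near: n; exact: near_harm.
have Ln : 4 * C / e + 1 <= L n by near: n; exact: near_llog.
have -> : F (hX w n) = (F (hX w n) - wsum f (hX w n) / (k (hX w n) * H (size (hX w n))))
   + wsum f (hX w n) / (n%:R * H n) by rewrite size_hist subrK.
rewrite abel acc_hist; apply: le_trans (ler_normD _ _) _.
have T1 : `|wsum f (hX w n) / (n%:R * H n)| <= e / 4.
  rewrite normrM normfV (ger0_norm (x := _ * _)); last by rewrite mulr_ge0 //; lra.
  have : `|wsum f (hX w n)| <= e / 4 * n%:R by near: n; apply: A; lra.
  rewrite ler_pdivrMr ?mulr_gt0 //; last by lra.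
  by move=> /le_trans; apply; rewrite mulrA ler_peMr // mulr_ge0 //; lra.
have := CP n; rewrite -mulr_sumr -/(llog R n) => T2.
have T3 := le_trans (ler_norm_sum _ _ _) T2.
apply: le_trans (lerD T3 T1) _.
have C4 : C <= e / 4 * L n.
  have : 4 * C / e <= L n by lra.
  rewrite ler_pdivrMr // => ?; lra.
have L1 : 1 <= L n by near: n; exact: near_llog.
have : e / 4 <= e / 4 * L n by rewrite ler_peMr //; lra.
by lra.
Unshelve. all: by end_near. Qed.

End QSL.

(** * Comparison of harmonic and logarithmic normalisations *)

Section Scales.
Variable R : realType.
Notation H := (harm R).
Notation L := (llog R).

Lemma harm_ge0 n : 0 <= H n.
Proof. by case: n => [|n]; [rewrite harm0|rewrite ltW ?harm_gt0]. Qed.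

Lemma near_scale (e : R) : 0 < e -> \forall n \near \oo,
  1 <= (n%:R + 1) * H n * H n.+1 / (n%:R * ln n%:R ^+ 2) <= 1 + e.
Proof.
move=> e0; near=> n.
have n2 : (2 <= n)%N by near: n; exact: nbhs_infty_ge.
have n0 : (0 : R) < n%:R by rewrite ltr0n (leq_trans _ n2).
pose e1 := Num.min 1 e / 32.
have e10 : 0 < e1 by rewrite divr_gt0 // lt_min ltr01.
have e11 : e1 <= 1 / 32 by rewrite ler_wpM2r // ge_min lexx.
have e1e : 32 * e1 <= e by rewrite /e1 mulrC divfK // ge_min lexx orbT.
set l : R := ln n%:R.
have lB : (1 + e1^-1) * 2 <= l by rewrite /l /e1; near: n; exact: near_ln.
have nB : e1^-1 <= n%:R by rewrite /e1; near: n; exact: near_natr.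
have i0 : 0 < e1^-1 by rewrite invr_gt0.
have l0 : 0 < l by lra.
have n1' : 1 <= e1 * n%:R by rewrite -ler_pdivrMl // mulr1.
have l1' : 2 <= e1 * l.
  have : e1^-1 * 2 <= l by lra.
  by rewrite mulrC -ler_pdivlMr ?invr_gt0 // invrK mulrC.
have Hl : l <= H n.
  by apply: le_trans (ln_harm R n); rewrite ler_ln ?posrE // ler_nat.
have HS : H n <= H n.+1 by rewrite harmS lerDl.
have Hu : H n.+1 <= 2 + l.
  have : ln n.+1%:R <= 1 + l.
    by apply: ln_le_double; rewrite // muln2 -addnn -addn1 leq_add // ltnW.
  by have := harm_ln R n; lra.
have d0' : 0 < n%:R * l ^+ 2 by rewrite mulr_gt0 // exprn_gt0.
rewrite ler_pdivlMr // ler_pdivrMr // mul1r expr2 mulrA; apply/andP; split.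
  apply: ler_pM => //; rewrite ?mulr_ge0 ?(ltW l0) ?(ltW n0) //; last exact: le_trans HS.
  by apply: ler_pM => //; rewrite ?(ltW l0) ?(ltW n0) // lerDl.
have H0 : 0 <= H n by lra.
have up : H n * H n.+1 <= ((1 + e1) * l) * ((1 + e1) * l).
  by apply: ler_pM => //; lra.
have un : n%:R + 1 <= (1 + e1) * n%:R :> R by lra.
rewrite -mulrA; apply: (@le_trans _ _ (((1 + e1) * n%:R) * (((1 + e1) * l) * ((1 + e1) * l)))).
  by apply: ler_pM => //; rewrite ?mulr_ge0 ?addr_ge0 ?ler0n //; lra.
have -> : (1 + e1) * n%:R * ((1 + e1) * l * ((1 + e1) * l)) = (1 + e1) ^+ 3 * (n%:R * l * l) by ring.
rewrite ler_wpM2r ?mulr_ge0 ?(ltW l0) ?ler0n //.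
have -> : (1 + e1) ^+ 3 = 1 + 3 * e1 + 3 * e1 ^+ 2 + e1 ^+ 3 by ring.
have : e1 ^+ 2 <= e1 by rewrite expr2; nra.
have : e1 ^+ 3 <= e1 by rewrite exprS expr2; nra.
by lra.
Unshelve. all: by end_near. Qed.

Lemma near_llog_lnln : \forall n \near \oo,
  ln (ln n%:R) <= L n.+1 <= ln (ln n%:R) + 2.
Proof.
near=> n.
have n2 : (2 <= n)%N by near: n; exact: nbhs_infty_ge.
have n0 : (0 : R) < n%:R by rewrite ltr0n (leq_trans _ n2).
have l3 : 3 <= ln n%:R :> R by near: n; exact: near_ln.
have l0 : 0 < ln n%:R :> R by lra.
have H1 := harm_gt0 R n.
have [_ l2] := ln2_itv R.
apply/andP; split.
  apply: le_trans (llog_ge R n); rewrite ler_ln ?posrE //.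
  by apply: le_trans (ln_harm R _); rewrite ler_ln ?posrE // ler_nat leqW.
apply: le_trans (llog_le R n) _.
have Hu : H n.+1 <= 2 * ln n%:R.
  have : ln n.+1%:R <= 1 + ln n%:R :> R.
    by apply: ln_le_double; rewrite // muln2 -addnn -addn1 leq_add // ltnW.
  by have := harm_ln R n; lra.
have : ln (H n.+1) <= ln (2 * ln n%:R) by rewrite ler_ln ?posrE ?mulr_gt0.
by rewrite lnM ?posrE //; lra.
Unshelve. all: by end_near. Qed.

End Scales.

(** A bootstrap, since the martingale [nm] is controlled by [q] itself. First [kap <= 1/2] allows
    absorption and gives the crude bound [q <= 2 (s + 1) l]; this is then fed back with the small
    [kap]. *)
Lemma quadratic_perturbation (R : realFieldType) (q sq nm u s l e e1 kap C : R) :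
  u = sq + 2 * nm - q -> 0 <= q -> 0 <= s -> 1 <= l ->
  0 <= u -> u <= e1 / 3 * l -> `|sq - s * l| <= e1 / 3 * l ->
  2 * `|nm| <= kap * q + 2 * C -> 2 * C <= e1 / 3 * l ->
  e1 <= 1 -> e1 <= e / 2 -> 0 <= kap -> kap <= 1 / 2 -> kap * (4 * (s + 1)) <= e ->
  `|q - s * l| <= e * l.
Proof.
move=> uE q0 s0 l1 u0 ul sl nl Cl e11 e1e kap0 kap2 kape.
have l0 : 0 <= l by lra.
have K1 : `|q - s * l| <= kap * q + e1 * l.
  have -> : q - s * l = (sq - s * l) + (2 * nm + - u) by lra.
  apply: le_trans (ler_normD _ _) _; apply: le_trans (lerD sl (ler_normD _ _)) _.
  by rewrite normrN (ger0_norm u0) normrM (ger0_norm (x := 2)) //; lra.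
have e1l : e1 * l <= l by rewrite ler_piMl.
have qs : q <= 2 * (s + 1) * l.
  have Q1 := ler_norm (q - s * l).
  have Q2 : kap * q <= 1 / 2 * q by rewrite ler_wpM2r.
  by lra.
apply: le_trans K1 _.
have E1 : kap * q <= kap * (2 * (s + 1) * l) by rewrite ler_wpM2l.
have E2 : kap * (4 * (s + 1)) * l <= e * l by rewrite ler_wpM2r.
have E3 : e1 * l <= e / 2 * l by rewrite ler_wpM2r.
by lra.
Qed.

Section QSL2.
Variables (R : realType) (dT : measure_display) (T : measurableType dT).
Variables (P : probability T R) (d : nat) (X : nat -> T -> dir d).
Hypothesis d0 : (1 <= d)%N.
Hypothesis XP : is_ERW P ((2 * d%:R + 1) / (4 * d%:R)) X.
Notation H := (harm R).
Notation path := (seq (dir d)).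
Notation k h := ((size h)%:R : R).
Notation hX w n := (hist (X^~ w) n).
Implicit Types g : dir d -> R.
Notation var g := (mean (fun y => g y ^+ 2)).
Notation L := (llog R).

Lemma nmart_exp_supermartingale g (c th : R) : mean g = 0 -> (forall y, `|g y| <= c) ->
  supermartingale (fun h => expR (th * nmart g h - 8 * c ^+ 2 * th ^+ 2 * qvar g h)).
Proof.
move=> g0 gc.
pose D h y : R := th * (wsum g h / ((k h + 1) * H (size h).+1) * eps g h y).
pose b h : R := (th ^+ 2 * (4 * c ^+ 2)) * (wsum g h ^+ 2 / (k h * (k h + 1) * H (size h) * H (size h).+1)).
have /supermartingale_exp : forall h, cexp h (fun y => expR (D h y - 2 * b h)) <= 1.
  move=> h; apply: cexp_exp_subgaussian => //.
    by rewrite /D cexpZ cexp_epsZ ?mulr0.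
  move=> y; rewrite /D /b [leRHS]mulrAC -[leRHS]mulrA !exprMn ler_wpM2l ?sqr_ge0 //.
  have [->|hn] := eqVneq h [::].
    by rewrite wsum_nil expr0n !mul0r.
  have k0 : 0 < k h by rewrite ltr0n lt0n size_eq0.
  have h0 : 0 < H (size h) by case: (h) hn => // ? ? _; exact: harm_gt0.
  have h1 := harm_gt0 R (size h).
  have k1 : 0 < k h + 1 by lra.
  apply: ler_pM; rewrite ?sqr_ge0 //; last exact: eps_sq_le.
    by rewrite mulr_ge0 ?sqr_ge0.
  rewrite ler_wpM2l ?sqr_ge0 // exprVn lef_pV2 ?posrE ?exprn_gt0 ?mulr_gt0 //.
  have -> : ((k h + 1) * H (size h).+1) ^+ 2 = (k h + 1) * (k h + 1) * H (size h).+1 * H (size h).+1 by ring.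
  rewrite ler_wpM2r ?(ltW h1) //.
  apply: ler_pM; rewrite ?mulr_ge0 ?ltW //.
    by rewrite ltr_pM2r //; lra.
  by rewrite harmS ltrDl.
congr supermartingale; apply/funext => h; congr expR.
rewrite accB !accZ -/(nmart g h); congr (_ - _).
by rewrite -/(qvar g h); ring.
Qed.

(** A fixed parameter [th] gives a linear bound of slope [8 c^2 th] in the bracket. The countably
    many values [th = 1 / (m + 1)], with both signs, make the slope as small as desired, in place of
    a strong law for martingales. *)
Lemma nmart_le_ae g (c : R) : mean g = 0 -> (forall y, `|g y| <= c) ->
  {ae P, forall w, forall m : nat, exists C : R, forall n,
     `|nmart g (hX w n)| <= 8 * c ^+ 2 / m.+1%:R * qvar g (hX w n) + C}.
Proof.
move=> g0 gc; apply: ae_foralln => m; pose th : R := m.+1%:R^-1.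
have th0 : 0 < th by rewrite invr_gt0.
have A := ville_bounded_ae d0 XP (nmart_exp_supermartingale th g0 gc).
have B := ville_bounded_ae d0 XP (nmart_exp_supermartingale (- th) g0 gc).
apply: filterS2 A B => w [C1 C1P] [C2 C2P].
exists ((`|C1| + `|C2|) / th) => n.
have lin (z C : R) : expR z <= C -> z <= `|C|.
  move=> zC; apply: le_trans (ler_norm C).
  by have := expR_ge1Dx z; lra.
have := lin _ _ (C1P n); have := lin _ _ (C2P n).
rewrite sqrrN -/th => I2 I1.
have n1 := normr_ge0 C1; have n2 := normr_ge0 C2.
have key : th * `|nmart g (hX w n)| <= 8 * c ^+ 2 * th ^+ 2 * qvar g (hX w n) + (`|C1| + `|C2|).
  by case: ger0P => _; lra.
rewrite -(ler_pM2l th0); apply: le_trans key _.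
rewrite mulrDr [X in _ <= _ + X]mulrCA divff ?gt_eqF // mulr1 lerD2r.
by rewrite le_eqVlt; apply/orP; left; apply/eqP; ring.
Qed.

Lemma qvar_qsl_ae g : mean g = 0 -> {ae P, forall w, forall e, 0 < e ->
  \forall n \near \oo, `|qvar g (hX w n) - var g * L n| <= e * L n}.
Proof.
move=> g0; have [c gc] := dir_bound g; have s0 := mean_sq_ge0 g.
apply: filterS3 (nmart_le_ae g0 gc) (sqsum_lln_ae d0 XP g) (wsum_sq_upper_ae d0 XP g0).
move=> w Nw Sw Uw e e0; set s := var g; have {}s0 : 0 <= s := s0.
pose e1 := Num.min 1 (e / 2).
have e10 : 0 < e1 by rewrite lt_min ltr01 divr_gt0.
have e11 : e1 <= 1 by rewrite ge_min lexx.
have e1e : e1 <= e / 2 by rewrite ge_min lexx orbT.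
pose kap := Num.min (1 / 2) (e / (4 * (s + 1))).
have s1 : 0 < 4 * (s + 1) by lra.
have kap0 : 0 < kap by rewrite lt_min !divr_gt0.
have kap2 : kap <= 1 / 2 by rewrite ge_min lexx.
have kape : kap * (4 * (s + 1)) <= e by rewrite -ler_pdivlMr // ge_min lexx orbT.
pose m := Num.bound (16 * c ^+ 2 / kap).
have mk : 16 * c ^+ 2 / m.+1%:R <= kap.
  rewrite ler_pdivrMr // [kap * _]mulrC -ler_pdivrMr //.
  apply: le_trans (ltW (archi_boundP _)) _; last by rewrite ler_nat.
  by rewrite divr_ge0 ?(ltW kap0) // mulr_ge0 // sqr_ge0.
have [C CP] := Nw m.
have es0 : 0 < e1 / (6 * (s + 1)) by rewrite divr_gt0 //; lra.
have [x0 x01 lnx] := ln_le_lin es0.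
near=> n.
have n1 : (1 <= n)%N by near: n; exact: nbhs_infty_ge.
have n0 : (0 : R) < n%:R by rewrite ltr0n.
have Hn : 1 <= H n by near: n; exact: near_harm.
have Ln0 : 1 + 6 * C / e1 <= L n by near: n; exact: near_llog.
have Ln1 : 1 <= L n by near: n; exact: near_llog.
have lH : x0 <= ln (H n) by near: n; exact: near_lnH.
have lHL : ln (H n) <= L n by rewrite -(prednK n1) llog_ge.
have S1 : `|sqsum g (hX w n) - s * L n| <= e1 / 3 * L n.
  by near: n; apply: Sw; lra.
(* The boundary term of the quadratic identity is of order [ln (ln (H n))] by the iterated logarithm
   bound, hence negligible against [L n], which is at least [ln (H n)]. *)
have U1 : wsum g (hX w n) ^+ 2 / (k (hX w n) * H (size (hX w n))) <= e1 / 3 * L n.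
  rewrite size_hist ler_pdivrMr ?mulr_gt0 //; last by lra.
  have : wsum g (hX w n) ^+ 2 <= (s + 1) * lilscale R n by near: n; apply: Uw; rewrite ltrDl.
  move=> /le_trans; apply; rewrite /lilscale.
  have -> : (s + 1) * (2 * n%:R * H n * ln (ln (H n))) = (2 * (s + 1) * ln (ln (H n))) * (n%:R * H n) by ring.
  rewrite ler_wpM2r ?mulr_ge0 //; first by lra.
  have s10 : 0 < 6 * (s + 1) by lra.
  have := lnx _ lH; rewrite mulrAC ler_pdivlMr // => lnH.
  have elH : e1 * ln (H n) <= e1 * L n by rewrite ler_wpM2l // ltW.
  by lra.
have U0 : 0 <= wsum g (hX w n) ^+ 2 / (k (hX w n) * H (size (hX w n))).
  by rewrite divr_ge0 ?sqr_ge0 // mulr_ge0 // harm_ge0.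
have := CP n; have := quadratic_identity g (hX w n).
have Q0 : 0 <= qvar g (hX w n).
  apply: acc_ge0 => h _; rewrite divr_ge0 ?sqr_ge0 // !mulr_ge0 ?harm_ge0 //.
move: U1 U0 S1 Q0; move: (_ / _) (sqsum _ _) (nmart _ _) (qvar _ _) => u sq nm q U1 U0 S1 Q0 uE NB.
have NB' : 2 * `|nm| <= kap * q + 2 * C.
  have : 16 * c ^+ 2 / m.+1%:R * q <= kap * q by rewrite ler_wpM2r.
  rewrite (_ : 16 * c ^+ 2 / _ * q = 2 * (8 * c ^+ 2 / m.+1%:R * q)); last by ring.
  by move: NB; move: (8 * c ^+ 2 / _ * q) => z; lra.
have C3 : 2 * C <= e1 / 3 * L n.
  have : 6 * C / e1 <= L n by lra.
  by rewrite ler_pdivrMr // => LC; lra.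
exact: (quadratic_perturbation uE Q0 s0 Ln1 U0 U1 S1 NB' C3 e11 e1e (ltW kap0) kap2 kape).
Unshelve. all: by end_near. Qed.

End QSL2.

(** * Quadratic law for projections of the center of mass *)

Section CenterQSL.
Variables (R : realType) (dT : measure_display) (T : measurableType dT).
Variables (P : probability T R) (d : nat) (X : nat -> T -> dir d).
Hypothesis d0 : (1 <= d)%N.
Hypothesis XP : is_ERW P ((2 * d%:R + 1) / (4 * d%:R)) X.
Notation H := (harm R).
Notation path := (seq (dir d)).
Notation k h := ((size h)%:R : R).
Notation hX w n := (hist (X^~ w) n).
Implicit Types g : dir d -> R.
Notation var g := (mean (fun y => g y ^+ 2)).
Notation L := (llog R).

(** Young's inequality with weight [de] separates the walk from the remainder. The factors [1 + de]
    come from Young, from [r] and, squared, from [1 + 1/(2 i)]; their product is at most [1 + 15 de]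
    because [4 + 6 + 4 + 1 = 15] and [de <= 1]. *)
Lemma possum_term_bounds (i W r de S Rm l t : R) : 0 < de <= 1 -> 0 < i -> 0 <= W ->
  (2 * i)^-1 <= de -> 1 <= r <= 1 + de -> r * W = (i * l) ^- 2 ->
  t = (2 / 3 * ((i + 1 / 2) * S - Rm) / i) ^+ 2 / (i * l) ^+ 2 ->
  4 / 9 * ((1 - de) * (S ^+ 2 * W) - de^-1 * ((Rm / i) ^+ 2 * W)) <= t <=
  4 / 9 * ((1 + 15 * de) * (S ^+ 2 * W) + 2 * (1 + de^-1) * ((Rm / i) ^+ 2 * W)).
Proof.
move=> /andP[de0 de1] i0 W0 ide /andP[r1 r2] rW tE.
have -> : t = 4 / 9 * (r * (((1 + (2 * i)^-1) * S - Rm / i) ^+ 2 * W)).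
  rewrite [r * _]mulrCA rW tE; set u := (i * l) ^- 2.
  by field; rewrite gt_eqF.
have i20 : 0 <= (2 * i)^-1 by rewrite invr_ge0 mulr_ge0 // ltW.
move: (Rm / i) (2 * i)^-1 i20 ide => y a a0 ade {tE t}.
have S20 := sqr_ge0 S; have y20 := sqr_ge0 y.
set x := (1 + a) * S.
have x2l : S ^+ 2 <= x ^+ 2.
  rewrite exprMn ler_peMl // expr2; nra.
have x2u : x ^+ 2 <= (1 + de) ^+ 2 * S ^+ 2.
  by rewrite exprMn ler_wpM2r // lerXn2r ?nnegrE; lra.
have dei : 0 < de^-1 by rewrite invr_gt0.
have dede : de * de^-1 = 1 by rewrite divff // gt_eqF.
have up : (x - y) ^+ 2 <= (1 + de) * x ^+ 2 + (1 + de^-1) * y ^+ 2.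
  rewrite -subr_ge0.
  have -> : (1 + de) * x ^+ 2 + (1 + de^-1) * y ^+ 2 - (x - y) ^+ 2 = de^-1 * (de * x + y) ^+ 2.
    by field; rewrite gt_eqF.
  by rewrite mulr_ge0 ?sqr_ge0 // ltW.
have lo : (1 - de) * S ^+ 2 - de^-1 * y ^+ 2 <= (x - y) ^+ 2.
  apply: (@le_trans _ _ ((1 - de) * x ^+ 2 - de^-1 * y ^+ 2)).
    by rewrite lerD2r ler_wpM2l //; lra.
  rewrite -subr_ge0.
  have -> : (x - y) ^+ 2 - ((1 - de) * x ^+ 2 - de^-1 * y ^+ 2) = de^-1 * (de * x - y) ^+ 2 + y ^+ 2.
    by field; rewrite gt_eqF.
  by rewrite addr_ge0 // mulr_ge0 ?sqr_ge0 // ltW.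
have z0 : 0 <= (x - y) ^+ 2 * W by rewrite mulr_ge0 ?sqr_ge0.
apply/andP; split; apply: ler_wpM2l => //.
  apply: (@le_trans _ _ ((x - y) ^+ 2 * W)); last by rewrite ler_peMl.
  rewrite [leLHS](_ : _ = ((1 - de) * S ^+ 2 - de^-1 * y ^+ 2) * W); last by ring.
  exact: ler_wpM2r.
apply: (@le_trans _ _ ((1 + de) * ((x - y) ^+ 2 * W))); first by rewrite ler_wpM2r.
rewrite [leRHS](_ : _ = ((1 + 15 * de) * S ^+ 2 + 2 * (1 + de^-1) * y ^+ 2) * W); last by ring.
rewrite mulrA; apply: ler_wpM2r => //.
apply: (@le_trans _ _ ((1 + de) * ((1 + de) * ((1 + de) ^+ 2 * S ^+ 2) + (1 + de^-1) * y ^+ 2))).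
  rewrite ler_wpM2l ?addr_ge0 ?(ltW de0) //; apply: le_trans up _; rewrite lerD2r.
  by rewrite ler_wpM2l ?addr_ge0 ?(ltW de0).
rewrite mulrDr; apply: lerD.
  have -> : (1 + de) * ((1 + de) * ((1 + de) ^+ 2 * S ^+ 2)) = (1 + de) ^+ 4 * S ^+ 2 by ring.
  rewrite ler_wpM2r //.
  have -> : (1 + de) ^+ 4 = 1 + 4 * de + 6 * de ^+ 2 + 4 * de ^+ 3 + de ^+ 4 by ring.
  have : de ^+ 2 <= de by rewrite expr2; nra.
  have : de ^+ 3 <= de by rewrite -[leRHS]mulr1 exprS ler_wpM2l ?(ltW de0) // exprn_ile1 // ltW.
  have : de ^+ 4 <= de by rewrite -[leRHS]mulr1 exprS ler_wpM2l ?(ltW de0) // exprn_ile1 // ltW.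
  by lra.
rewrite mulrA ler_wpM2r // ler_wpM2r //; lra.
Qed.

Lemma possum_qsl_ae g : mean g = 0 -> {ae P, forall w,
  (fun n => (ln (ln n%:R))^-1 * \sum_(2 <= i < n.+1)
     ((possum g (hX w i) / i%:R) ^+ 2 / (i%:R * ln i%:R) ^+ 2)) @ \oo --> (4 / 9 * var g : R)}.
Proof.
move=> g0; have s0 := mean_sq_ge0 g.
apply: filterS2 (qvar_qsl_ae d0 XP g0) (remn_sum_ae d0 XP g0) => w Qw [Lam LamP].
move: s0 Qw; set s := var g => s0 Qw.
apply/cvgrPdist_le => e e0.
(* Errors proportional to [de * l] fit into [c1 * de * l], chiefly [15 * de * q] with
   [q <= (s + 1) * L]; all bounded terms go into [Cst] below. *)
pose c1 := 30 * (s + 1) + 2; have c10 : 0 < c1 by rewrite /c1; lra.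
pose de := Num.min 1 (e / (2 * c1)).
have de0 : 0 < de by rewrite lt_min ltr01 divr_gt0 // mulr_gt0.
have de1 : de <= 1 by rewrite ge_min lexx.
have dee : de * (2 * c1) <= e by rewrite -ler_pdivlMr ?mulr_gt0 // ge_min lexx orbT.
pose W (i : nat) : R := (i%:R * (i%:R + 1) * H i * H i.+1)^-1.
pose t (i : nat) : R := (possum g (hX w i) / i%:R) ^+ 2 / (i%:R * ln i%:R) ^+ 2.
pose qq i := wsum g (hX w i) ^+ 2 * W i.
pose rr i := (remn g (hX w i) / i%:R) ^+ 2 * W i.
have bnd : \forall i \near \oo,
    4 / 9 * ((1 - de) * qq i - de^-1 * rr i) <= t i <=
    4 / 9 * ((1 + 15 * de) * qq i + 2 * (1 + de^-1) * rr i).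
  near=> i.
  have i1 : (1 <= i)%N by near: i; exact: nbhs_infty_ge.
  have i0 : (0 : R) < i%:R by rewrite ltr0n.
  have l1 : 1 <= ln i%:R :> R by near: i; exact: near_ln.
  have Hi : 0 < H i by rewrite -(prednK i1) harm_gt0.
  have HS := harm_gt0 R i.
  have idl : (2 * i%:R)^-1 <= de.
    have di : de^-1 <= i%:R by near: i; exact: near_natr.
    rewrite -[leRHS]invrK lef_pV2 ?posrE ?invr_gt0 ?mulr_gt0 //.
    by apply: le_trans di _; rewrite ler_peMl // ?ler1n // ltW.
  have sc : 1 <= (i%:R + 1) * H i * H i.+1 / (i%:R * ln i%:R ^+ 2) <= 1 + de.
    by near: i; exact: near_scale.
  have := @possum_term_bounds i%:R (W i) _ de (wsum g (hX w i)) (remn g (hX w i)) (ln i%:R) (t i) _ i0 _ idl sc.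
  rewrite de0 de1 => /(_ isT); apply; last by rewrite /t possumE // size_hist.
    by rewrite invr_ge0 !mulr_ge0 ?ltW // addr_gt0.
  have l0 : 0 < ln i%:R :> R by apply: lt_le_trans l1.
  have i10 : 0 < i%:R + 1 :> R by rewrite addr_gt0.
  rewrite /W; move: (i%:R : R) (ln _) i0 l0 i10 (H i) (H i.+1) Hi HS => x l x0 l0 x1 a b a0 b0.
  by field; rewrite !gt_eqF.
have bup : \forall i \near \oo, t i <= 4 / 9 * ((1 + 15 * de) * qq i + 2 * (1 + de^-1) * rr i).
  by apply: filterS bnd => i /andP[].
have blo : \forall i \near \oo, 4 / 9 * ((1 - de) * qq i - de^-1 * rr i) <= t i.
  by apply: filterS bnd => i /andP[].
have [C1 C1P] := sum_le_near bup; have [C2 C2P] := sum_le_near blo.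
have QE n : \sum_(0 <= i < n) qq i = qvar g (hX w n).
  rewrite /qvar acc_hist; apply: eq_bigr => i _.
  by rewrite size_hist.
have RE n : \sum_(0 <= i < n) rr i <= Lam.
  apply: le_trans (LamP n); rewrite acc_hist; apply: ler_sum => i _.
  rewrite size_hist (_ : rr i = remn g (hX w i) ^+ 2 / (i%:R ^+ 3 * (i%:R + 1) * H i * H i.+1)) //.
  by rewrite /rr /W exprMn exprVn -[LHS]mulrA -invfM; congr (_ / _); ring.
have R0 n : 0 <= \sum_(0 <= i < n) rr i.
  apply: sumr_ge0 => i _; rewrite mulr_ge0 ?sqr_ge0 // invr_ge0 !mulr_ge0 ?harm_ge0 //.
pose Cst := `|C1| + `|C2| + 4 / 9 * (2 * (1 + de^-1) * Lam) + de^-1 * Lam + 2 * s + 4 * c1.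
have Qn' : \forall n \near \oo, `|qvar g (hX w n.+1) - s * L n.+1| <= de * L n.+1.
  by have [N _ NP] := Qw de de0; exists N => // n /= Nn; exact: (NP n.+1 (leqW Nn)).
near=> n.
set l : R := ln (ln n%:R).
have lB : 1 + 2 * Cst / e <= l by rewrite /l; near: n; exact: (near_ln_comp (@near_ln R)).
have l2 : 2 <= l by rewrite /l; near: n; exact: (near_ln_comp (@near_ln R)).
have /andP[Ll Lu] : l <= L n.+1 <= l + 2 by rewrite /l; near: n; exact: near_llog_lnln.
have TE : \sum_(2 <= i < n.+1) ((possum g (hX w i) / i%:R) ^+ 2 / (i%:R * ln i%:R) ^+ 2) =
    \sum_(0 <= i < n.+1) t i.
  have n1 : (1 <= n)%N by near: n; exact: nbhs_infty_ge.
  (* The terms of index 0 and 1 vanish: their denominators are 0, and [x / 0 = 0]. *)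
  rewrite [RHS](big_cat_nat (n := 2)) //= [X in _ = X + _](_ : _ = 0) ?add0r //.
  rewrite big_nat_recr // big_nat1 /t ln1 mul0r mulr0 expr0n invr0.
  by rewrite /= mulr0 mul0r addr0.
rewrite TE.
have := C1P n.+1; have := C2P n.+1.
rewrite -!mulr_sumr sumrB big_split /= -!mulr_sumr QE => lo up.
have Qn : `|qvar g (hX w n.+1) - s * L n.+1| <= de * L n.+1.
  by near: n; exact: Qn'.
set Tn := \sum_(0 <= i < n.+1) t i in lo up *.
move: lo up (RE n.+1) (R0 n.+1) Qn; set rs := \sum_(0 <= i < n.+1) rr i.
set q := qvar _ _ => lo up rsL rs0 Qn.
have dei : 0 < de^-1 by rewrite invr_gt0.
have l0 : 0 < l by apply: lt_le_trans l2.
suff K : `|4 / 9 * s * l - Tn| <= e * l.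
  have -> : 4 / 9 * s - l^-1 * Tn = l^-1 * (4 / 9 * s * l - Tn).
    by field; rewrite gt_eqF.
  by rewrite normrM gtr0_norm ?invr_gt0 // mulrC ler_pdivrMr.
have q0 : 0 <= q.
  by rewrite /q /qvar; apply: acc_ge0 => h _; rewrite divr_ge0 ?sqr_ge0 // !mulr_ge0 ?harm_ge0.
have L0 : 0 <= L n.+1 by apply: le_trans Ll; exact: ltW.
have sp0 : 0 <= s + 1 by rewrite addr_ge0.
have qu : q <= (s + 1) * L n.+1.
  have Q1 := ler_norm (q - s * L n.+1).
  have Q2 : de * L n.+1 <= L n.+1 by rewrite ler_piMl // ltW.
  by lra.
have dq : de * q <= de * ((s + 1) * L n.+1) by rewrite ler_wpM2l // ltW.
have dei2 : de^-1 * rs <= de^-1 * Lam by rewrite ler_wpM2l // ltW.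
have dei3 : 2 * (1 + de^-1) * rs <= 2 * (1 + de^-1) * Lam.
  by rewrite ler_wpM2l // mulr_ge0 // addr_ge0 // ltW.
have [ls1 ls2] : s * l <= s * L n.+1 /\ s * L n.+1 <= s * l + 2 * s.
  split; first by rewrite ler_wpM2l.
  by rewrite [2 * s]mulrC -mulrDr ler_wpM2l.
have dL : de * L n.+1 <= de * (l + 2) by rewrite ler_wpM2l // ltW.
have dsL : de * ((s + 1) * L n.+1) <= de * ((s + 1) * (l + 2)).
  by rewrite ler_wpM2l ?(ltW de0) // ler_wpM2l.
have Cl : Cst <= e / 2 * l.
  have : 2 * Cst / e <= l by lra.
  by rewrite ler_pdivrMr // => Cl; lra.
have main : `|4 / 9 * s * l - Tn| <= Cst + c1 * de * l.
  have n1 := ler_norm C1; have n2 := ler_norm C2.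
  have n10 := normr_ge0 C1; have n20 := normr_ge0 C2.
  have dc : de * c1 <= c1 by rewrite ler_piMl // ltW.
  move: Qn; rewrite ler_norml => /andP[Qn1 Qn2].
  have X1 : de * ((s + 1) * (l + 2)) = de * (s + 1) * l + 2 * (de * (s + 1)) by ring.
  have X2 : de * (l + 2) = de * l + 2 * de by ring.
  have X3 : c1 * de * l = 30 * (de * (s + 1) * l) + 2 * (de * l) by rewrite /c1; ring.
  have X4 : de * c1 = 30 * (de * (s + 1)) + 2 * de by rewrite /c1; ring.
  have X5 : (1 + 15 * de) * q = q + 15 * (de * q) by ring.
  have X6 : (1 - de) * q = q - de * q by ring.
  have X7 : 0 <= de * (s + 1) * l by rewrite !mulr_ge0 // ltW.
  have X8 : 0 <= de * (s + 1) by rewrite mulr_ge0 // ltW.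
  have X9 : 0 <= de * l by rewrite !mulr_ge0 // ltW.
  have X10 : 0 <= de^-1 * rs by rewrite mulr_ge0 // ltW.
  rewrite X5 in up; rewrite X6 in lo; rewrite X1 in dsL; rewrite X2 in dL; rewrite X4 in dc.
  rewrite ler_norml X3 /Cst; apply/andP; split.
    by lra.
  by lra.
apply: le_trans main _.
have E1 : c1 * de * l <= e / 2 * l.
  rewrite ler_wpM2r ?(ltW l0) //.
  by move: dee; rewrite mulrCA [de * _]mulrC => E2; lra.
by lra.
Unshelve. all: by end_near. Qed.

End CenterQSL.

(** * Lower bound in the law of the iterated logarithm *)

Section Tilt.
Variables (R : realType) (d : nat).
Hypothesis d0 : (1 <= d)%N.
Notation q := (@erwq R d).
Notation K := (kstep q).
Notation H := (harm R).
Notation path := (seq (dir d)).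
Notation k h := ((size h)%:R : R).

(** The step projected on [(1, ..., 1)]. Its values square to 1, so the conditional variance is the
    explicit function [vrc] of the drift and needs no law of large numbers. *)
Definition sgn (y : dir d) : R := if y.2 then 1 else -1.

Lemma sgn_sq y : sgn y ^+ 2 = 1.
Proof. by rewrite /sgn; case: ifP; rewrite ?sqrrN expr1n. Qed.

Lemma sgn_le y : `|sgn y| <= 1.
Proof. by rewrite /sgn; case: ifP; rewrite ?normrN normr1. Qed.

Lemma mean_sgn : mean sgn = 0.
Proof.
rewrite /mean -(pair_bigA _ (fun i b => if b then 1 else -1 : R)) /= big1 ?mulr0 // => i _.
by rewrite big_bool /= subrr.
Qed.

Notation S := (wsum sgn).
Definition drf (h : path) : R := S h / (2 * k h).
Definition vrc (h : path) : R := 1 - drf h ^+ 2.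

Lemma drf_le h : `|drf h| <= 1 / 2.
Proof. by have := drift_le d0 sgn_le h. Qed.

Lemma drf_sq_le h : drf h ^+ 2 <= 1 / 4.
Proof.
rewrite -real_normK ?num_real // (_ : 1 / 4 = (1 / 2) ^+ 2); last by field.
by rewrite lerXn2r ?nnegrE // drf_le.
Qed.

Lemma vrc_ge h : 3 / 4 <= vrc h. Proof. by have := drf_sq_le h; rewrite /vrc; lra. Qed.
Lemma vrc_gt0 h : 0 < vrc h. Proof. by have := vrc_ge h; lra. Qed.

Lemma sgn_epsE h y : eps sgn h y = sgn y - drf h. Proof. by []. Qed.

Lemma cexp_sgn_eps_sq h : cexp h (fun y => eps sgn h y ^+ 2) = vrc h.
Proof.
have mg := cexp_g d0 mean_sgn h.
rewrite (@eq_cexp _ _ _ _ (fun y => 1 + ((- 2 * drf h) * sgn y + drf h ^+ 2))).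
  by rewrite cexpD cexpD !cexp_cst // cexpZ mg -/(drf h) /vrc; ring.
by move=> y; rewrite sgn_epsE sqrrB sgn_sq; ring.
Qed.

Variable th : R.
Hypothesis th0 : 0 < th.
Hypothesis th1 : th <= 1 / 4.

Definition dlt (h : path) : R := th / Num.sqrt (k h + 1).
(** A linear tilt: [eps] is centered, so [1 + lik] integrates to 1 without a normalising constant.
    Division by the conditional variance makes the tilted mean of [eps] exactly [dlt], hence [mart]
    drifts by [th] times the clock. *)
Definition lik (h : path) (y : dir d) : R := dlt h / vrc h * eps sgn h y.
Definition tilt (h : path) (y : dir d) : R := q h y * (1 + lik h y).
Notation KQ := (kstep tilt).

Let k1 (h : path) : 0 < k h + 1. Proof. by rewrite ltr_pwDr. Qed.

Lemma dlt_ge0 h : 0 <= dlt h. Proof. by rewrite divr_ge0 ?sqrtr_ge0 // ltW. Qed.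
Lemma dlt_le h : dlt h <= th.
Proof.
rewrite ler_pdivrMr ?sqrtr_gt0 // ler_peMr ?(ltW th0) //.
by rewrite -[leLHS]sqrtr1 ler_wsqrtr // lerDr.
Qed.
Lemma dlt_sq h : dlt h ^+ 2 = th ^+ 2 / (k h + 1).
Proof. by rewrite exprMn exprVn sqr_sqrtr // ltW. Qed.

Lemma sgn_eps_le h y : `|eps sgn h y| <= 3 / 2.
Proof.
rewrite sgn_epsE; apply: le_trans (ler_normB _ _) _.
by have := sgn_le y; have := drf_le h; lra.
Qed.

Lemma lik_le h y : `|lik h y| <= 2 * th.
Proof.
have v0 := vrc_gt0 h.
rewrite normrM ger0_norm; last by rewrite divr_ge0 ?dlt_ge0 // ltW.
apply: (@le_trans _ _ (th / (3 / 4) * (3 / 2))); last by rewrite le_eqVlt; apply/orP; left; apply/eqP; field.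
apply: ler_pM => //; first by rewrite divr_ge0 ?dlt_ge0 // ltW.
  apply: ler_pM; rewrite ?dlt_ge0 ?invr_ge0 ?(ltW v0) ?dlt_le //.
  by rewrite lef_pV2 ?posrE ?vrc_ge // divr_gt0.
exact: sgn_eps_le.
Qed.

Lemma lik_gt0 h y : 0 < 1 + lik h y.
Proof. by have := th1; have := lik_le h y; rewrite ler_norml => /andP[? _]; lra. Qed.

Lemma cexp_lik h : cexp h (lik h) = 0.
Proof. by rewrite /lik cexpZ cexp_eps ?mulr0 // mean_sgn. Qed.

Lemma KQE F h : KQ F h = cexp h (fun y => (1 + lik h y) * F (y :: h)).
Proof. by apply: eq_bigr => y _; rewrite mulrA. Qed.

Lemma tilt_stochastic : stochastic tilt.
Proof.
split=> [h y|h].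
  by rewrite mulr_ge0 //; [case: (erwq_stochastic R d0)|rewrite ltW ?lik_gt0].
by rewrite -/(cexp h (fun y => 1 + lik h y)) cexpD cexp_cst // cexp_lik addr0.
Qed.

Lemma KQ_affine h a b : KQ (fun h' => a + b * (if h' is y :: _ then eps sgn h y else 0)) h
  = a + b * dlt h.
Proof.
rewrite KQE (@eq_cexp _ _ _ _ (fun y => a + ((a * (dlt h / vrc h) + b) * eps sgn h y
   + b * (dlt h / vrc h) * eps sgn h y ^+ 2))); last by move=> y; rewrite /lik; ring.
rewrite cexpD cexpD cexp_cst // !cexpZ cexp_eps ?mean_sgn // cexp_sgn_eps_sq.
by field; rewrite gt_eqF ?vrc_gt0.
Qed.

Lemma KQ_mart_sq h a : KQ (fun h' => (mart sgn h' - th * H (size h') - a) ^+ 2) h <=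
  (mart sgn h - th * H (size h) - a) ^+ 2 + 4 / (k h + 1).
Proof.
set u := mart sgn h - th * H (size h) - a; set r := Num.sqrt (k h + 1).
have r0 : 0 < r by rewrite sqrtr_gt0.
have rE : k h + 1 = r ^+ 2 by rewrite sqr_sqrtr // ltW.
have dE : dlt h = th / r by [].
have step y : mart sgn (y :: h) - th * H (size (y :: h)) - a = u + r^-1 * (eps sgn h y - dlt h).
  have -> : mart sgn (y :: h) = mart sgn h + r^-1 * eps sgn h y by [].
  rewrite [size (y :: h)]/= harmS -natr1 rE dE /u.
  by field; rewrite gt_eqF.
rewrite (@eq_kstep _ _ _ _ (fun h' => (u ^+ 2 - 2 * u * r^-1 * dlt h + (2 * u * r^-1) *
    (if h' is y :: _ then eps sgn h y else 0)) +
    (if h' is y :: _ then (r^-1 * (eps sgn h y - dlt h)) ^+ 2 else 0))); last first.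
  by move=> y; rewrite step; ring.
rewrite kstepD KQ_affine subrK lerD2l.
rewrite -(kstep_cst tilt_stochastic (4 / (k h + 1)) h); apply: (kstep_le tilt_stochastic) => y.
rewrite exprMn exprVn rE mulrC ler_wpM2r ?invr_ge0 ?sqr_ge0 //.
have t1 := th1; have := sgn_eps_le h y; have := dlt_ge0 h; have := dlt_le h.
rewrite ler_norml => ? ? /andP[? ?].
rewrite -real_normK ?num_real // (_ : 4 = 2 ^+ 2); last by ring.
by rewrite lerXn2r ?nnegrE // ler_norml; apply/andP; split; lra.
Qed.

Lemma iter_KQ_mart_sq n h a :
  iter n KQ (fun h' => (mart sgn h' - th * H (size h') - a) ^+ 2) h <=
  (mart sgn h - th * H (size h) - a) ^+ 2 + 4 * (H (n + size h) - H (size h)).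
Proof.
elim: n h => [|n IH] h; first by rewrite add0n subrr mulr0 addr0.
rewrite iterS.
apply: (@le_trans _ _ (KQ (fun h' => (mart sgn h' - th * H (size h') - a) ^+ 2 +
    4 * (H (n + size h') - H (size h'))) h)).
  by apply: (kstep_le tilt_stochastic) => y; exact: IH.
rewrite kstepD [X in _ + X](_ : _ = 4 * (H (n + (size h).+1) - H (size h).+1)); last first.
  by rewrite -[RHS](kstep_cst tilt_stochastic _ h); exact: eq_kstep.
apply: le_trans (lerD (KQ_mart_sq h a) (lexx _)) _.
rewrite addnS (harmS _ (size h)) natr1 addSn.
by move: (H _.+1) (H (size h)) (_ ^+ 2) ((size h).+1%:R^-1) => u v w z; lra.
Qed.

(** The entropy of a tilted step involves [1 / vrc], which is at most [1 + pot / 2]. After the first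
    step [pot] is a supermartingale even under the tilt, so its value at the start of a block
    controls the entropy of the whole block; the summand [2 / k] pays for the noise in
    [(S / k)^2]. *)
Definition pot (h : path) : R := (S h / k h) ^+ 2 + 2 / k h.

Lemma KQ_pot h : h != [::] -> KQ pot h <= pot h.
Proof.
move=> hn; have x0 : 0 < k h by rewrite ltr0n lt0n size_eq0.
have x1 : 0 < k h + 1 by [].
rewrite (@eq_kstep _ _ _ _ (fun h' => (k h + 1) ^- 2 * ((((S h + drf h) ^+ 2 + 2 * (S h + drf h) *
    (if h' is y :: _ then eps sgn h y else 0)) +
    (if h' is y :: _ then eps sgn h y ^+ 2 else 0)) + 2 * (k h + 1)))); last first.
  move=> y; rewrite /pot wsum_cons [size (y :: h)]/= -natr1 sgn_epsE.
  by field; rewrite gt_eqF.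
rewrite kstepZ kstepD kstepD KQ_affine (kstep_cst tilt_stochastic).
have E2 : KQ (fun h' => if h' is y :: _ then eps sgn h y ^+ 2 else 0) h <=
   1 - drf h ^+ 2 - 2 * drf h * dlt h.
  have -> : KQ (fun h' => if h' is y :: _ then eps sgn h y ^+ 2 else 0) h =
      KQ (fun h' => 1 - drf h ^+ 2 + (- 2 * drf h) * (if h' is y :: _ then eps sgn h y else 0)) h.
    apply: eq_kstep => y; rewrite sgn_epsE sqrrB sgn_sq; ring.
  by rewrite KQ_affine; lra.
rewrite ler_pdivrMl ?exprn_gt0 //.
apply: (@le_trans _ _ ((S h + drf h) ^+ 2 + 2 * (S h + drf h) * dlt h +
  (1 - drf h ^+ 2 - 2 * drf h * dlt h) + 2 * (k h + 1))); first by rewrite lerD2r lerD2l.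
have D2 : k h * dlt h ^+ 2 <= 1.
  rewrite dlt_sq mulrA ler_pdivrMr // mul1r.
  have t0 := th0; have t1 := th1; have : th ^+ 2 <= 1 by rewrite expr2; nra.
  by move=> ?; nra.
have SD : 2 * S h * dlt h <= S h ^+ 2 / k h + k h * dlt h ^+ 2.
  rewrite -subr_ge0.
  have -> : S h ^+ 2 / k h + k h * dlt h ^+ 2 - 2 * S h * dlt h = (S h - k h * dlt h) ^+ 2 / k h.
    by field; rewrite gt_eqF.
  by rewrite divr_ge0 ?sqr_ge0 // ltW.
have DR : 2 * S h * drf h = S h ^+ 2 / k h by rewrite /drf; field; rewrite gt_eqF.
have PE : (k h + 1) ^+ 2 * pot h = S h ^+ 2 + 2 * (S h ^+ 2 / k h) + (S h / k h) ^+ 2 + 2 * k h + 4 + 2 / k h.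
  by rewrite /pot; field; rewrite gt_eqF.
have P1 := sqr_ge0 (S h / k h); have P2 : 0 <= 2 / k h by rewrite divr_ge0 // ltW.
rewrite PE.
have -> : (S h + drf h) ^+ 2 + 2 * (S h + drf h) * dlt h +
  (1 - drf h ^+ 2 - 2 * drf h * dlt h) + 2 * (k h + 1) =
  S h ^+ 2 + 2 * S h * drf h + 2 * S h * dlt h + 1 + 2 * (k h + 1) by ring.
rewrite DR; lra.
Qed.

(** Relative entropy of the tilted next step with respect to the true one. *)
Definition klh (h : path) : R := cexp h (fun y => (1 + lik h y) * ln (1 + lik h y)).

Lemma klh_le h eta : 0 < eta <= 1 -> 2 * th <= eta / 2 ->
  klh h <= (1 + eta) / 2 * th ^+ 2 * (1 + pot h / 2) / (k h + 1).
Proof.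
move=> e01 te; have /andP[e0 e1] := e01.
apply: (@le_trans _ _ (cexp h (fun y => lik h y + (1 + eta) / 2 * lik h y ^+ 2))).
  apply: cexp_le => // y; apply: ln_entropy_2nd => //.
  exact: le_trans (lik_le h y) te.
rewrite cexpD cexp_lik add0r cexpZ.
have -> : cexp h (fun y => lik h y ^+ 2) = dlt h ^+ 2 / vrc h.
  under eq_cexp do rewrite exprMn.
  by rewrite cexpZ cexp_sgn_eps_sq; field; rewrite gt_eqF ?vrc_gt0.
rewrite dlt_sq [leLHS](_ : _ = ((1 + eta) / 2 * th ^+ 2) * ((vrc h)^-1 / (k h + 1))); last by ring.
rewrite [leRHS](_ : _ = ((1 + eta) / 2 * th ^+ 2) * ((1 + pot h / 2) / (k h + 1))); last by ring.
apply: ler_wpM2l; first by rewrite mulr_ge0 ?sqr_ge0 // divr_ge0 // addr_ge0 // ltW.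
apply: ler_wpM2r; first by rewrite invr_ge0 ltW.
have D : 2 * drf h ^+ 2 <= pot h / 2.
  have -> : drf h ^+ 2 = (S h / k h) ^+ 2 / 4.
    by rewrite /drf invfM (mulrC 2^-1) mulrA; move: (S h / k h) => z; field.
  have kp : 0 <= 2 / k h by rewrite divr_ge0.
  by rewrite /pot; lra.
apply: (@le_trans _ _ (1 + 2 * drf h ^+ 2)); last by rewrite lerD2l.
rewrite -[leLHS]mul1r ler_pdivrMr ?vrc_gt0 // /vrc.
have := drf_sq_le h; have := sqr_ge0 (drf h); move: (drf h ^+ 2) => z z0 z4; nra.
Qed.

Lemma iter_kstep_gt0 n F h : (forall h', 0 < F h') -> 0 < iter n K F h.
Proof.
move=> F0; have qs := erwq_stochastic R d0; elim: n h => [//|n IH] h.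
have [y qy] : exists y, 0 < q h y.
  apply: contrapT => /forallNP qn.
  have : \sum_y q h y <= 0 by apply: sumr_le0 => y _; rewrite leNgt; exact/negP/qn.
  by case: qs => _ ->; rewrite ler10.
rewrite iterS /kstep (bigD1 y) //= ltr_pwDl ?mulr_gt0 //.
by apply: sumr_ge0 => z _; rewrite mulr_ge0 ?(ltW (IH _)) //; case: qs.
Qed.

(** The Gibbs variational inequality for one step: apply [ln x <= x - 1] to [F / (c * (1 + lik))]
    and average under the tilted law. *)
Lemma ln_kstep F h : (forall h', 0 < F h') -> KQ (fun h' => ln (F h')) h - klh h <= ln (K F h).
Proof.
move=> F0; have qs := erwq_stochastic R d0.
have c0 : 0 < K F h := iter_kstep_gt0 1 h F0.
set c := K F h in c0 *.
rewrite KQE /klh -[X in X - _ <= _]addr0 lerBlDr.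
have -> : ln c = cexp h (fun y => (1 + lik h y) * ln c).
  under eq_cexp do rewrite mulrC.
  by rewrite cexpZ cexpD cexp_cst // cexp_lik addr0 mulr1.
rewrite -cexpD addr0 -subr_le0 -mulN1r -cexpZ -cexpD.
apply: (@le_trans _ _ (cexp h (fun y => c^-1 * F (y :: h) + (- 1 - lik h y)))).
  apply: cexp_le => // y; have l0 := lik_gt0 h y.
  have L : ln (F (y :: h) / (c * (1 + lik h y))) <= F (y :: h) / (c * (1 + lik h y)) - 1.
    have {1}-> : F (y :: h) / (c * (1 + lik h y)) = 1 + (F (y :: h) / (c * (1 + lik h y)) - 1).
      by rewrite addrCA subrr addr0.
    by apply: le_ln1Dx; rewrite ltrBrDl subrr divr_gt0 ?mulr_gt0.
  rewrite ln_div ?posrE ?mulr_gt0 // lnM ?posrE // in L.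
  have := ler_wpM2l (ltW l0) L.
  rewrite [X in _ <= X](_ : _ = c^-1 * F (y :: h) - 1 - lik h y); last by field; rewrite !gt_eqF.
  by lra.
rewrite cexpD cexpZ -kstepE -/c mulVf ?gt_eqF //.
under eq_cexp do rewrite -opprD -mulN1r.
by rewrite cexpZ cexpD cexp_cst // cexp_lik addr0 mulr1 subrr.
Qed.

(** Chain rule for entropy along [n] steps, the future entropies being bounded through [KQ_pot]. *)
Lemma ln_iter_kstep n F h eta : 0 < eta <= 1 -> 2 * th <= eta / 2 ->
  (forall h', 0 < F h') -> h != [::] ->
  iter n KQ (fun h' => ln (F h')) h -
    (1 + eta) / 2 * th ^+ 2 * (1 + pot h / 2) * (H (n + size h) - H (size h)) <=
  ln (iter n K F h).
Proof.
move=> e01 te F0; set A := (1 + eta) / 2 * th ^+ 2.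
have A0 : 0 <= A.
  by case/andP: e01 => e0 _; rewrite mulr_ge0 ?sqr_ge0 // divr_ge0 // addr_ge0 // ltW.
elim: n h => [|n IH] h hn; first by rewrite add0n subrr mulr0 subr0.
rewrite [iter n.+1 K _]iterS.
apply: le_trans (ln_kstep h (fun h' => iter_kstep_gt0 n h' F0)).
have D0 : 0 <= H (n + (size h).+1) - H (size h).+1.
  rewrite subr_ge0; elim: (n) => [//|p IHp]; rewrite addSn [leRHS]harmS; apply: le_trans IHp _.
  by rewrite lerDl.
have step : KQ (fun h' => iter n KQ (fun h' => ln (F h')) h') h -
    A * (1 + pot h / 2) * (H (n + (size h).+1) - H (size h).+1) <=
    KQ (fun h' => ln (iter n K F h')) h.
  apply: (@le_trans _ _ (KQ (fun h' => iter n KQ (fun h' => ln (F h')) h' +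
     ((- (A * (H (n + (size h).+1) - H (size h).+1))) +
       (- (A * (H (n + (size h).+1) - H (size h).+1) / 2)) * pot h')) h)).
    rewrite kstepD kstepD kstepZ (kstep_cst tilt_stochastic).
    have := KQ_pot hn; move: (KQ pot h) => z zp.
    have AD : 0 <= A * (H (n + (size h).+1) - H (size h).+1) by rewrite mulr_ge0.
    move: AD; set B := A * _ => AD; rewrite [A * _ * _]mulrAC -/B.
    have : B * z <= B * pot h by rewrite ler_wpM2l.
    by lra.
  apply: (kstep_le tilt_stochastic) => y.
  by have := IH (y :: h) isT; rewrite [size (y :: h)]/=; lra.
apply: le_trans (lerB step (klh_le h e01 te)).
rewrite iterS -/A addSn -addnS (harmS _ (size h)) natr1.
move: (KQ _ _) (H (n + _)) (H (size h)) ((size h).+1%:R^-1) (A * (1 + _)) => z u v i B.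
by rewrite le_eqVlt; apply/orP; left; apply/eqP; ring.
Qed.

(** The entropy inequality is applied to the function equal to [e0] on failure and 1 on success; a
    positive [e0] keeps its logarithm finite. Under the tilt, failure is a deviation of
    [eta * th * D] from the mean, which Chebyshev bounds by [4 / (eta^2 th^2 D)]. *)
Lemma block_fail_le n (h : path) (eta e0 D : R) : 0 < eta <= 1 -> 2 * th <= eta / 2 -> 0 < e0 <= 1 ->
  h != [::] -> D = H (n + size h) - H (size h) -> 0 < D ->
  iter n K (fun h' => (mart sgn h' - mart sgn h < (1 - eta) * (th * D))%R%:R) h <=
  1 + e0 - expR (ln e0 * (4 / (eta ^+ 2 * (th ^+ 2 * D))) -
    (1 + eta) / 2 * (th ^+ 2 * D) * (1 + pot h / 2)).
Proof.
move=> e01 te /andP[e00 e011] hn DE D0; have /andP[et0 et1] := e01.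
have qs := erwq_stochastic R d0.
pose fail (h' : path) : bool := mart sgn h' - mart sgn h < (1 - eta) * (th * D).
pose F h' : R := if fail h' then e0 else 1.
have F0 h' : 0 < F h' by rewrite /F; case: ifP.
have KF : iter n K F h <= 1 + e0 - iter n K (fun h' => (fail h')%:R) h.
  rewrite lerBrDr -iter_kstepD -[leRHS](iter_kstep_cst qs n (1 + e0) h).
  apply: iter_kstep_le => // s _; rewrite /F; case: ifP => _ /=; lra.
have Qf : iter n KQ (fun h' => (fail h')%:R) h <= 4 / (eta ^+ 2 * (th ^+ 2 * D)).
  have eD : 0 < (eta * (th * D)) ^+ 2 by rewrite exprn_gt0 // !mulr_gt0.
  apply: (@le_trans _ _ (iter n KQ (fun h' => (eta * (th * D)) ^- 2 *
      (mart sgn h' - th * H (size h') - (mart sgn h - th * H (size h))) ^+ 2) h)).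
    apply: (iter_kstep_le tilt_stochastic) => s sn.
    case f : (fail (s ++ h)); last by rewrite mulr_ge0 ?sqr_ge0 // invr_ge0 ltW.
    move: f; rewrite /fail size_cat sn => f; rewrite ler_pdivlMl // mulr1.
    have -> : mart sgn (s ++ h) - th * H (n + size h) - (mart sgn h - th * H (size h)) =
      - (- (mart sgn (s ++ h) - mart sgn h) + th * D) by rewrite DE; ring.
    rewrite sqrrN lerXn2r ?nnegrE ?mulr_ge0 ?(ltW et0) ?(ltW th0) ?(ltW D0) //; last first.
      by move: f; rewrite mulrBl; lra.
    have : 0 <= eta * (th * D) by rewrite !mulr_ge0 ?ltW.
    by move: f; rewrite mulrBl; lra.
  rewrite iter_kstepZ ler_pdivrMl //; apply: le_trans (iter_KQ_mart_sq _ _ _) _.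
  rewrite subrr expr0n add0r -DE le_eqVlt; apply/orP; left; apply/eqP.
  by field; rewrite !gt_eqF.
have LF : iter n KQ (fun h' => ln (F h')) h = ln e0 * iter n KQ (fun h' => (fail h')%:R) h.
  rewrite -iter_kstepZ; apply: (eq_iter_kstep tilt_stochastic) => s _.
  by rewrite /F; case: ifP => _; rewrite ?mulr1 ?mulr0 ?ln1.
have := ln_iter_kstep n e01 te F0 hn; rewrite LF -DE => E.
have le0 : ln e0 <= 0 by exact: ln_le0.
have E2 : ln e0 * (4 / (eta ^+ 2 * (th ^+ 2 * D))) -
    (1 + eta) / 2 * (th ^+ 2 * D) * (1 + pot h / 2) <= ln (iter n K F h).
  apply: le_trans E; rewrite [X in _ - X](_ : _ = (1 + eta) / 2 * th ^+ 2 * (1 + pot h / 2) * D); last by ring.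
  by rewrite lerD2r ler_wnM2l.
rewrite lerBrDr -lerBrDl; apply: le_trans KF.
by rewrite -[leRHS]lnK ?posrE ?iter_kstep_gt0 // ler_expR.
Qed.

End Tilt.

(** * Superexponential blocks and their clocks *)

Section Blocks.
Variable R : realType.
Notation H := (harm R).

(* Superexponential clock blocks: the clock [H (blk j)] is about [j!], so
   consecutive blocks are nearly independent while [ln ln H (blk j)] is still
   asymptotic to [ln j]. *)
Definition blk (j : nat) : nat := 2 ^ (j`!).

Lemma blk_homo : {homo blk : j i / (j <= i)%N}.
Proof. by move=> j i ji; rewrite leq_pexp2l // leq_fact. Qed.

Lemma leq_blk j : (j <= blk j)%N.
Proof. by apply: leq_trans (fact_geq j) (ltnW _); exact: ltn_expl. Qed.

Lemma blk_gt0 j : (0 < blk j)%N. Proof. by rewrite expn_gt0. Qed.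

Lemma near_blk (Q : nat -> Prop) : (\forall n \near \oo, Q n) -> \forall j \near \oo, Q (blk j).
Proof.
move=> [N _ NP]; exists N => // j /= Nj; apply: NP => /=.
exact: leq_trans Nj (leq_blk j).
Qed.

Lemma near_S (Q : nat -> Prop) : (\forall n \near \oo, Q n) -> \forall j \near \oo, Q j.+1.
Proof. by move=> [N _ NP]; exists N => // j /= Nj; apply: NP => /=; exact: leqW. Qed.

Lemma harm_blk j : (j`!)%:R / 2 <= H (blk j) <= 1 + (j`!)%:R.
Proof.
have [l1 l2] := ln2_itv R.
have lE : ln (blk j)%:R = (j`!)%:R * ln 2 :> R by rewrite /blk natrX lnXn // mulr_natl.
have b0 : (0 : R) < (blk j)%:R by rewrite ltr0n blk_gt0.
have f0 : (0 : R) <= (j`!)%:R by [].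
apply/andP; split.
  apply: le_trans (ln_harm R _); apply: (@le_trans _ _ (ln (blk j)%:R)).
    by rewrite lE; nra.
  by rewrite ler_ln ?posrE // ler_nat.
have -> : blk j = (blk j).-1.+1 by rewrite prednK ?blk_gt0.
by apply: le_trans (harm_ln R _) _; rewrite prednK ?blk_gt0 // lE lerD2l; nra.
Qed.

Lemma harm_blk_gt0 j : 0 < H (blk j).
Proof. by rewrite -(prednK (blk_gt0 j)) harm_gt0. Qed.

Lemma harm_blkS j : j.+1%:R * H (blk j) <= 4 * H (blk j.+1).
Proof.
have /andP[_ u] := harm_blk j; have /andP[l _] := harm_blk j.+1.
have f1 : (1 : R) <= (j`!)%:R by rewrite ler1n fact_gt0.
move: l; rewrite factS natrM => l.
have J0 : (0 : R) < j.+1%:R by [].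
apply: (@le_trans _ _ (j.+1%:R * (2 * (j`!)%:R))); first by rewrite ler_wpM2l //; lra.
by lra.
Qed.

Lemma harm_blkS_sq j : (1 <= j)%N -> H (blk j.+1) <= 16 * H (blk j) ^+ 2.
Proof.
move=> j1; have /andP[l _] := harm_blk j; have /andP[_ u] := harm_blk j.+1.
have jf : j%:R <= (j`!)%:R :> R by rewrite ler_nat fact_geq.
have j1R : (1 : R) <= j%:R by rewrite ler1n.
move: u; rewrite factS natrM -natr1 => u.
apply: le_trans u _; move: l jf; move: (H _) (j`!%:R) => x f l jf.
have : f ^+ 2 <= 4 * x ^+ 2.
  by rewrite (_ : 4 * x ^+ 2 = (2 * x) ^+ 2); [rewrite lerXn2r ?nnegrE; lra|ring].
have : (j%:R + 1) * f <= 2 * f ^+ 2 by rewrite expr2; nra.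
have : 1 <= f ^+ 2 by rewrite expr2; nra.
by lra.
Qed.

Lemma near_harm_blk_le (nu : R) : 0 < nu -> \forall j \near \oo, H (blk j.+1) <= nu * (blk j)%:R.
Proof.
move=> nu0; near=> j.
have j1 : (1 <= j)%N by near: j; exact: nbhs_infty_ge.
apply: le_trans (harm_blkS_sq j1) _.
have : H (blk j) ^+ 2 <= nu / 16 * (blk j)%:R.
  by near: j; apply: (near_blk (Q := fun n => H n ^+ 2 <= nu / 16 * n%:R)); apply: near_harm_sq; rewrite divr_gt0.
by lra.
Unshelve. all: by end_near. Qed.

Lemma leq_fact_exp n : (n`! <= n ^ n)%N.
Proof.
elim: n => // n IH; rewrite factS expnS leq_mul2l /=.
by apply: leq_trans IH _; case: n => // n; rewrite leq_exp2r.
Qed.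

Lemma near_lnln_blk (eta : R) : 0 < eta -> \forall j \near \oo,
  ln (ln (H (blk j.+1))) <= (1 + eta) * ln j%:R.
Proof.
move=> e0; have [x0 x01 lnx] := ln_le_lin (divr_gt0 e0 (ltr0n R 6)).
have [l1 l2] := ln2_itv R.
near=> j.
have j2 : (2 <= j)%N by near: j; exact: nbhs_infty_ge.
have j0 : (0 : R) < j%:R by rewrite ltr0n (leq_trans _ j2).
set y : R := ln j%:R.
have yB : x0 + 1 <= y by rewrite /y; near: j; exact: near_ln.
have L1 : 1 < ln (H (blk j.+1)).
  have : 2 <= ln (H (blk j.+1)); last by lra.
  near: j; apply: (near_S (Q := fun j => 2 <= ln (H (blk j)))).
  by apply: (near_blk (Q := fun n => 2 <= ln (H n))); exact: near_lnH.
have ly : ln j.+1%:R <= 1 + y.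
  by apply: ln_le_double; rewrite // muln2 -addnn -addn1 leq_add // ltnW.
have hB : ln (H (blk j.+1)) <= j%:R * (3 + 3 * y).
  have /andP[_ u] := harm_blk j.+1.
  have f1 : (1 : R) <= (j.+1`!)%:R by rewrite ler1n fact_gt0.
  have fe : (j.+1`!)%:R <= j.+1%:R ^+ j.+1 :> R by rewrite -natrX ler_nat leq_fact_exp.
  have p0 : (0 : R) < j.+1%:R ^+ j.+1 by rewrite exprn_gt0.
  have : ln (H (blk j.+1)) <= ln (2 * j.+1%:R ^+ j.+1).
    by rewrite ler_ln ?posrE ?harm_blk_gt0 ?mulr_gt0 //; lra.
  rewrite lnM ?posrE // lnXn // => /le_trans; apply.
  have j1R : (2 : R) <= j%:R by rewrite (ler_nat R 2).
  have -> : ln j.+1%:R *+ j.+1 = (j%:R + 1) * ln j.+1%:R :> R by rewrite natr1 mulr_natl.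
  have : (j%:R + 1) * ln j.+1%:R <= (j%:R + 1) * (1 + y) by rewrite ler_wpM2l //; lra.
  have : (j%:R + 1) * (1 + y) <= (2 * j%:R) * (1 + y) by rewrite ler_wpM2r //; lra.
  nra.
have yp : 0 < 3 + 3 * y by lra.
have : ln (ln (H (blk j.+1))) <= ln (j%:R * (3 + 3 * y)).
  by rewrite ler_ln ?posrE ?mulr_gt0 //; lra.
rewrite lnM ?posrE // -/y => /le_trans; apply.
have : ln (3 + 3 * y) <= eta / 6 * (3 + 3 * y) by apply: lnx; lra.
have : eta <= eta * y by rewrite ler_peMr ?ltW //; lra.
by lra.
Unshelve. all: by end_near. Qed.

End Blocks.

(** * Infinitely many successful blocks *)

Section LowerLIL.
Variables (R : realType) (dT : measure_display) (T : measurableType dT).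
Variables (P : probability T R) (d : nat) (X : nat -> T -> dir d).
Hypothesis d0 : (1 <= d)%N.
Hypothesis XP : is_ERW P ((2 * d%:R + 1) / (4 * d%:R)) X.
Notation H := (harm R).
Notation path := (seq (dir d)).
Notation k h := ((size h)%:R : R).
Notation hX w n := (hist (X^~ w) n).
Notation K := (kstep (@erwq R d)).
Notation sg := (@sgn R d).

Lemma var_sgn : mean (fun y => sg y ^+ 2) = 1.
Proof.
rewrite (_ : mean _ = mean (fun y : dir d => 0 - (- 1 : R))); last first.
  by congr mean; apply/funext => y; rewrite sgn_sq sub0r opprK.
by rewrite meanB // opprK /mean big1 // mulr0 add0r.
Qed.

Definition gap (j : nat) : R := H (blk j.+1) - H (blk j).

Lemma near_gap (eta : R) : 0 < eta -> \forall j \near \oo, (1 - eta) * H (blk j.+1) <= gap j.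
Proof.
move=> e0; near=> j.
have jB : 4 / eta <= j.+1%:R.
  apply: (@le_trans _ _ j%:R); last by rewrite ler_nat.
  by near: j; exact: near_natr.
have h0 := harm_blk_gt0 R j.+1; have := harm_blkS R j.
have : 4 * H (blk j) <= eta * (j.+1%:R * H (blk j)).
  rewrite mulrA ler_wpM2r ?(ltW (harm_blk_gt0 R j)) // mulrC.
  by rewrite -ler_pdivrMr.
move=> A B; have : eta * (j.+1%:R * H (blk j)) <= eta * (4 * H (blk j.+1)).
  by rewrite ler_wpM2l // ltW.
by rewrite /gap; lra.
Unshelve. all: by end_near. Qed.

(** Tuned so that the entropy of a block, about [thb^2 * gap / 2], stays just below [ln j]: success
    then keeps a probability of order at least [1 / j]. *)
Definition thb (eta : R) (j : nat) : R := Num.sqrt (2 * (1 - 3 * eta) * ln j%:R / gap j).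

(** A history with a bad start counts as no failure, so that the conditional bound can hold for
    every past. The upper bound shows later that bad starts occur only finitely often. *)
Definition failb (eta : R) (j : nat) (h : path) : bool :=
  let h0 := drop (blk j.+1 - blk j) h in
  (wsum sg h0 ^+ 2 <= (blk j)%:R * H (blk j.+1)) &&
  (mart sg h - mart sg h0 < (1 - eta) * (thb eta j * gap j)).

Lemma block_fail_near (eta : R) : 0 < eta <= 1 / 14 -> exists J0, forall j h, (J0 <= j)%N ->
  size h = blk j ->
  iter (blk j.+1 - blk j) K (fun h' => (failb eta j h')%:R) h <= j%:R / j.+1%:R.
Proof.
move=> /andP[e0 e14]; have qs := erwq_stochastic R d0.
have e3 : 0 < 1 - 3 * eta by lra.
pose C := 4 / (eta ^+ 2 * (1 - 3 * eta)).
have eta01 : 0 < eta <= 1 by rewrite e0; lra.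
suff [J0 _ JP] : \forall j \near \oo, forall h, size h = blk j ->
    iter (blk j.+1 - blk j) K (fun h' => (failb eta j h')%:R) h <= j%:R / j.+1%:R.
  by exists J0 => j h Jj; exact: JP.
near=> j => h hs.
have j2 : (2 <= j)%N by near: j; exact: nbhs_infty_ge.
have j0 : (0 : R) < j%:R by rewrite ltr0n (leq_trans _ j2).
have lj : (C + 1) / eta <= ln j%:R by near: j; exact: near_ln.
have C0 : 0 < C by rewrite divr_gt0 // mulr_gt0 ?exprn_gt0.
have lj0 : 0 < ln j%:R :> R by apply: lt_le_trans lj; rewrite divr_gt0 // addr_gt0.
have G2 : (1 - 1 / 2) * H (blk j.+1) <= gap j by near: j; apply: near_gap; lra.
have g0 : 0 < gap j by apply: lt_le_trans G2; rewrite mulr_gt0 ?harm_blk_gt0 //; lra.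
have Hnu : H (blk j.+1) <= eta * (blk j)%:R by near: j; exact: near_harm_blk_le.
have b0 : (0 : R) < (blk j)%:R by rewrite ltr0n blk_gt0.
have bB : 4 / eta <= (blk j)%:R.
  by near: j; apply: (near_blk (Q := fun n => 4 / eta <= n%:R :> R)); exact: near_natr.
have jB : 128 / eta ^+ 2 <= j%:R by near: j; exact: near_natr.
have cat_drop s : size s = (blk j.+1 - blk j)%N -> drop (blk j.+1 - blk j) (s ++ h) = h.
  by move=> <-; rewrite drop_size_cat.
case: (boolP (wsum sg h ^+ 2 <= (blk j)%:R * H (blk j.+1))) => bad; last first.
  apply: (@le_trans _ _ (iter (blk j.+1 - blk j) K (fun=> 0) h)).
    apply: (iter_kstep_le qs) => s sn; rewrite /failb cat_drop // (negbTE bad) //.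
  by rewrite (iter_kstep_cst qs) divr_ge0.
set D := gap j; set t := thb eta j.
have tt : t ^+ 2 * D = 2 * (1 - 3 * eta) * ln j%:R.
  rewrite /t /thb sqr_sqrtr ?divfK ?gt_eqF // divr_ge0 ?(ltW g0) //.
  by rewrite !mulr_ge0 ?(ltW e3) ?(ltW lj0).
have t0 : 0 < t by rewrite sqrtr_gt0 divr_gt0 // !mulr_gt0.
have tsm : 2 * t <= eta / 2.
  have Dj : j%:R ^+ 2 / 4 <= D.
    have /andP[l _] := harm_blk R j.+1.
    have : j%:R ^+ 2 <= (j.+1`!)%:R :> R.
      rewrite -natrX ler_nat factS expnS expn1 leq_mul ?fact_geq //.
    by move: G2 l; rewrite -/D; lra.
  have t2 : t ^+ 2 <= 8 / j%:R.
    have -> : t ^+ 2 = 2 * (1 - 3 * eta) * ln j%:R / D by rewrite -tt mulfK ?gt_eqF.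
    rewrite ler_pdivrMr //; apply: (@le_trans _ _ (2 * j%:R)).
      have : ln j%:R < j%:R :> R by exact: ln_sublinear.
      by nra.
    apply: (@le_trans _ _ (8 / j%:R * (j%:R ^+ 2 / 4))).
      by rewrite le_eqVlt; apply/orP; left; apply/eqP; field; rewrite gt_eqF.
    by rewrite ler_wpM2l // divr_ge0 // ltW.
  have : t ^+ 2 <= (eta / 4) ^+ 2.
    apply: le_trans t2 _; rewrite ler_pdivrMr //.
    move: jB; rewrite ler_pdivrMr ?exprn_gt0 // => ?.
    by rewrite (_ : (eta / 4) ^+ 2 * j%:R = j%:R * eta ^+ 2 / 16); [lra|field].
  rewrite ler_pXn2r ?nnegrE ?(ltW t0) ?divr_ge0 ?(ltW e0) //; lra.
have hn : h != [::] by rewrite -size_eq0 hs -lt0n blk_gt0.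
have DE : D = H ((blk j.+1 - blk j) + size h) - H (size h).
  by rewrite hs subnK ?blk_homo.
(* With [e0 = j^-2] the term [ln e0] times the Chebyshev bound is the constant [- C], because
   [t^2 * D] is proportional to [ln j], while [e0] itself is negligible against [1 / j]. *)
have j21 : 0 < (j%:R ^- 2 : R) <= 1.
  apply/andP; split; first by rewrite invr_gt0 exprn_gt0.
  by rewrite invf_le1 ?exprn_gt0 // exprn_ege1 // ler1n ltnW.
have th4 : t <= 1 / 4 by lra.
have := @block_fail_le R d d0 t t0 th4 (blk j.+1 - blk j) h eta _ D eta01 tsm j21 hn DE g0.
have pt : pot R h / 2 <= eta.
  rewrite /pot hs expr_div_n.
  have : wsum sg h ^+ 2 / (blk j)%:R ^+ 2 <= eta.
    rewrite ler_pdivrMr ?exprn_gt0 //; apply: le_trans bad _.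
    rewrite expr2 mulrCA ler_wpM2l // ltW //.
  have : 2 / (blk j)%:R <= eta / 2.
    rewrite ler_pdivrMr //; move: bB; rewrite ler_pdivrMr // => ?; lra.
  by lra.
have -> : ln (j%:R ^- 2) * (4 / (eta ^+ 2 * (t ^+ 2 * D))) = - C.
  rewrite lnV ?posrE ?exprn_gt0 // lnXn // tt /C mulr2n.
  by field; rewrite !gt_eqF.
set ex := (- C - _) => B.
(* The entropy is at most [(1 + eta)^2 (1 - 3 eta) ln j <= (1 - eta) ln j], and the spare
   [eta * ln j] pays for [C + 1]. Then [expR ex >= 2 / j], enough to absorb [j^-2]. *)
have exB : 1 - ln j%:R <= ex.
  have : (1 + eta) / 2 * (t ^+ 2 * D) * (1 + pot R h / 2) <= (1 - eta) * ln j%:R.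
    rewrite tt.
    have -> : (1 + eta) / 2 * (2 * (1 - 3 * eta) * ln j%:R) * (1 + pot R h / 2) =
      ((1 + eta) * (1 - 3 * eta) * (1 + pot R h / 2)) * ln j%:R by field.
    rewrite ler_wpM2r ?(ltW lj0) //.
    apply: (@le_trans _ _ ((1 + eta) * (1 - 3 * eta) * (1 + eta))).
      by rewrite ler_wpM2l ?lerD2l // mulr_ge0 //; lra.
    have : 0 <= eta ^+ 3 by rewrite exprn_ge0 // ltW.
    have := sqr_ge0 eta.
    have -> : (1 + eta) * (1 - 3 * eta) * (1 + eta) = 1 - eta - 5 * eta ^+ 2 - 3 * eta ^+ 3 by ring.
    by lra.
  move: lj; rewrite ler_pdivrMr // /ex.
  by lra.
have eB : 2 / j%:R <= expR ex.
  apply: (@le_trans _ _ (expR (1 - ln j%:R))); last by rewrite ler_expR.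
  rewrite expRD expRN lnK ?posrE // ler_wpM2r ?invr_ge0 ?(ltW j0) //.
  by have := expR_ge1Dx (1 : R); lra.
apply: (@le_trans _ _ (1 + j%:R ^- 2 - expR ex)).
  apply: le_trans B; apply: (iter_kstep_le qs) => s sn.
  rewrite /failb cat_drop // bad /=; exact: lexx.
have j3 : j%:R ^- 2 <= j%:R^-1 :> R.
  rewrite lef_pV2 ?posrE ?exprn_gt0 // expr2 ler_peMr ?(ltW j0) // ler1n ltnW //.
have j4 : j.+1%:R^-1 <= j%:R^-1 :> R by rewrite lef_pV2 ?posrE // ler_nat.
have -> : j%:R / j.+1%:R = 1 - j.+1%:R^-1 :> R.
  by rewrite -natr1; field; rewrite gt_eqF // addr_gt0.
move: eB j3 j4; move: (expR ex) (j%:R ^- 2) (j%:R^-1) (j.+1%:R^-1) => a b e f; lra.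
Unshelve. all: by end_near. Qed.

Lemma wsum_lower_fixed_ae (tau : R) : 0 <= tau < 1 ->
  {ae P, forall w, forall N, exists n, [/\ (N <= n)%N, 0 <= wsum sg (hX w n) &
     tau * lilscale R n <= wsum sg (hX w n) ^+ 2]}.
Proof.
(* This makes [t2 = (1 + tau) / 2] equal to [1 - 7 eta], below the product of losses
   [(1 - eta)^3 (1 - 3 eta) / (1 + eta)]. *)
move=> /andP[t0 t1]; pose eta := (1 - tau) / 14.
have e0 : 0 < eta by rewrite divr_gt0 // subr_gt0.
have e14 : eta <= 1 / 14 by rewrite /eta; lra.
have et : 0 < eta <= 1 / 14 by rewrite e0.
have [J0 JP] := block_fail_near et.
have sg0 : mean sg = 0 by exact: mean_sgn.
have A := infinitely_often_ae d0 XP (nn := blk) (F := failb eta) blk_homo JP.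
have sv : mean (fun y => sg y ^+ 2) < 2 by rewrite var_sgn; lra.
apply: filterS2 A (wsum_sq_upper_fixed_ae d0 XP sg0 sv) => w io up N.
pose t2 := (1 + tau) / 2.
have sq0 : 0 < Num.sqrt t2 - Num.sqrt tau by rewrite subr_gt0 ltr_sqrt /t2; lra.
suff [J1 _ J1P] : \forall j \near \oo, ~~ failb eta j (hX w (blk j.+1)) ->
    0 <= wsum sg (hX w (blk j.+1)) /\
    tau * lilscale R (blk j.+1) <= wsum sg (hX w (blk j.+1)) ^+ 2.
  have [j] := io (maxn J1 N); rewrite geq_max => /andP[J1j Nj] /(J1P j J1j)[? ?].
  exists (blk j.+1); split => //.
  exact: leq_trans Nj (leq_trans (leqnSn j) (leq_blk _)).
have near_b (B : R) : \forall j \near \oo, B <= ln (ln (H (blk j.+1))).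
  apply: (near_S (Q := fun j => B <= ln (ln (H (blk j))))).
  by apply: (near_blk (Q := fun n => B <= ln (ln (H n)))); exact: near_lnlnH.
have e32 : (0 : R) < 1 / 32 by rewrite divr_gt0.
have [x0 x01 lnx] := ln_le_lin e32.
near=> j.
have drp : drop (blk j.+1 - blk j) (hX w (blk j.+1)) = hX w (blk j).
  have {2}-> : blk j.+1 = (blk j.+1 - blk j + blk j)%N by rewrite subnK ?blk_homo.
  exact: drop_hist.
rewrite /failb drp.
have j2 : (2 <= j)%N by near: j; exact: nbhs_infty_ge.
have j0 : (0 : R) < j%:R by rewrite ltr0n (leq_trans _ j2).
have lj0 : 0 < ln j%:R :> R by rewrite ln_gt0 // ltr1n.
set h1 := H (blk j.+1); set n1 := blk j.+1.
have h0 : 0 < h1 by exact: harm_blk_gt0.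
have G1 : (1 - eta) * h1 <= gap j by rewrite /h1; near: j; exact: near_gap.
have g0 : 0 < gap j by apply: lt_le_trans G1; rewrite mulr_gt0 //; lra.
have LL : ln (ln h1) <= (1 + eta) * ln j%:R by rewrite /h1; near: j; exact: near_lnln_blk.
have LL2 : ln (ln h1) <= (1 + 1) * ln j%:R by rewrite /h1; near: j; exact: near_lnln_blk.
have l1 : (3 / (Num.sqrt t2 - Num.sqrt tau)) ^+ 2 <= ln (ln h1) by rewrite /h1; near: j; exact: near_b.
have h11 : 1 <= h1.
  rewrite /h1; near: j; apply: (near_S (Q := fun j => 1 <= H (blk j))).
  by apply: (near_blk (Q := fun n => 1 <= H n)); exact: near_harm.
have l0 : 0 <= ln (ln h1) by apply: le_trans l1; exact: sqr_ge0.
have b0 : (0 : R) < (blk j)%:R by rewrite ltr0n blk_gt0.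
have n10 : (0 : R) < n1%:R by rewrite ltr0n blk_gt0.
(* By [harm_blkS] the clock grows by a factor of at least [(j + 1) / 4], which dominates the
   iterated logarithm in the upper bound, itself of order [ln j]. *)
have good : wsum sg (hX w (blk j)) ^+ 2 <= (blk j)%:R * h1.
  have U : wsum sg (hX w (blk j)) ^+ 2 <= 2 * lilscale R (blk j).
    by near: j; apply: (near_blk (Q := fun n => wsum sg (hX w n) ^+ 2 <= 2 * lilscale R n)).
  apply: le_trans U _; rewrite /lilscale.
  have -> : 2 * (2 * (blk j)%:R * H (blk j) * ln (ln (H (blk j)))) =
    (blk j)%:R * (4 * (H (blk j) * ln (ln (H (blk j))))) by ring.
  rewrite ler_wpM2l ?(ltW b0) //.
  have Hj0 := harm_blk_gt0 R j.
  have lH1 : 1 <= ln (H (blk j)).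
    by near: j; apply: (near_blk (Q := fun n => 1 <= ln (H n))); exact: near_lnH.
  have HS := harm_blkS R j; rewrite -/h1 in HS.
  have mono : ln (ln (H (blk j))) <= ln (ln h1).
    have Hm : H (blk j) <= h1 by move: g0; rewrite /gap subr_gt0 => /ltW.
    have Hl : ln (H (blk j)) <= ln h1 by rewrite ler_ln ?posrE.
    rewrite ler_ln ?posrE //; lra.
  have lnj : ln j%:R <= 1 / 32 * j%:R :> R.
    by apply: lnx; near: j; exact: near_natr.
  have L16 : 16 * ln (ln (H (blk j))) <= j.+1%:R by rewrite -natr1; lra.
  have : H (blk j) * (16 * ln (ln (H (blk j)))) <= H (blk j) * j.+1%:R by rewrite ler_wpM2l // ltW.
  by rewrite [_ * j.+1%:R]mulrC; lra.
rewrite good /= -leNgt => succ.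
have c1 : Num.sqrt (t2 * (2 * h1 * ln (ln h1))) <= (1 - eta) * (thb eta j * gap j).
  have e1 : 0 <= 1 - eta by lra.
  have e3 : 0 < 1 - 3 * eta by lra.
  have -> : (1 - eta) * (thb eta j * gap j) =
      Num.sqrt ((1 - eta) ^+ 2 * (2 * (1 - 3 * eta) * ln j%:R * gap j)).
    rewrite sqrtrM ?sqr_ge0 // sqrtr_sqr ger0_norm //; congr (_ * _).
    have {1}-> : gap j = Num.sqrt (gap j ^+ 2) by rewrite sqrtr_sqr gtr0_norm.
    rewrite /thb -sqrtrM; last by rewrite divr_ge0 ?(ltW g0) // !mulr_ge0 ?(ltW e3) ?(ltW lj0).
    by congr Num.sqrt; field; rewrite gt_eqF.
  apply: ler_wsqrtr.
  apply: (@le_trans _ _ ((1 - eta) ^+ 2 * (2 * (1 - 3 * eta) * (ln (ln h1) / (1 + eta)) * ((1 - eta) * h1)))).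
    have -> : (1 - eta) ^+ 2 * (2 * (1 - 3 * eta) * (ln (ln h1) / (1 + eta)) * ((1 - eta) * h1)) =
      ((1 - eta) ^+ 3 * (1 - 3 * eta) / (1 + eta)) * (2 * h1 * ln (ln h1)).
      by field; rewrite gt_eqF //; lra.
    apply: ler_wpM2r; first by rewrite !mulr_ge0 // ltW.
    rewrite ler_pdivlMr; last by lra.
    have -> : t2 = 1 - 7 * eta by rewrite /t2 /eta; field.
    apply: (@le_trans _ _ ((1 - 3 * eta) * (1 - 3 * eta))); first by nra.
    rewrite ler_wpM2r ?(ltW e3) //.
    have : 0 <= eta ^+ 2 * (3 - eta) by rewrite mulr_ge0 ?sqr_ge0 //; lra.
    have -> : (1 - eta) ^+ 3 = 1 - 3 * eta + eta ^+ 2 * (3 - eta) by ring.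
    by lra.
  rewrite ler_wpM2l ?sqr_ge0 //; apply: ler_pM => //.
  - apply: mulr_ge0; first by rewrite mulr_ge0 // ltW.
    by rewrite divr_ge0 //; lra.
  - by rewrite mulr_ge0 // ltW.
  rewrite ler_wpM2l ?mulr_ge0 ?(ltW e3) // ler_pdivrMr; last by lra.
  by rewrite mulrC.
have sgb := wsum_mart d0 (@sgn_le R d).
(* The block may start as low as about [- sqrt h1]; [K3] below shows that this is negligible against
   a gain of order [sqrt (h1 * ln (ln h1))]. *)
have M1 : - (Num.sqrt h1 + 1) <= mart sg (hX w (blk j)).
  have := sgb (hX w (blk j)); rewrite size_hist ler_norml => /andP[_ M].
  have : - Num.sqrt h1 <= wsum sg (hX w (blk j)) / Num.sqrt (blk j)%:R.
    have sb0 : 0 < Num.sqrt (blk j)%:R :> R by rewrite sqrtr_gt0.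
    rewrite ler_pdivlMr // mulNr -sqrtrM ?(ltW h0) // lerNl.
    apply: le_trans (ler_norm _) _; rewrite normrN -sqrtr_sqr; apply: ler_wsqrtr.
    by rewrite mulrC.
  by lra.
have := sgb (hX w n1); rewrite size_hist ler_norml => /andP[M2 _].
set sn := Num.sqrt (n1%:R : R) in M2 *.
have sn0 : 0 < sn by rewrite sqrtr_gt0.
set ph := 2 * h1 * ln (ln h1).
have ph0 : 0 <= ph by rewrite !mulr_ge0 // ltW.
have t20 : 0 <= t2 by rewrite /t2; lra.
have K3 : Num.sqrt h1 + 2 <= (Num.sqrt t2 - Num.sqrt tau) * Num.sqrt ph.
  have s1 : 1 <= Num.sqrt h1 by rewrite -[leLHS]sqrtr1 ler_wsqrtr.
  have -> : ph = h1 * (2 * ln (ln h1)) by rewrite /ph; ring.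
  rewrite (@sqrtrM _ h1 _ (ltW h0)).
  have B3 : 3 <= (Num.sqrt t2 - Num.sqrt tau) * Num.sqrt (2 * ln (ln h1)).
    rewrite mulrC -ler_pdivrMr //.
    have -> : 3 / (Num.sqrt t2 - Num.sqrt tau) = Num.sqrt ((3 / (Num.sqrt t2 - Num.sqrt tau)) ^+ 2).
      by rewrite sqrtr_sqr ger0_norm // divr_ge0 // ltW.
    by apply: ler_wsqrtr; lra.
  have : 3 * Num.sqrt h1 <= (Num.sqrt t2 - Num.sqrt tau) * Num.sqrt (2 * ln (ln h1)) * Num.sqrt h1.
    by rewrite ler_wpM2r // sqrtr_ge0.
  move: (Num.sqrt h1) s1 (Num.sqrt (2 * ln (ln h1))) (Num.sqrt t2 - Num.sqrt tau) {B3} => a a1 b e.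
  by rewrite -[e * b * a]mulrA [b * a]mulrC; lra.
have fin : Num.sqrt (tau * ph) <= wsum sg (hX w n1) / sn.
  rewrite (@sqrtrM _ t2 ph t20) in c1.
  rewrite (@sqrtrM _ tau ph t0); move: K3; rewrite mulrBl.
  move: succ c1 M1 M2; rewrite -/n1; lra.
have S0 : 0 <= wsum sg (hX w n1).
  have : 0 <= wsum sg (hX w n1) / sn by apply: le_trans fin; exact: sqrtr_ge0.
  by rewrite ler_pdivlMr // mul0r.
split => //.
have -> : tau * lilscale R n1 = Num.sqrt (tau * ph) ^+ 2 * sn ^+ 2.
  have snE : sn ^+ 2 = n1%:R by rewrite sqr_sqrtr.
  by rewrite snE sqr_sqrtr ?(mulr_ge0 t0 ph0) // /lilscale -/h1 /ph; ring.
rewrite -exprMn lerXn2r ?nnegrE ?mulr_ge0 ?sqrtr_ge0 //.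
by rewrite -ler_pdivlMr.
Unshelve. all: by end_near. Qed.

End LowerLIL.

(** * The center of mass *)

Section CenterLIL.
Variables (R : realType) (dT : measure_display) (T : measurableType dT).
Variables (P : probability T R) (d : nat) (X : nat -> T -> dir d).
Hypothesis d0 : (1 <= d)%N.
Hypothesis XP : is_ERW P ((2 * d%:R + 1) / (4 * d%:R)) X.
Notation H := (harm R).
Notation hX w n := (hist (X^~ w) n).
Implicit Types g : dir d -> R.
Notation var g := (mean (fun y => g y ^+ 2)).

Definition lil (n : nat) : R := 2 * n%:R * ln n%:R * ln (ln (ln n%:R)).

Lemma near_lil_gt0 : \forall n \near \oo, 0 < lil n.
Proof.
near=> n.
have n0 : (0 : R) < n%:R by rewrite ltr0n; near: n; exact: nbhs_infty_gt.
have l0 : 1 <= ln n%:R :> R by near: n; exact: near_ln.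
have l3 : 1 <= ln (ln (ln n%:R)) :> R.
  by near: n; exact: (near_ln_comp (near_ln_comp (@near_ln R))).
by rewrite !mulr_gt0 // (lt_le_trans ltr01).
Unshelve. all: by end_near. Qed.

Lemma near_lilscale (e : R) : 0 < e -> \forall n \near \oo,
  lil n <= lilscale R n <= (1 + e) * lil n.
Proof.
move=> e0; pose e1 := Num.min 1 e / 4.
have e10 : 0 < e1 by rewrite divr_gt0 // lt_min ltr01.
have e11 : e1 <= 1 / 4 by rewrite ler_wpM2r // ge_min lexx.
have e1e : 4 * e1 <= e by rewrite /e1 mulrC divfK // ge_min lexx orbT.
have [_ l2] := ln2_itv R.
near=> n.
have n1 : (1 <= n)%N by near: n; exact: nbhs_infty_ge.
have n0 : (0 : R) < n%:R by rewrite ltr0n.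
set l : R := ln n%:R; set ll := ln l; set lll := ln ll.
have lB : 1 + e1^-1 <= l by rewrite /l; near: n; exact: near_ln.
have llB : 2 <= ll by rewrite /ll /l; near: n; exact: (near_ln_comp (@near_ln R)).
have lllB : 1 + e1^-1 <= lll.
  by rewrite /lll /ll /l; near: n; exact: (near_ln_comp (near_ln_comp (@near_ln R))).
have i0 : 0 < e1^-1 by rewrite invr_gt0.
have Hl : l <= H n.
  by apply: le_trans (ln_harm R n); rewrite ler_ln ?posrE // ler_nat.
have Hu : H n <= 1 + l by rewrite -(prednK n1) (le_trans (harm_ln R _)) // prednK.
have l0 : 0 < l by lra.
have ll0 : 0 < ll by lra.
have H0 : 0 < H n by lra.
have lnHl : ll <= ln (H n) by rewrite ler_ln ?posrE.
have lnlnHl : lll <= ln (ln (H n)) by rewrite ler_ln ?posrE //; lra.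
have lnHu : ln (H n) <= 2 * ll.
  have : ln (H n) <= ln (2 * l) by rewrite ler_ln ?posrE ?mulr_gt0 //; lra.
  by rewrite lnM ?posrE // -/ll; lra.
have lnlnHu : ln (ln (H n)) <= 1 + lll.
  have : ln (ln (H n)) <= ln (2 * ll) by rewrite ler_ln ?posrE ?mulr_gt0 //; lra.
  by rewrite lnM ?posrE // -/lll; lra.
have u1 : H n <= (1 + e1) * l.
  have : 1 <= e1 * l by rewrite -ler_pdivrMl // mulr1; lra.
  by lra.
have u2 : ln (ln (H n)) <= (1 + e1) * lll.
  have : 1 <= e1 * lll by rewrite -ler_pdivrMl // mulr1; lra.
  by lra.
have lll0 : 0 < lll by lra.
rewrite /lilscale /lil -/l -/ll -/lll -!mulrA; apply/andP; split.
  rewrite !ler_wpM2l // ?(ltW n0) //.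
  by apply: ler_pM => //; lra.
rewrite [leRHS]mulrCA ler_wpM2l // [leRHS]mulrCA ler_wpM2l ?(ltW n0) //.
apply: (@le_trans _ _ (((1 + e1) * l) * ((1 + e1) * lll))).
  by apply: ler_pM => //; lra.
have -> : (1 + e1) * l * ((1 + e1) * lll) = (1 + e1) ^+ 2 * (l * lll) by ring.
rewrite ler_wpM2r ?mulr_ge0 ?(ltW l0) ?(ltW lll0) //; nra.
Unshelve. all: by end_near. Qed.

Lemma near_remn_small (C de : R) : 0 < de -> \forall n \near \oo,
  C * (H n * n%:R) <= de * lilscale R n.
Proof.
move=> de0; near=> n.
have H1 : 1 <= H n by near: n; exact: near_harm.
have l0 : C / (2 * de) <= ln (ln (H n)) by near: n; exact: near_lnlnH.
rewrite /lilscale (_ : de * _ = (2 * de * ln (ln (H n))) * (H n * n%:R)); last by ring.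
rewrite ler_wpM2r ?mulr_ge0 //; first by lra.
by rewrite mulrC -ler_pdivrMr // mulr_gt0.
Unshelve. all: by end_near. Qed.

Lemma lilscale_ge0 : \forall n \near \oo, 0 <= lilscale R n.
Proof.
near=> n; have H1 : 1 <= H n by near: n; exact: near_harm.
have l0 : 0 <= ln (ln (H n)) by near: n; exact: near_lnlnH.
by rewrite /lilscale !mulr_ge0 //; lra.
Unshelve. all: by end_near. Qed.

Lemma possum_sq_bounds (n S Rm de : R) : 0 < de <= 1 -> 0 < n -> (2 * n)^-1 <= de ->
  4 / 9 * ((1 - de) * S ^+ 2 - de^-1 * (Rm / n) ^+ 2) <=
    (2 / 3 * ((n + 1 / 2) * S - Rm) / n) ^+ 2 <=
  4 / 9 * ((1 + 15 * de) * S ^+ 2 + 2 * (1 + de^-1) * (Rm / n) ^+ 2).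
Proof.
move=> de01 n0 nde; have /andP[de0 de1] := de01.
have W0 : 0 <= n ^- 2 by rewrite invr_ge0 sqr_ge0.
have r1 : 1 <= (1 : R) <= 1 + de by rewrite lexx lerDl ltW.
have rW : 1 * n ^- 2 = (n * 1) ^- 2 by rewrite mul1r mulr1.
have /andP[A B] := possum_term_bounds (S := S) (Rm := Rm) de01 n0 W0 nde r1 rW erefl.
rewrite mulr1 in A B.
have p0 : 0 < n ^- 2 by rewrite invr_gt0 exprn_gt0.
apply/andP; split; rewrite -(ler_pM2r p0).
  by apply: le_trans A; rewrite le_eqVlt; apply/orP; left; apply/eqP; ring.
by apply: le_trans B _; rewrite le_eqVlt; apply/orP; left; apply/eqP; ring.
Qed.

Lemma possum_upper_ae g : mean g = 0 -> {ae P, forall w, forall tau, var g < tau ->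
  \forall n \near \oo, (possum g (hX w n) / n%:R) ^+ 2 <= 4 / 9 * tau * lil n}.
Proof.
move=> g0; apply: filterS2 (wsum_sq_upper_ae d0 XP g0) (remn_sq_upper_ae d0 XP g0).
move=> w Sw [C Cw] tau st; have s0 := mean_sq_ge0 g.
(* The accumulated error is at most [31 * de * tau + 34 * de], hence within
   [40 * de * (tau + 1)]. *)
pose de := Num.min 1 ((tau - var g) / (40 * (tau + 1))).
have t40 : 0 < 40 * (tau + 1) by lra.
have de0 : 0 < de by rewrite lt_min ltr01 divr_gt0 // subr_gt0.
have de1 : de <= 1 by rewrite ge_min lexx.
have dee : de * (40 * (tau + 1)) <= tau - var g by rewrite -ler_pdivlMr // ge_min lexx orbT.
have Sd := Sw (var g + de); near=> n.
have n1 : (1 <= n)%N by near: n; exact: nbhs_infty_ge.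
have n0 : (0 : R) < n%:R by rewrite ltr0n.
have nd : (2 * n%:R)^-1 <= de.
  have di : de^-1 <= n%:R by near: n; exact: near_natr.
  rewrite -[leRHS]invrK lef_pV2 ?posrE ?invr_gt0 ?mulr_gt0 //.
  by apply: le_trans di _; rewrite ler_peMl // ?ler1n // ltW.
have de01 : 0 < de <= 1 by rewrite de0.
have /andP[_ B] := possum_sq_bounds (wsum g (hX w n)) (remn g (hX w n)) de01 n0 nd.
rewrite possumE // size_hist; apply: le_trans B _.
rewrite -[leRHS]mulrA ler_wpM2l //.
have L0 : 0 <= lilscale R n by near: n; exact: lilscale_ge0.
have S2 : wsum g (hX w n) ^+ 2 <= (var g + de) * lilscale R n by near: n; apply: Sd; rewrite ltrDl.
have R2 : remn g (hX w n) ^+ 2 <= C * (H n * n%:R ^+ 3) by near: n; exact: Cw.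
have R3 : 2 * (1 + de^-1) * (remn g (hX w n) / n%:R) ^+ 2 <= de * lilscale R n.
  apply: (@le_trans _ _ (2 * (1 + de^-1) * C * (H n * n%:R))); last by near: n; exact: near_remn_small.
  rewrite -[leRHS]mulrA ler_wpM2l ?mulr_ge0 ?addr_ge0 ?invr_ge0 ?(ltW de0) //.
  rewrite expr_div_n ler_pdivrMr ?exprn_gt0 //; apply: le_trans R2 _.
  by rewrite le_eqVlt; apply/orP; left; apply/eqP; ring.
have /andP[_ lu] : lil n <= lilscale R n <= (1 + de) * lil n by near: n; exact: near_lilscale.
have lil0 : 0 < lil n by near: n; exact: near_lil_gt0.
apply: (@le_trans _ _ (((1 + 15 * de) * (var g + de) + de) * lilscale R n)).
  rewrite [leRHS]mulrDl lerD // -[leRHS]mulrA ler_wpM2l //; lra.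
apply: (@le_trans _ _ (((1 + 15 * de) * (var g + de) + de) * ((1 + de) * lil n))).
  by rewrite ler_wpM2l // addr_ge0 ?(ltW de0) // mulr_ge0; lra.
rewrite mulrA ler_wpM2r ?(ltW lil0) //.
have vt : var g <= tau by lra.
move: s0 vt dee; move: (var g) => v s0 vt dee.
have d2 : de ^+ 2 <= de by rewrite expr2; nra.
have d3 : de ^+ 3 <= de by rewrite -[leRHS]mulr1 exprS ler_wpM2l ?(ltW de0) // exprn_ile1 // ltW.
have dv : de * v <= de * tau by rewrite ler_wpM2l // ltW.
have d2v : de ^+ 2 * v <= de * v by rewrite ler_wpM2r.
have dt : 0 <= de * tau by rewrite mulr_ge0 ?(ltW de0) // (le_trans s0).
have -> : ((1 + 15 * de) * (v + de) + de) * (1 + de) =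
  v + 16 * (de * v) + 15 * (de ^+ 2 * v) + 2 * de + 17 * de ^+ 2 + 15 * de ^+ 3 by ring.
by lra.
Unshelve. all: by end_near. Qed.

Lemma possum_lower_ae : {ae P, forall w, forall tau, tau < 1 -> forall N, exists2 n, (N <= n)%N &
  4 / 9 * tau * lil n <= (possum (@sgn R d) (hX w n) / n%:R) ^+ 2}.
Proof.
have A : {ae P, forall w, forall m N : nat, exists n, [/\ (N <= n)%N, 0 <= wsum (@sgn R d) (hX w n) &
     (1 - m.+1%:R^-1) * lilscale R n <= wsum (@sgn R d) (hX w n) ^+ 2]}.
  apply: ae_foralln => m; apply: (wsum_lower_fixed_ae d0 XP).
  have m1 : (m.+1%:R : R)^-1 <= 1 by rewrite invf_le1 // ler1n.
  have m0 : (0 : R) < m.+1%:R^-1 by rewrite invr_gt0.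
  by rewrite subr_ge0 m1 ltrBlDr ltrDl.
have sg0 := @mean_sgn R d.
apply: filterS2 A (remn_sq_upper_ae d0 XP sg0) => w Sw [C Cw] tau t1 N.
(* The losses leave [(1 - de)^2 - de >= 1 - 3 de], and this choice gives [tau <= 1 - 4 de]. *)
pose de := Num.min (1 / 4) ((1 - tau) / 4).
have de0 : 0 < de by rewrite lt_min !divr_gt0 // subr_gt0.
have de1 : de <= 1 / 4 by rewrite ge_min lexx.
have de4 : 4 * de <= 1 - tau by rewrite mulrC -ler_pdivlMr // ge_min lexx orbT.
pose m := Num.bound de^-1.
have md : m.+1%:R^-1 <= de.
  rewrite -[leRHS]invrK lef_pV2 ?posrE ?invr_gt0 //.
  apply: le_trans (ltW (archi_boundP _)) _; first by rewrite invr_ge0 ltW.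
  by rewrite ler_nat.
suff [N1 _ N1P] : \forall n \near \oo,
    (1 - m.+1%:R^-1) * lilscale R n <= wsum (@sgn R d) (hX w n) ^+ 2 ->
    4 / 9 * tau * lil n <= (possum (@sgn R d) (hX w n) / n%:R) ^+ 2.
  have [n [+ _ Sn]] := Sw m (maxn N N1); rewrite geq_max => /andP[Nn N1n].
  by exists n => //; exact: N1P.
near=> n => Sn.
have n1 : (1 <= n)%N by near: n; exact: nbhs_infty_ge.
have n0 : (0 : R) < n%:R by rewrite ltr0n.
have nd : (2 * n%:R)^-1 <= de.
  have di : de^-1 <= n%:R by near: n; exact: near_natr.
  rewrite -[leRHS]invrK lef_pV2 ?posrE ?invr_gt0 ?mulr_gt0 //.
  by apply: le_trans di _; rewrite ler_peMl // ?ler1n // ltW.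
have de01 : 0 < de <= 1 by rewrite de0; lra.
have /andP[B _] := possum_sq_bounds (wsum (@sgn R d) (hX w n)) (remn (@sgn R d) (hX w n)) de01 n0 nd.
rewrite possumE // size_hist; apply: le_trans B; rewrite -[leLHS]mulrA ler_wpM2l //.
have L0 : 0 <= lilscale R n by near: n; exact: lilscale_ge0.
have R2 : remn (@sgn R d) (hX w n) ^+ 2 <= C * (H n * n%:R ^+ 3) by near: n; exact: Cw.
have R3 : de^-1 * (remn (@sgn R d) (hX w n) / n%:R) ^+ 2 <= de * lilscale R n.
  apply: (@le_trans _ _ (de^-1 * C * (H n * n%:R))); last by near: n; exact: near_remn_small.
  rewrite -[leRHS]mulrA ler_wpM2l ?invr_ge0 ?(ltW de0) //.
  rewrite expr_div_n ler_pdivrMr ?exprn_gt0 //; apply: le_trans R2 _.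
  by rewrite le_eqVlt; apply/orP; left; apply/eqP; ring.
have /andP[ll _] : lil n <= lilscale R n <= (1 + 1) * lil n by near: n; exact: near_lilscale.
have lil0 : 0 < lil n by near: n; exact: near_lil_gt0.
have S2 : (1 - de) * lilscale R n <= wsum (@sgn R d) (hX w n) ^+ 2.
  by apply: le_trans Sn; rewrite ler_wpM2r // lerD2l lerN2.
have S3 : (1 - de) * ((1 - de) * lilscale R n) <= (1 - de) * wsum (@sgn R d) (hX w n) ^+ 2.
  by rewrite ler_wpM2l //; lra.
apply: (@le_trans _ _ ((1 - 3 * de) * lilscale R n)); last first.
  have : (1 - 3 * de) * lilscale R n <= (1 - de) * ((1 - de) * lilscale R n) - de * lilscale R n.
    have := mulr_ge0 (sqr_ge0 de) L0; nra.
  by lra.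
have [tn|tp] := leP tau 0.
  apply: (@le_trans _ _ 0); first by rewrite mulr_le0_ge0 // ltW.
  by rewrite mulr_ge0 //; lra.
apply: ler_pM => //; rewrite ?(ltW tp) ?(ltW lil0) //; lra.
Unshelve. all: by end_near. Qed.

End CenterLIL.

(** * Directions of the Euclidean space *)

Section Limits.
Variable R : realType.

Lemma limn_esup_eq (u : nat -> R) (c : R) :
  (forall e, 0 < e -> \forall n \near \oo, u n <= c + e) ->
  (forall e, 0 < e -> forall N, exists2 n, (N <= n)%N & c - e <= u n) ->
  limn_esup (fun n => (u n)%:E) = c%:E.
Proof.
move=> up lo; rewrite limn_esup_lim.
have ce : cvgn (esups (fun n => (u n)%:E)) by exact: is_cvg_esups.
apply/eqP; rewrite eq_le; apply/andP; split.
  apply/lee_addgt0Pr => e e0; rewrite -EFinD; apply: lime_le => //.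
  have [N _ NP] := up e e0; exists N => // n /= Nn.
  apply: ge_ereal_sup => _ [k /= nk <-]; rewrite lee_fin.
  by apply: NP; exact: leq_trans Nn nk.
apply/lee_addgt0Pr => e e0; rewrite -leeBlDr // -EFinB.
apply: lime_ge => //; near=> n.
have [k nk ck] := lo e e0 n.
apply: (@le_trans _ _ (u k)%:E); first by rewrite lee_fin.
by apply: ereal_sup_ubound; exists k.
Unshelve. all: by end_near. Qed.

Lemma cvg_mx (m n : nat) (f : nat -> 'M[R]_(m, n)) (M : 'M[R]_(m, n)) :
  (forall i j, (fun k => f k i j) @ \oo --> M i j) -> f @ \oo --> M.
Proof.
move=> fM; apply/cvg_mx_entourageP => A eA.
apply: filter_forall => i; apply: filter_forall => j.
have /fM := nbhs_entourage (M i j) eA; rewrite !nbhs_simpl /=.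
by apply: filterS => k /= /xsectionP; rewrite inE.
Qed.
End Limits.

Section Projections.
Variables (R : realType) (d : nat).
Hypothesis d0 : (1 <= d)%N.
Implicit Types u v : 'I_d -> R.
Let dR : (0 : R) < d%:R. Proof. by rewrite ltr0n. Qed.

Definition lin u (y : dir d) : R := sgn R y * u y.1.

Lemma sum_dir (f : dir d -> R) : \sum_y f y = \sum_(i < d) (f (i, true) + f (i, false)).
Proof.
rewrite (eq_bigr (fun y => (fun i b => f (i, b)) y.1 y.2)); last by case.
rewrite -(pair_bigA _ (fun i b => f (i, b))) /=.
by apply: eq_bigr => i _; rewrite big_bool.
Qed.

Lemma mean_lin u : mean (lin u) = 0.
Proof.
by rewrite /mean sum_dir big1 ?mulr0 // => i _; rewrite /lin /sgn /= mul1r mulN1r subrr.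
Qed.

Lemma var_lin u : mean (fun y => lin u y ^+ 2) = (\sum_i u i ^+ 2) / d%:R.
Proof.
rewrite /mean sum_dir (eq_bigr (fun i => 2 * u i ^+ 2)) => [|i _].
  by rewrite -mulr_sumr; field; rewrite gt_eqF.
by rewrite /lin /sgn /=; ring.
Qed.

Lemma lin_dirvec u y : lin u y = \sum_i u i * dirvec R y i 0.
Proof.
rewrite (bigD1 y.1) //= big1 => [|i /negbTE iy].
  by rewrite mxE eqxx addr0 /lin /sgn mulrC.
by rewrite mxE iy mulr0.
Qed.

Lemma lin1 y : lin (fun=> 1) y = sgn R y. Proof. by rewrite /lin mulr1. Qed.

Section Walk.
Variables (T : Type) (X : nat -> T -> dir d).

Lemma wsum_hist (g : dir d -> R) w n :
  wsum g (hist (X^~ w) n) = \sum_(1 <= i < n.+1) g (X i w).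
Proof.
elim: n => [|n IH]; first by rewrite big_geq // /wsum big_nil.
by rewrite big_nat_recr //= wsum_cons IH.
Qed.

Lemma possum_hist (g : dir d -> R) w n :
  possum g (hist (X^~ w) n) = \sum_(1 <= i < n.+1) wsum g (hist (X^~ w) i).
Proof.
elim: n => [|n IH]; first by rewrite big_geq.
by rewrite big_nat_recr //= IH.
Qed.

Lemma center_proj u w n :
  \sum_i u i * ERW_center R X n w i 0 = possum (lin u) (hist (X^~ w) n) / n%:R.
Proof.
have E i : ERW_center R X n w i 0 =
    n%:R^-1 * \sum_(1 <= k < n.+1) \sum_(1 <= l < k.+1) dirvec R (X l w) i 0.
  rewrite /ERW_center mxE summxE; congr (_ * _); apply: eq_bigr => k _.
  by rewrite /ERW_pos summxE.
under eq_bigr do rewrite E mulrCA.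
rewrite -mulr_sumr mulrC; congr (_ / _).
under eq_bigr do rewrite mulr_sumr.
rewrite exchange_big possum_hist; apply: eq_bigr => k _.
under eq_bigr do rewrite mulr_sumr.
rewrite exchange_big wsum_hist; apply: eq_bigr => l _.
by rewrite lin_dirvec.
Qed.
End Walk.

Definition grid (K : nat) (m : {ffun 'I_d -> 'I_(2 * K).+1}) (i : 'I_d) : R :=
  ((m i)%:R - K%:R) / K%:R.

(* Rounding the unit vector [v/|v|] to the grid of mesh [1/K] costs a factor
   [1 + O(d/K)], so finitely many directions control the Euclidean norm. *)
Lemma grid_net (K : nat) v : (d <= K)%N -> exists m,
  (1 - d%:R / K%:R) ^+ 2 * (\sum_i v i ^+ 2) <= (\sum_i @grid K m i * v i) ^+ 2 /\
  \sum_i @grid K m i ^+ 2 <= 1 + 3 * (d%:R / K%:R).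
Proof.
move=> dK; have K0 : (0 : R) < K%:R by rewrite ltr0n (leq_trans d0).
have dKR : d%:R / K%:R <= 1 :> R by rewrite ler_pdivrMr // mul1r ler_nat.
have dK0 : 0 <= d%:R / K%:R :> R by rewrite divr_ge0.
set Q := \sum_i v i ^+ 2.
have Q0 : 0 <= Q by apply: sumr_ge0 => i _; exact: sqr_ge0.
have [Qz|Qn] := eqVneq Q 0.
  exists [ffun=> inord K]; rewrite Qz mulr0; split; first exact: sqr_ge0.
  rewrite big1 => [|i _]; first by lra.
  by rewrite /grid ffunE inordK ?ltnS ?leq_pmull // subrr mul0r expr0n.
have Qp : 0 < Q by rewrite lt_neqAle eq_sym Qn.
pose r := Num.sqrt Q; have r0 : 0 < r by rewrite sqrtr_gt0.
have rE : r ^+ 2 = Q by rewrite sqr_sqrtr.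
pose x i := v i / r.
have x2 : \sum_i x i ^+ 2 = 1.
  rewrite (eq_bigr (fun i => v i ^+ 2 * r ^- 2)) => [|i _]; last by rewrite exprMn exprVn.
  by rewrite -mulr_suml -/Q rE divff.
have x1 i : `|x i| <= 1.
  rewrite -(ler_pXn2r (n := 2)) ?nnegrE // real_normK ?num_real // expr1n -x2.
  by rewrite (bigD1 i) //= lerDl sumr_ge0 // => j _; exact: sqr_ge0.
have xb i : 0 <= K%:R * (x i + 1) <= (2 * K)%:R.
  have := x1 i; rewrite ler_norml => /andP[? ?]; rewrite natrM [2%:R * _]mulrC.
  by rewrite mulr_ge0 ?(ltW K0) ?ler_wpM2l ?(ltW K0) //; lra.
pose m : {ffun 'I_d -> 'I_(2 * K).+1} := [ffun i => inord (Num.truncn (K%:R * (x i + 1)))].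
have mb i : 0 <= x i - grid m i <= K%:R^-1.
  have /andP[b0 b1] := xb i.
  have /andP[t0 t1] := truncn_itv b0.
  have tK : (Num.truncn (K%:R * (x i + 1)) < (2 * K).+1)%N.
    by rewrite ltnS -(ler_nat R); exact: le_trans b1.
  rewrite /grid ffunE inordK //; move: t0 t1; rewrite -(natr1 (Num.truncn _)).
  move: ((Num.truncn (K%:R * (x i + 1)))%:R : R) => t t0 t1.
  have -> : x i - (t - K%:R) / K%:R = (K%:R * (x i + 1) - t) / K%:R.
    by field; rewrite gt_eqF.
  rewrite divr_ge0 ?(ltW K0) ?subr_ge0 //= -[leRHS]mul1r ler_wpM2r ?invr_ge0 ?(ltW K0) //.
  by lra.
exists m; split; last first.
  apply: (@le_trans _ _ (\sum_(i < d) (x i ^+ 2 + 3 / K%:R))).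
    apply: ler_sum => i _; have /andP[m0 m1] := mb i; have := x1 i.
    have Ki : K%:R^-1 <= 1 :> R by rewrite invf_le1 // ler1n (leq_trans d0).
    rewrite ler_norml => /andP[z1 z2].
    have -> : grid m i = x i - (x i - grid m i) by rewrite subKr.
    move: (x i - grid m i) m0 m1 => de m0 m1.
    have d2 : de ^+ 2 <= de by rewrite expr2; nra.
    have zd : - (x i * de) <= de by nra.
    have -> : (x i - de) ^+ 2 = x i ^+ 2 + 2 * (- (x i * de)) + de ^+ 2 by ring.
    move: m1 d2 zd; move: (K%:R^-1 : R) (x i * de) (de ^+ 2) => ki a b; lra.
  rewrite big_split /= x2 sumr_const card_ord -[_ *+ d]mulr_natl lerD2l.
  by rewrite [leLHS]mulrCA lexx.
have E : \sum_i grid m i * v i = r * (1 - \sum_i (x i - grid m i) * x i).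
  rewrite -x2 -sumrB mulr_sumr; apply: eq_bigr => i _.
  by rewrite /x; field; rewrite gt_eqF.
have SB : \sum_i (x i - grid m i) * x i <= d%:R / K%:R.
  apply: (@le_trans _ _ (\sum_(i < d) K%:R^-1)).
    apply: ler_sum => i _; have /andP[m0 m1] := mb i.
    apply: le_trans (ler_norm _) _; rewrite normrM (ger0_norm m0) -[leRHS]mulr1.
    exact: ler_pM.
  by rewrite sumr_const card_ord -[_ *+ d]mulr_natl.
rewrite E exprMn rE mulrC ler_wpM2l // lerXn2r ?nnegrE; lra.
Qed.

End Projections.

(** * Polarisation and assembly of the three limits *)

Section Assembly.
Variables (R : realType) (d : nat).
Hypothesis d0 : (1 <= d)%N.
Let dR : (0 : R) < d%:R. Proof. by rewrite ltr0n. Qed.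

(** The vectors [e_i + e_j] and [e_i - e_j]: by polarisation [4 G_i G_j] is the difference of two
    squared projections, also when [i = j]. *)
Definition epm (i j : 'I_d) (b : bool) (l : 'I_d) : R :=
  (l == i)%:R + (if b then 1 else -1) * (l == j)%:R.

Lemma sum_delta (i : 'I_d) (v : 'I_d -> R) : \sum_l (l == i)%:R * v l = v i.
Proof.
rewrite (bigD1 i) //= eqxx mul1r big1 ?addr0 // => l /negbTE ->.
by rewrite mul0r.
Qed.

Lemma sum_epm i j b (v : 'I_d -> R) :
  \sum_l epm i j b l * v l = v i + (if b then 1 else -1) * v j.
Proof.
under eq_bigr do rewrite mulrDl -mulrA.
by rewrite big_split /= -mulr_sumr !sum_delta.
Qed.

Lemma var_epm i j : mean (fun y => lin (epm i j true) y ^+ 2) -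
  mean (fun y => lin (epm i j false) y ^+ 2) = 4 * (i == j)%:R / d%:R.
Proof.
rewrite !var_lin // -mulrBl -sumrB; congr (_ / _).
rewrite -(sum_delta i (fun l => (l == j)%:R)) mulr_sumr; apply: eq_bigr => l _.
by rewrite /epm; ring.
Qed.

(** Cauchy-Schwarz against [(1, ..., 1)]: a lower bound in this single direction bounds the norm
    from below, and the factor [d] turns [4/9] into the constant [4 / (9 d)] of the limsup. *)
Lemma sqr_sum_le (v : 'I_d -> R) : (\sum_i v i) ^+ 2 <= d%:R * \sum_i v i ^+ 2.
Proof.
set s := \sum_i v i; set Q := \sum_i v i ^+ 2.
have : 0 <= \sum_i (d%:R * v i - s) ^+ 2 by apply: sumr_ge0 => i _; exact: sqr_ge0.
rewrite (eq_bigr (fun i => d%:R ^+ 2 * v i ^+ 2 + ((- 2 * d%:R * s) * v i + s ^+ 2))); last first.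
  by move=> i _; ring.
rewrite !big_split /= -!mulr_sumr -/s -/Q sumr_const card_ord -[s *+ d]mulr_natl.
have -> : d%:R ^+ 2 * Q + (- 2 * d%:R * s * s + s * (d%:R * s)) = d%:R * (d%:R * Q - s ^+ 2) by ring.
by rewrite pmulr_rge0 // subr_ge0.
Qed.

End Assembly.

Theorem theorem2p5 (R : realType) (dT : measure_display) (T : measurableType dT)
  (P : probability T R) (d : nat) (X : nat -> T -> dir d) :
  (1 <= d)%N ->
  is_ERW P ((2 * d%:R + 1) / (4 * d%:R)) X ->
  {ae P, forall w,
    [/\ (fun n : nat =>
           (ln (ln n%:R))^-1 *:
             \sum_(2 <= k < n.+1)
               (((k%:R * ln k%:R) ^+ 2)^-1 *:
                  (ERW_center R X k w *m (ERW_center R X k w)^T)))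
          @ \oo --> ((4 / (9 * d%:R))%:M : 'M[R]_d),
        (fun n : nat =>
           (ln (ln n%:R))^-1 *
             \sum_(2 <= k < n.+1)
               (sqnorm (ERW_center R X k w) / (k%:R * ln k%:R) ^+ 2))
          @ \oo --> (4 / 9 : R)
      & limn_esup (fun n : nat =>
           (sqnorm (ERW_center R X n w) /
              (2 * n%:R * ln n%:R * ln (ln (ln n%:R))))%:E)
          = (4 / (9 * d%:R))%:E]}.
Proof.
move=> d0 XP; have dR : (0 : R) < d%:R by rewrite ltr0n.
have A1 : {ae P, forall w, forall ijb : 'I_d * 'I_d * bool,
   (fun n => (ln (ln n%:R))^-1 * \sum_(2 <= i < n.+1)
     ((possum (lin (epm R ijb.1.1 ijb.1.2 ijb.2)) (hist (X^~ w) i) / i%:R) ^+ 2 /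
      (i%:R * ln i%:R) ^+ 2)) @ \oo -->
   (4 / 9 * mean (fun y => lin (epm R ijb.1.1 ijb.1.2 ijb.2) y ^+ 2) : R)}.
  by apply: filter_forall => ijb; apply: (possum_qsl_ae d0 XP); exact: mean_lin.
have A2 : {ae P, forall w, forall K (m : {ffun 'I_d -> 'I_(2 * K).+1}) tau,
   mean (fun y => lin (grid R m) y ^+ 2) < tau ->
   \forall n \near \oo, (possum (lin (grid R m)) (hist (X^~ w) n) / n%:R) ^+ 2 <= 4 / 9 * tau * lil R n}.
  apply: ae_foralln => K; apply: filter_forall => m.
  by apply: (possum_upper_ae d0 XP); exact: mean_lin.
have A3 := possum_lower_ae d0 XP.
apply: filterS3 A1 A2 A3 => w Q U Lo.
pose G n i := ERW_center R X n w i 0.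
have GE u n : \sum_i u i * G n i = possum (lin u) (hist (X^~ w) n) / n%:R by exact: center_proj.
have ent i j : (fun n => (ln (ln n%:R))^-1 *
    \sum_(2 <= k < n.+1) ((k%:R * ln k%:R) ^+ 2)^-1 * (G k i * G k j)) @ \oo -->
    (4 / (9 * d%:R) * (i == j)%:R : R).
  have E : 4^-1 * (4 / 9 * mean (fun y => lin (epm R i j true) y ^+ 2) -
      4 / 9 * mean (fun y => lin (epm R i j false) y ^+ 2)) = 4 / (9 * d%:R) * (i == j)%:R.
    by rewrite -mulrBr var_epm //; field; rewrite gt_eqF.
  rewrite -E.
  pose f b n : R := (ln (ln n%:R))^-1 * \sum_(2 <= k < n.+1)
     ((possum (lin (epm R i j b)) (hist (X^~ w) k) / k%:R) ^+ 2 / (k%:R * ln k%:R) ^+ 2).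
  have -> : (fun n => (ln (ln n%:R))^-1 *
      \sum_(2 <= k < n.+1) ((k%:R * ln k%:R) ^+ 2)^-1 * (G k i * G k j)) =
      (fun n => 4^-1 * (f true n - f false n)).
    apply/funext => n; rewrite /f -mulrBr mulrCA; congr (_ * _).
    rewrite -sumrB mulr_sumr; apply: eq_bigr => k _.
    rewrite -!GE !sum_epm -mulrBl [LHS]mulrC [RHS]mulrA; congr (_ / _).
    by field.
  apply: cvgMl_tmp; apply: cvgB; [exact: (Q (i, j, true))|exact: (Q (i, j, false))].
split.
- apply: cvg_mx => i j; rewrite mxE -[_ *+ (i == j)]mulr_natr.
  rewrite (_ : (fun n => _) = (fun n => (ln (ln n%:R))^-1 *
    \sum_(2 <= k < n.+1) ((k%:R * ln k%:R) ^+ 2)^-1 * (G k i * G k j))); first exact: ent.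
  apply/funext => n; rewrite mxE summxE; congr (_ * _).
  apply: eq_bigr => k _; rewrite mxE; congr (_ * _).
  by rewrite mxE big_ord1 [X in _ * X]mxE.
(* The second limit is the trace of the first. *)
- have -> : 4 / 9 = \sum_(i < d) (4 / (9 * d%:R) * (i == i)%:R) :> R.
    under eq_bigr do rewrite eqxx mulr1.
    by rewrite sumr_const card_ord -[RHS]mulr_natl; field; rewrite gt_eqF.
  have : (fun n => \sum_(i < d) ((ln (ln n%:R))^-1 *
      \sum_(2 <= k < n.+1) ((k%:R * ln k%:R) ^+ 2)^-1 * (G k i * G k i))) @ \oo -->
      (\sum_(i < d) (4 / (9 * d%:R) * (i == i)%:R) : R).
    by apply: cvg_big => //; exact: add_continuous.
  rewrite (_ : (fun n => \sum_(i < d) _) = (fun n => (ln (ln n%:R))^-1 *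
    \sum_(2 <= k < n.+1) (sqnorm (ERW_center R X k w) / (k%:R * ln k%:R) ^+ 2))) //.
  apply/funext => n; rewrite -mulr_sumr; congr (_ * _); rewrite exchange_big; apply: eq_bigr => k _.
  by rewrite /sqnorm mulr_suml; apply: eq_bigr => i _; rewrite mulrC -expr2.
pose c : R := 4 / (9 * d%:R); have c0 : 0 < c by rewrite divr_gt0 // mulr_gt0.
have SE n : sqnorm (ERW_center R X n w) = \sum_i G n i ^+ 2 by [].
apply: (@limn_esup_eq R (fun n => sqnorm (ERW_center R X n w) / lil R n)).
- move=> e e0; rewrite -/c.
  have c14 : 0 < 14 * c + 2 by lra.
  (* The ratio [x = d / K] must satisfy [x <= 1/4] and [x * (14 c + 2) <= e]: the net inflates [c]
     to [(1 + 6 x) * (c (1 + 3 x) + 4/9 x)], which exceeds [c] by at most [x * (14 c + 2)]. *)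
  pose K := (maxn (4 * d) (Num.bound (d%:R * (14 * c + 2) / e))).+1.
  pose x : R := d%:R / K%:R.
  have K0 : (0 : R) < K%:R by [].
  have dK : (d <= K)%N by rewrite /K; lia.
  have x0 : 0 <= x by rewrite divr_ge0.
  have x4 : x <= 1 / 4.
    rewrite ler_pdivrMr // mulrC mul1r ler_pdivlMr // -natrM ler_nat /K; lia.
  have xe : x * (14 * c + 2) <= e.
    rewrite /x mulrAC ler_pdivrMr // [e * _]mulrC -ler_pdivrMr //.
    apply: le_trans (ltW (archi_boundP _)) _.
      by rewrite divr_ge0 ?mulr_ge0 ?(ltW c14) ?(ltW e0).
    by rewrite ler_nat /K leqW // leq_maxr.
  have x00 : 0 < x by rewrite divr_gt0.
  (* The first summand bounds the variance along any grid vector given by [grid_net]; the extra [x]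
     makes the inequality strict. *)
  pose tau := (1 + 3 * x) / d%:R + x.
  have UK : \forall n \near \oo, forall m : {ffun 'I_d -> 'I_(2 * K).+1},
      \sum_i grid R m i ^+ 2 <= 1 + 3 * x -> (\sum_i grid R m i * G n i) ^+ 2 <= 4 / 9 * tau * lil R n.
    apply: filter_forall => m.
    case: (leP (\sum_i grid R m i ^+ 2) (1 + 3 * x)) => gm; last by apply: nearW.
    have : mean (fun y => lin (grid R m) y ^+ 2) < tau.
      by rewrite var_lin // /tau; apply: (@le_lt_trans _ _ ((1 + 3 * x) / d%:R)); rewrite ?ltrDl // ler_pM2r ?invr_gt0.
    by move=> /(U K m tau); apply: filterS => n; rewrite GE.
  near=> n; have l0 : 0 < lil R n by near: n; exact: near_lil_gt0.
  rewrite ler_pdivrMr // SE.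
  have [m [m1 m2]] := grid_net d0 (G n) dK.
  have m3 : (\sum_i grid R m i * G n i) ^+ 2 <= 4 / 9 * tau * lil R n.
    by move: m2; move: (m); near: n; exact: UK.
  have := le_trans m1 m3; rewrite -/x; move: (\sum_i G n i ^+ 2) => q qb.
  have x1 : 0 < (1 - x) ^+ 2 by rewrite exprn_gt0 //; lra.
  rewrite -(ler_pM2l x1); apply: le_trans qb _; rewrite [leRHS]mulrA ler_wpM2r ?(ltW l0) //.
  have tE : 4 / 9 * tau = c * (1 + 3 * x) + 4 / 9 * x by rewrite /tau /c; field; rewrite gt_eqF.
  have cx : 0 <= c * x by rewrite mulr_ge0 // ltW.
  (* A division-free form of [(1 - x)^-2 <= 1 + 6 x], valid since [x <= 1/4]. *)
  have inv : 1 <= (1 - x) ^+ 2 * (1 + 6 * x).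
    have -> : (1 - x) ^+ 2 * (1 + 6 * x) = 1 + x * (4 - 11 * x + 6 * x ^+ 2) by ring.
    rewrite lerDl mulr_ge0 //; have := sqr_ge0 x; lra.
  apply: (@le_trans _ _ ((1 - x) ^+ 2 * (1 + 6 * x) * (4 / 9 * tau))).
    by rewrite ler_peMl // tE; lra.
  rewrite -mulrA ler_pM2l // tE.
  have xx : x ^+ 2 <= x / 4 by rewrite expr2; nra.
  have cxx : c * x ^+ 2 <= c * x / 4 by rewrite -mulrA ler_wpM2l // ltW.
  have -> : (1 + 6 * x) * (c * (1 + 3 * x) + 4 / 9 * x) =
    c + 9 * (c * x) + 18 * (c * x ^+ 2) + 4 / 9 * x + 24 / 9 * x ^+ 2 by field.
  lra.
- move=> e e0 N; rewrite -/c.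
  (* With [tau = 1 - e / c] the bound [4 / 9 * tau / d] is exactly [c - e]. *)
  have t1 : 1 - e / c < 1 by rewrite ltrBlDr ltrDl divr_gt0.
  have [N1 _ N1P] := near_lil_gt0 R.
  have [n] := Lo _ t1 (maxn N N1); rewrite geq_max => /andP[Nn N1n] B.
  exists n => //; have l0 := N1P n N1n; rewrite ler_pdivlMr // SE.
  have lE : possum (@sgn R d) (hist (X^~ w) n) / n%:R = \sum_i G n i.
    rewrite -[RHS](eq_bigr _ (fun i _ => mul1r (G n i))) (GE (fun=> 1)).
    by congr (possum _ _ / _); apply/funext => y; rewrite lin1.
  rewrite lE in B; have := le_trans B (sqr_sum_le d0 (G n)).
  rewrite [d%:R * _]mulrC -ler_pdivrMr // => B'; apply: le_trans B'.
  rewrite le_eqVlt; apply/orP; left; apply/eqP; rewrite /c.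
  by field; rewrite gt_eqF.
Unshelve. all: by end_near. Qed.
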